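(* Let $K$ be a field, $H$ a finite hypergraph and $L(H)$ its Leavitt path algebra over $K$. The general linear groupoid $\mathbf G(L(H))$ (with respect to the vertex set $H^0$) is generated by the sets $$\operatorname{E}_\sigma(L(H)),\quad\operatorname{F}_{\sigma\times\tau}(L(H)),\quad\operatorname{P}_{\sigma\times\tau}(K)\qquad(\sigma,\tau\in\mathcal S).$$
   Context: A (directed) hypergraph is $H=(H^0,H^1,r,s)$ with sets $H^0$ (vertices), $H^1$ (hyperedges) and maps $r,s$ associating to each $h\in H^1$ nonempty families $r(h)=(r(h)_j)_{j\in J_h}$ and $s(h)=(s(h)_i)_{i\in I_h}$ of (not necessarily distinct) elements of $H^0$. It is finite if $H^0$ and $H^1$ are finite; all index sets $I_h,J_h$ are finite. The Leavitt path algebra $L=L(H)$ is the $K$-algebra presented by generators $v,h_{ij},h_{ij}^*$ ($v\in H^0$, $h\in H^1$, $i\in I_h$, $j\in J_h$) and relations: (i) $uv=\delta_{uv}u$; (ii) $s(h)_ih_{ij}=h_{ij}=h_{ij}r(h)_j$, $r(h)_jh_{ij}^*=h_{ij}^*=h_{ij}^*s(h)_i$; (iii) $\sum_{j\in J_h}h_{ij}h_{i'j}^*=\delta_{ii'}s(h)_i$ ($i,i'\in I_h$); (iv) $\sum_{i\in I_h}h_{ij}^*h_{ij'}=\delta_{jj'}r(h)_j$ ($j,j'\in J_h$). It is unital with $1=\sum_{v\in H^0}v$, so $H^0$ is a complete set of orthogonal idempotents. Write $H^1=\{h^{(1)},\dots,h^{(p)}\}$, $I_{h^{(i)}}=\{1,\dots,m_i\}$,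 $J_{h^{(i)}}=\{1,\dots,n_i\}$. Put $\mathcal S=\bigcup_{n\ge1}(H^0)^n$. For $\sigma\in(H^0)^m$, $\tau\in(H^0)^n$, $\mathbb M_{\sigma\times\tau}(L)$ is the set of $m\times n$ matrices $A$ with $A_{ij}\in\sigma_iL\tau_j$; $I_\sigma=\operatorname{diag}(\sigma_1,\dots,\sigma_m)$; $\operatorname{GL}_{\sigma\times\tau}(L)$ is the set of $A\in\mathbb M_{\sigma\times\tau}(L)$ for which there is $B\in\mathbb M_{\tau\times\sigma}(L)$ with $AB=I_\sigma$, $BA=I_\tau$; $\operatorname{GL}_\sigma(L)=\operatorname{GL}_{\sigma\times\sigma}(L)$. The groupoid $\mathbf G(L)$ has object set $\mathcal S$, $\operatorname{Hom}(\sigma,\tau)=\operatorname{GL}_{\tau\times\sigma}(L)$ and composition given by matrix multiplication. The subgroupoid generated by a set $S$ of morphisms has as objects all sources and targets of elements of $S$ and as morphisms all finite compositions of morphisms from $S\cup S^{-1}$. $\operatorname{E}_\sigma(L)$ is the subgroup of $\operatorname{GL}_\sigma(L)$ generated by all elementary matrices $E_{ij}(x)=I_\sigma+e_{ij}(x)$, $i\ne j$, $x\in\sigma_iL\sigma_j$, where $e_{ij}(x)$ has entry $x$ at $(i,j)$ and $0$ elsewhere. $\operatorname{F}_{\sigma\times\tau}(L)$ is the set of all block-diagonal matrices $A=\operatorname{diag}(A_1,\dots,A_\ell)\in\operatorname{GL}_{\sigma\times\tau}(L)$ such that each block is either (i) the $1\times 1$ matrix $(v)$ with $v\in H^0$,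 or (ii) the $m_i\times n_i$ matrix $(h^{(i)}_{jj'})_{1\le j\le m_i,1\le j'\le n_i}$ for some $1\le i\le p$, or (iii) the $n_i\times m_i$ matrix whose $(j',j)$ entry is $(h^{(i)}_{jj'})^*$, for some $1\le i\le p$. For $\sigma,\tau\in(H^0)^n$, $\operatorname{P}_{\sigma\times\tau}(K)$ is the set of generalised permutation matrices, i.e. of matrices $P\in\operatorname{GL}_{\sigma\times\tau}(L)$ such that for some permutation $\pi$ of $\{1,\dots,n\}$ with $\sigma_i=\tau_{\pi(i)}$ for all $i$ and some $k_1,\dots,k_n\in K^\times$ one has $P_{ij}=\delta_{j,\pi(i)}k_i\sigma_i$ for all $i,j$. ($\operatorname{P}_{\sigma\times\tau}(K)$ is empty if there is no such $\pi$.) *)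

(* Defs.v *)
From HB Require Import structures.
From mathcomp Require Import all_boot all_order all_fingroup all_algebra.
From mathcomp Require Import generic_quotient.
From mathcomp Require Import boolp.

Set Implicit Arguments.
Unset Strict Implicit.
Unset Printing Implicit Defensive.

Import GRing.Theory.
Local Open Scope ring_scope.
Local Open Scope quotient_scope.

(* The index sets I_h and J_h are 'I_(nsrc h) and 'I_(nrng h). *)
Record hypergraph := Hypergraph {
  vertex : finType;
  hedge : finType;
  nsrc : hedge -> nat;
  nrng : hedge -> nat;
  nsrc_gt0 : forall h, (0 < nsrc h)%N;
  nrng_gt0 : forall h, (0 < nrng h)%N;
  hsrc : forall h, 'I_(nsrc h) -> vertex;
  hrng : forall h, 'I_(nrng h) -> vertex
}.

(* The presentation is taken in the category of associative, not necessarily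
   unital K-algebras: [lterm] are the formal expressions in the generators (no
   constant for a unit), and [lcongr] is the smallest K-algebra congruence
   containing the defining relations.  That the sum of the vertices is a unit
   is then a consequence. *)

Inductive lterm (K : fieldType) (H : hypergraph) : Type :=
| TVert of vertex H
| TEdge (h : hedge H) of 'I_(nsrc h) & 'I_(nrng h)
| TStar (h : hedge H) of 'I_(nsrc h) & 'I_(nrng h)
| TZero
| TAdd of lterm K H & lterm K H
| TScale of K & lterm K H
| TMul of lterm K H & lterm K H.

Arguments TVert {K H} _.
Arguments TEdge {K H} h _ _.
Arguments TStar {K H} h _ _.
Arguments TZero {K H}.

Inductive lcongr (K : fieldType) (H : hypergraph) :
    lterm K H -> lterm K H -> Prop :=
| lc_refl t : lcongr t t
| lc_sym t u : lcongr t u -> lcongr u t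
| lc_trans t u w : lcongr t u -> lcongr u w -> lcongr t w
| lc_add t t' u u' :
    lcongr t t' -> lcongr u u' -> lcongr (TAdd t u) (TAdd t' u')
| lc_scale a t t' : lcongr t t' -> lcongr (TScale a t) (TScale a t')
| lc_mul t t' u u' :
    lcongr t t' -> lcongr u u' -> lcongr (TMul t u) (TMul t' u')
| lc_addA t u w : lcongr (TAdd t (TAdd u w)) (TAdd (TAdd t u) w)
| lc_addC t u : lcongr (TAdd t u) (TAdd u t)
| lc_add0 t : lcongr (TAdd TZero t) t
| lc_addN t : lcongr (TAdd (TScale (-1) t) t) TZero
| lc_scaleA a b t : lcongr (TScale a (TScale b t)) (TScale (a * b) t)
| lc_scale1 t : lcongr (TScale 1 t) t
| lc_scaleDr a t u :
    lcongr (TScale a (TAdd t u)) (TAdd (TScale a t) (TScale a u))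
| lc_scaleDl a b t :
    lcongr (TScale (a + b) t) (TAdd (TScale a t) (TScale b t))
| lc_mulA t u w : lcongr (TMul t (TMul u w)) (TMul (TMul t u) w)
| lc_mulDl t u w : lcongr (TMul (TAdd t u) w) (TAdd (TMul t w) (TMul u w))
| lc_mulDr t u w : lcongr (TMul t (TAdd u w)) (TAdd (TMul t u) (TMul t w))
| lc_scaleAl a t u : lcongr (TScale a (TMul t u)) (TMul (TScale a t) u)
| lc_scaleAr a t u : lcongr (TScale a (TMul t u)) (TMul t (TScale a u))
| lc_vert (u v : vertex H) :
    lcongr (TMul (TVert u) (TVert v)) (if u == v then TVert u else TZero)
| lc_src_edge h i j :
    lcongr (TMul (TVert (@hsrc H h i)) (TEdge h i j)) (TEdge h i j)
| lc_edge_rng h i j :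
    lcongr (TMul (TEdge h i j) (TVert (@hrng H h j))) (TEdge h i j)
| lc_rng_star h i j :
    lcongr (TMul (TVert (@hrng H h j)) (TStar h i j)) (TStar h i j)
| lc_star_src h i j :
    lcongr (TMul (TStar h i j) (TVert (@hsrc H h i))) (TStar h i j)
| lc_edge_star (h : hedge H) (i i' : 'I_(nsrc h)) :
    lcongr (\big[@TAdd K H/TZero]_(j < nrng h) TMul (TEdge h i j) (TStar h i' j))
           (if i == i' then TVert (hsrc i) else TZero)
| lc_star_edge (h : hedge H) (j j' : 'I_(nrng h)) :
    lcongr (\big[@TAdd K H/TZero]_(i < nsrc h) TMul (TStar h i j) (TEdge h i j'))
           (if j == j' then TVert (hrng j) else TZero).

Section LeavittPathAlgebra.
Variables (K : fieldType) (H : hypergraph).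
Implicit Types (t u w : lterm K H).

HB.instance Definition _ := gen_eqMixin (lterm K H).
HB.instance Definition _ := gen_choiceMixin (lterm K H).

Definition lcongrb : rel (lterm K H) := fun t u => `[< lcongr t u >].

Lemma lcongrb_refl : reflexive lcongrb.
Proof. by move=> t; apply/asboolP; exact: lc_refl. Qed.

Lemma lcongrb_sym : symmetric lcongrb.
Proof. by move=> t u; apply/asboolP/asboolP; exact: lc_sym. Qed.

Lemma lcongrb_trans : transitive lcongrb.
Proof.
move=> u t w /asboolP tu /asboolP uw; apply/asboolP; exact: lc_trans tu uw.
Qed.

Definition lcongr_equiv := EquivRel lcongrb lcongrb_refl lcongrb_sym lcongrb_trans.

Definition lpa : Type := {eq_quot lcongr_equiv}.
HB.instance Definition _ := Choice.on lpa.
HB.instance Definition _ := EqQuotient.on lpa.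

Definition lpi (t : lterm K H) : lpa := \pi_lpa t.

Lemma lpi_eqP t u : lpi t = lpi u <-> lcongr t u.
Proof.
split=> [/eqmodP/asboolP //|tu]; apply/eqmodP; exact/asboolP.
Qed.

Lemma lpi_repr (x : lpa) : lpi (repr x) = x.
Proof. exact: reprK. Qed.

Lemma lpa_ind (P : lpa -> Prop) : (forall t, P (lpi t)) -> forall x, P x.
Proof. by move=> Pt x; rewrite -(lpi_repr x). Qed.

Definition lpa_zero : lpa := lpi TZero.
Definition lpa_add (x y : lpa) : lpa := lpi (TAdd (repr x) (repr y)).
Definition lpa_scale (a : K) (x : lpa) : lpa := lpi (TScale a (repr x)).
Definition lpa_opp (x : lpa) : lpa := lpa_scale (-1) x.
Definition lpa_mul (x y : lpa) : lpa := lpi (TMul (repr x) (repr y)).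

Lemma repr_lpi t : lcongr (repr (lpi t)) t.
Proof. by apply/lpi_eqP; rewrite lpi_repr. Qed.

Lemma lpa_addE t u : lpa_add (lpi t) (lpi u) = lpi (TAdd t u).
Proof. by apply/lpi_eqP; apply: lc_add; apply: repr_lpi. Qed.

Lemma lpa_scaleE a t : lpa_scale a (lpi t) = lpi (TScale a t).
Proof. by apply/lpi_eqP; apply: lc_scale; apply: repr_lpi. Qed.

Lemma lpa_mulE t u : lpa_mul (lpi t) (lpi u) = lpi (TMul t u).
Proof. by apply/lpi_eqP; apply: lc_mul; apply: repr_lpi. Qed.

Let lpaE := (lpa_addE, lpa_scaleE, lpa_mulE).

Fact lpa_addA : associative lpa_add.
Proof.
elim/lpa_ind=> t; elim/lpa_ind=> u; elim/lpa_ind=> w; rewrite !lpaE.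
by apply/lpi_eqP; exact: lc_addA.
Qed.

Fact lpa_addC : commutative lpa_add.
Proof.
elim/lpa_ind=> t; elim/lpa_ind=> u; rewrite !lpaE.
by apply/lpi_eqP; exact: lc_addC.
Qed.

Fact lpa_add0 : left_id lpa_zero lpa_add.
Proof.
elim/lpa_ind=> t; rewrite /lpa_zero !lpaE.
by apply/lpi_eqP; exact: lc_add0.
Qed.

Fact lpa_addN : left_inverse lpa_zero lpa_opp lpa_add.
Proof.
elim/lpa_ind=> t; rewrite /lpa_opp !lpaE.
by apply/lpi_eqP; exact: lc_addN.
Qed.

HB.instance Definition _ :=
  GRing.isZmodule.Build lpa lpa_addA lpa_addC lpa_add0 lpa_addN.

Fact lpa_scaleA a b (x : lpa) :
  lpa_scale a (lpa_scale b x) = lpa_scale (a * b) x.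
Proof.
elim/lpa_ind: x => t; rewrite !lpaE.
by apply/lpi_eqP; exact: lc_scaleA.
Qed.

Fact lpa_scale1 : left_id 1 lpa_scale.
Proof.
by elim/lpa_ind=> t; rewrite !lpaE; apply/lpi_eqP; exact: lc_scale1.
Qed.

Fact lpa_scaleDr : right_distributive lpa_scale +%R.
Proof.
move=> a; elim/lpa_ind=> t; elim/lpa_ind=> u; rewrite /GRing.add /= !lpaE.
by apply/lpi_eqP; exact: lc_scaleDr.
Qed.

Fact lpa_scaleDl (x : lpa) : {morph lpa_scale^~ x : a b / a + b}.
Proof.
move=> a b; elim/lpa_ind: x => t /=; rewrite [RHS]/GRing.add /= !lpaE.
by apply/lpi_eqP; exact: lc_scaleDl.
Qed.

HB.instance Definition _ := GRing.Zmodule_isLmodule.Build K lpa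
  lpa_scaleA lpa_scale1 lpa_scaleDr lpa_scaleDl.

Lemma lpi_zero : lpi TZero = 0. Proof. by []. Qed.

Lemma lpi_add t u : lpi (TAdd t u) = lpi t + lpi u.
Proof. by rewrite -lpaE. Qed.

Lemma lpi_scale a t : lpi (TScale a t) = a *: lpi t.
Proof. by rewrite -lpaE. Qed.

Lemma lpi_sum (I : finType) (F : I -> lterm K H) :
  lpi (\big[@TAdd K H/TZero]_i F i) = \sum_i lpi (F i).
Proof. exact: (big_morph lpi lpi_add lpi_zero). Qed.

Definition lvert (v : vertex H) : lpa := lpi (TVert v).
Definition ledge (h : hedge H) i j : lpa := lpi (TEdge h i j).
Definition lstar (h : hedge H) i j : lpa := lpi (TStar h i j).

Definition lpa_one : lpa := \sum_(v : vertex H) lvert v.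

Fact lpa_mulA : associative lpa_mul.
Proof.
elim/lpa_ind=> t; elim/lpa_ind=> u; elim/lpa_ind=> w; rewrite !lpaE.
by apply/lpi_eqP; exact: lc_mulA.
Qed.

Fact lpa_mulDl : left_distributive lpa_mul +%R.
Proof.
elim/lpa_ind=> t; elim/lpa_ind=> u; elim/lpa_ind=> w.
rewrite /GRing.add /= !lpaE.
by apply/lpi_eqP; exact: lc_mulDl.
Qed.

Fact lpa_mulDr : right_distributive lpa_mul +%R.
Proof.
elim/lpa_ind=> t; elim/lpa_ind=> u; elim/lpa_ind=> w.
rewrite /GRing.add /= !lpaE.
by apply/lpi_eqP; exact: lc_mulDr.
Qed.

Fact lpa_scaleAl a (x y : lpa) : a *: lpa_mul x y = lpa_mul (a *: x) y.
Proof.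
elim/lpa_ind: x => t; elim/lpa_ind: y => u.
rewrite /GRing.scale /= !lpaE.
by apply/lpi_eqP; exact: lc_scaleAl.
Qed.

Fact lpa_scaleAr a (x y : lpa) : a *: lpa_mul x y = lpa_mul x (a *: y).
Proof.
elim/lpa_ind: x => t; elim/lpa_ind: y => u.
rewrite /GRing.scale /= !lpaE.
by apply/lpi_eqP; exact: lc_scaleAr.
Qed.

Fact lpa_mul0l (x : lpa) : lpa_mul 0 x = 0.
Proof. by have := lpa_scaleAl 0 0 x; rewrite !scale0r => <-. Qed.

Fact lpa_mul0r (x : lpa) : lpa_mul x 0 = 0.
Proof. by have := lpa_scaleAr 0 x 0; rewrite !scale0r => <-. Qed.

Fact lpa_vertM (u v : vertex H) : lpa_mul (lvert u) (lvert v) = if u == v then lvert u else 0.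
Proof.
rewrite /lvert lpaE; transitivity (lpi (if u == v then TVert u else TZero)).
  by apply/lpi_eqP; exact: lc_vert.
by case: eqP.
Qed.

Fact lpa_one_vert v : lpa_mul lpa_one (lvert v) = lvert v.
Proof.
rewrite /lpa_one (big_morph (lpa_mul^~ (lvert v)) (id1 := 0) (op1 := +%R)).
- rewrite (bigD1 v) //= lpa_vertM eqxx big1 ?addr0 // => u /negPf uv.
  by rewrite lpa_vertM uv.
- by move=> x y; rewrite lpa_mulDl.
- exact: lpa_mul0l.
Qed.

Fact lpa_vert_one v : lpa_mul (lvert v) lpa_one = lvert v.
Proof.
rewrite /lpa_one (big_morph (lpa_mul (lvert v)) (id1 := 0) (op1 := +%R)).
- rewrite (bigD1 v) //= lpa_vertM eqxx big1 ?addr0 // => u /negPf uv.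
  by rewrite lpa_vertM eq_sym uv.
- by move=> x y; rewrite lpa_mulDr.
- exact: lpa_mul0r.
Qed.

Fact lpa_mul1l : left_id lpa_one lpa_mul.
Proof.
elim/lpa_ind; elim=> [v|h i j|h i j||t IHt u IHu|a t IHt|t IHt u _].
- exact: lpa_one_vert.
- have -> : lpi (TEdge h i j) = lpa_mul (lvert (hsrc i)) (ledge i j).
    by rewrite lpa_mulE; symmetry; apply/lpi_eqP; exact: lc_src_edge.
  by rewrite lpa_mulA lpa_one_vert.
- have -> : lpi (TStar h i j) = lpa_mul (lvert (hrng j)) (lstar i j).
    by rewrite lpa_mulE; symmetry; apply/lpi_eqP; exact: lc_rng_star.
  by rewrite lpa_mulA lpa_one_vert.
- exact: lpa_mul0r.
- by rewrite lpi_add lpa_mulDr IHt IHu.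
- by rewrite lpi_scale -lpa_scaleAr IHt.
- by rewrite -lpa_mulE lpa_mulA IHt.
Qed.

Fact lpa_mul1r : right_id lpa_one lpa_mul.
Proof.
elim/lpa_ind; elim=> [v|h i j|h i j||t IHt u IHu|a t IHt|t _ u IHu].
- exact: lpa_vert_one.
- have -> : lpi (TEdge h i j) = lpa_mul (ledge i j) (lvert (hrng j)).
    by rewrite lpa_mulE; symmetry; apply/lpi_eqP; exact: lc_edge_rng.
  by rewrite -lpa_mulA lpa_vert_one.
- have -> : lpi (TStar h i j) = lpa_mul (lstar i j) (lvert (hsrc i)).
    by rewrite lpa_mulE; symmetry; apply/lpi_eqP; exact: lc_star_src.
  by rewrite -lpa_mulA lpa_vert_one.
- exact: lpa_mul0l.
- by rewrite lpi_add lpa_mulDl IHt IHu.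
- by rewrite lpi_scale -lpa_scaleAl IHt.
- by rewrite -lpa_mulE -lpa_mulA IHu.
Qed.

(* [lpa] is the zero ring when H has no vertices, hence only a [pzRingType];
   MathComp's [algType] requires 1 != 0, so the compatibility of the scalars
   with the product is given by [lpaZAl] and [lpaZAr] below. *)
HB.instance Definition _ := GRing.Zmodule_isPzRing.Build lpa
  lpa_mulA lpa_mul1l lpa_mul1r lpa_mulDl lpa_mulDr.

Lemma lpaZAl a (x y : lpa) : a *: (x * y) = (a *: x) * y.
Proof. exact: lpa_scaleAl. Qed.

Lemma lpaZAr a (x y : lpa) : a *: (x * y) = x * (a *: y).
Proof. exact: lpa_scaleAr. Qed.

Lemma lpi_mul t u : lpi (TMul t u) = lpi t * lpi u.
Proof. by rewrite -lpa_mulE. Qed.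

Lemma lpa_oneE : 1 = \sum_(v : vertex H) lvert v. Proof. by []. Qed.

Lemma lvertM (u v : vertex H) : lvert u * lvert v = if u == v then lvert u else 0.
Proof. exact: lpa_vertM. Qed.

Lemma lsrc_edge (h : hedge H) i j :
  lvert (hsrc i) * ledge (h := h) i j = ledge i j.
Proof. by rewrite -lpi_mul; apply/lpi_eqP; exact: lc_src_edge. Qed.

Lemma ledge_rng (h : hedge H) i j :
  ledge (h := h) i j * lvert (hrng j) = ledge i j.
Proof. by rewrite -lpi_mul; apply/lpi_eqP; exact: lc_edge_rng. Qed.

Lemma lrng_star (h : hedge H) i j :
  lvert (hrng j) * lstar (h := h) i j = lstar i j.
Proof. by rewrite -lpi_mul; apply/lpi_eqP; exact: lc_rng_star. Qed.

Lemma lstar_src (h : hedge H) i j :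
  lstar (h := h) i j * lvert (hsrc i) = lstar i j.
Proof. by rewrite -lpi_mul; apply/lpi_eqP; exact: lc_star_src. Qed.

Lemma ledge_star (h : hedge H) (i i' : 'I_(nsrc h)) :
  \sum_j ledge i j * lstar i' j = if i == i' then lvert (hsrc i) else 0.
Proof.
under eq_bigr do rewrite -lpi_mul.
rewrite -lpi_sum (iffRL (lpi_eqP _ _) (lc_edge_star K i i')).
by case: eqP.
Qed.

Lemma lstar_edge (h : hedge H) (j j' : 'I_(nrng h)) :
  \sum_i lstar i j * ledge i j' = if j == j' then lvert (hrng j) else 0.
Proof.
under eq_bigr do rewrite -lpi_mul.
rewrite -lpi_sum (iffRL (lpi_eqP _ _) (lc_star_edge K j j')).
by case: eqP.
Qed.

End LeavittPathAlgebra.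

Arguments lvert {K H} v.
Arguments ledge {K H h} i j.
Arguments lstar {K H h} i j.

Section Matrices.
Variables (K : fieldType) (H : hypergraph).
Notation L := (lpa K H).
Notation V := (vertex H).

(* u L v *)
Definition in_corner (u v : V) (x : L) : Prop :=
  exists y : L, x = lvert u * y * lvert v.

Definition in_M m n (s : m.-tuple V) (t : n.-tuple V) (A : 'M[L]_(m, n)) : Prop :=
  forall i j, in_corner (tnth s i) (tnth t j) (A i j).

Definition Imx n (s : n.-tuple V) : 'M[L]_n :=
  diag_mx (\row_i lvert (tnth s i)).

Definition in_GL m n (s : m.-tuple V) (t : n.-tuple V) (A : 'M[L]_(m, n)) : Prop :=
  in_M s t A /\
  exists B : 'M[L]_(n, m), [/\ in_M t s B, A *m B = Imx s & B *m A = Imx t].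

Lemma in_cornerP u v (x : L) :
  in_corner u v x <-> lvert u * x = x /\ x * lvert v = x.
Proof.
split=> [[y ->]|[ux xv]]; last by exists x; rewrite ux xv.
by split; rewrite -?mulrA ?lvertM ?eqxx // !mulrA lvertM eqxx.
Qed.

Lemma in_MP m n (s : m.-tuple V) (t : n.-tuple V) (A : 'M[L]_(m, n)) :
  in_M s t A <-> Imx s *m A = A /\ A *m Imx t = A.
Proof.
rewrite /Imx mul_diag_mx mul_mx_diag; split=> [sAt|[/matrixP sA /matrixP At] i j].
  by split; apply/matrixP=> i j; rewrite !mxE; case/in_cornerP: (sAt i j).
by apply/in_cornerP; move: (sA i j) (At i j); rewrite !mxE.
Qed.

Lemma in_M_mul m n p (s : m.-tuple V) (t : n.-tuple V) (r : p.-tuple V) A B :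
  in_M s t A -> in_M t r B -> in_M s r (A *m B).
Proof.
move=> /in_MP[sA _] /in_MP[_ Br]; apply/in_MP.
by rewrite mulmxA sA -mulmxA Br.
Qed.

Lemma Imx_idem n (s : n.-tuple V) : Imx s *m Imx s = Imx s.
Proof.
rewrite /Imx mul_diag_mx; apply/matrixP=> i j; rewrite !mxE.
by case: eqP => [->|_]; rewrite ?mulr1n ?mulr0n ?mulr0 // lvertM eqxx.
Qed.

Lemma in_GL_Imx n (s : n.-tuple V) : in_GL s s (Imx s).
Proof.
have sIs : in_M s s (Imx s) by apply/in_MP; rewrite !Imx_idem.
by split=> //; exists (Imx s); split=> //; exact: Imx_idem.
Qed.

Lemma in_GL_mul m n p (s : m.-tuple V) (t : n.-tuple V) (r : p.-tuple V) A B :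
  in_GL s t A -> in_GL t r B -> in_GL s r (A *m B).
Proof.
move=> [sAt [A' [tA's AA' A'A]]] [tBr [B' [rB't BB' B'B]]].
split; first exact: in_M_mul sAt tBr.
exists (B' *m A'); split; first exact: in_M_mul rB't tA's.
  by rewrite -mulmxA (mulmxA B) BB' (iffLR (in_MP _ _ _) tA's).1.
by rewrite -mulmxA (mulmxA A') A'A (iffLR (in_MP _ _ _) tBr).1.
Qed.

Lemma in_GL_inv m n (s : m.-tuple V) (t : n.-tuple V) A :
  in_GL s t A ->
  exists B : 'M[L]_(n, m), [/\ in_GL t s B, A *m B = Imx s & B *m A = Imx t].
Proof.
by move=> [sAt [B [tBs AB BA]]]; exists B; split=> //; split=> //; exists A.
Qed.

Definition elem_mx n (s : n.-tuple V) (i j : 'I_n) (x : L) : 'M[L]_n :=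
  Imx s + \matrix_(k, l) (if (k == i) && (l == j) then x else 0).

(* E_s(L) *)
Inductive in_E n (s : n.-tuple V) : 'M[L]_n -> Prop :=
| in_E_elem i j x :
    i != j -> in_corner (tnth s i) (tnth s j) x -> in_E s (elem_mx s i j x)
| in_E_one : in_E s (Imx s)
| in_E_mul A B : in_E s A -> in_E s B -> in_E s (A *m B)
| in_E_inv A B :
    in_E s A -> in_M s s B -> A *m B = Imx s -> B *m A = Imx s -> in_E s B.

Inductive block := BVert of V | BEdge of hedge H | BStar of hedge H.

Definition brows (b : block) : nat :=
  match b with BVert _ => 1 | BEdge h => nsrc h | BStar h => nrng h end.

Definition bcols (b : block) : nat :=
  match b with BVert _ => 1 | BEdge h => nrng h | BStar h => nsrc h end.

Definition block_mat (b : block) : 'M[L]_(brows b, bcols b) :=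
  match b with
  | BVert v => const_mx (lvert v)
  | BEdge h => \matrix_(j, j') ledge j j'
  | BStar h => \matrix_(j', j) lstar j j'
  end.

Definition srows (bs : seq block) : nat := foldr (fun b n => brows b + n)%N 0%N bs.
Definition scols (bs : seq block) : nat := foldr (fun b n => bcols b + n)%N 0%N bs.

Fixpoint block_diag (bs : seq block) : 'M[L]_(srows bs, scols bs) :=
  match bs with
  | [::] => 0
  | b :: bs' => block_mx (block_mat b) 0 0 (block_diag bs')
  end.

Definition in_F m n (s : m.-tuple V) (t : n.-tuple V) (A : 'M[L]_(m, n)) : Prop :=
  in_GL s t A /\
  exists (bs : seq block) (em : srows bs = m) (en : scols bs = n),
    A = castmx (em, en) (block_diag bs).

Definition in_P n (s t : n.-tuple V) (A : 'M[L]_n) : Prop :=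
  in_GL s t A /\
  exists (pi : 'S_n) (k : 'I_n -> K),
    [/\ forall i, tnth s i = tnth t (pi i),
        forall i, k i != 0 &
        forall i j, A i j = if j == pi i then k i *: lvert (tnth s i) else 0].

End Matrices.

Record groupoid := Groupoid {
  gobj : Type;
  ghom : gobj -> gobj -> Type;
  gid : forall x, ghom x x;
  gcomp : forall x y z, ghom y z -> ghom x y -> ghom x z;
  ginv : forall x y, ghom x y -> ghom y x;
  gcompA : forall x y z w (f : ghom z w) (g : ghom y z) (h : ghom x y),
    gcomp f (gcomp g h) = gcomp (gcomp f g) h;
  gcomp1f : forall x y (f : ghom x y), gcomp (gid y) f = f;
  gcompf1 : forall x y (f : ghom x y), gcomp f (gid x) = f;
  gcompVf : forall x y (f : ghom x y), gcomp (ginv f) f = gid x;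
  gcompfV : forall x y (f : ghom x y), gcomp f (ginv f) = gid y
}.

Section Generation.
Variables (G : groupoid) (S : forall x y : gobj G, ghom x y -> Prop).

Definition gen_obj (x : gobj G) : Prop :=
  (exists y (f : ghom x y), S f) \/ (exists y (f : ghom y x), S f).

(* Identities need no constructor: an object of the generated subgroupoid is an
   end of some f in S, and gcomp (ginv f) f, gcomp f (ginv f) are identities. *)
Inductive gen_hom : forall x y : gobj G, ghom x y -> Prop :=
| gen_base x y (f : ghom x y) : S f -> gen_hom f
| gen_inv x y (f : ghom x y) : S f -> gen_hom (ginv f)
| gen_comp x y z (g : ghom y z) (f : ghom x y) :
    gen_hom g -> gen_hom f -> gen_hom (gcomp g f).

(* The subgroupoid generated by S is the whole of G. *)
Definition generates : Prop :=
  (forall x, gen_obj x) /\ (forall x y (f : ghom x y), gen_hom f).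

End Generation.

Section GLGroupoid.
Variables (K : fieldType) (H : hypergraph).
Notation L := (lpa K H).
Notation V := (vertex H).

Definition word : Type := {n : nat & n.+1.-tuple V}.
Definition wlen (s : word) : nat := (tag s).+1.
Definition letters (s : word) : (wlen s).-tuple V := tagged s.

(* A morphism s -> t is a matrix in GL_(t x s)(L). *)
Definition GLhom (s t : word) : Type :=
  {A : 'M[L]_(wlen t, wlen s) | `[< in_GL (letters t) (letters s) A >]}.

Lemma GLhomP s t (A : GLhom s t) : in_GL (letters t) (letters s) (sval A).
Proof. exact/asboolP/(svalP A). Qed.

Definition GLid (s : word) : GLhom s s :=
  exist _ (Imx K (letters s)) (asboolT (in_GL_Imx K (letters s))).

Definition GLcomp (s t r : word) (A : GLhom t r) (B : GLhom s t) : GLhom s r :=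
  exist _ (sval A *m sval B) (asboolT (in_GL_mul (GLhomP A) (GLhomP B))).

Definition GLinv_mx (s t : word) (A : GLhom s t) := cid (in_GL_inv (GLhomP A)).

Lemma GLinv_subproof s t (A : GLhom s t) :
  in_GL (letters s) (letters t) (projT1 (GLinv_mx A)).
Proof. by case: (projT2 (GLinv_mx A)). Qed.

Definition GLinv (s t : word) (A : GLhom s t) : GLhom t s :=
  exist _ (projT1 (GLinv_mx A)) (asboolT (GLinv_subproof A)).

Lemma GLcompA s t r q (A : GLhom r q) (B : GLhom t r) (C : GLhom s t) :
  GLcomp A (GLcomp B C) = GLcomp (GLcomp A B) C.
Proof. by apply: val_inj; rewrite /= mulmxA. Qed.

Lemma GLcomp1f s t (A : GLhom s t) : GLcomp (GLid t) A = A.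
Proof. by apply: val_inj; case: (GLhomP A) => /in_MP[]. Qed.

Lemma GLcompf1 s t (A : GLhom s t) : GLcomp A (GLid s) = A.
Proof. by apply: val_inj; case: (GLhomP A) => /in_MP[]. Qed.

Lemma GLcompVf s t (A : GLhom s t) : GLcomp (GLinv A) A = GLid s.
Proof. by apply: val_inj; case: (projT2 (GLinv_mx A)). Qed.

Lemma GLcompfV s t (A : GLhom s t) : GLcomp A (GLinv A) = GLid t.
Proof. by apply: val_inj; case: (projT2 (GLinv_mx A)). Qed.

Definition GLgroupoid : groupoid :=
  Groupoid GLcompA GLcomp1f GLcompf1 GLcompVf GLcompfV.

(* P_(s x t)(K) is only defined for words of equal length, whence [EFP_P]. *)
Inductive EFP : forall s t : gobj GLgroupoid, ghom s t -> Prop :=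
| EFP_E (s : word) (A : GLhom s s) :
    in_E (letters s) (sval A) -> @EFP s s A
| EFP_F (s t : word) (A : GLhom s t) :
    in_F (letters t) (letters s) (sval A) -> @EFP s t A
| EFP_P n (s t : n.+1.-tuple V)
    (A : GLhom (existT _ n s : word) (existT _ n t : word)) :
    in_P t s (sval A) -> @EFP (existT _ n s : word) (existT _ n t : word) A.

End GLGroupoid.

(* Main.v *)
From HB Require Import structures.
From mathcomp Require Import all_boot all_order all_fingroup all_algebra.
From mathcomp Require Import generic_quotient boolp.
Require Import Defs.

Set Implicit Arguments.
Unset Strict Implicit.
Unset Printing Implicit Defensive.

Import GRing.Theory.
Local Open Scope ring_scope.

(** Why the theorem holds.

    Give every hyperedge [h] an object of its own, which is at once the sum of
    the sources of [h] and the sum of the ranges of [h]; a vertex is the sum of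
    itself on both sides.  With these objects (the cells) the algebra [L]
    becomes a corner of a coproduct of two semisimple algebras, one for the
    source side and one for the range side, amalgamated over a power of [K].
    Bergman's theorem on modules over coproducts says that an isomorphism
    between standard modules over such a coproduct is a product of
    transvections, of free transfers (moving a summand from one side to the
    other) and of isomorphisms of modules over the factors.  Here the
    transvections are the elementary matrices, the free transfers are the block
    matrices of [F], and the isomorphisms over the factors are products of
    matrices of [E] and [P].  The proof below is Bergman's argument, made
    concrete.

    An invertible matrix is read as the list of its columns, a basis of the
    right module of all columns.  Multiplication on the right by a generator is
    a move on such lists: permute, rescale, add a multiple of one column to
    another, or exchange the columns of a cell on the source side for its
    columns on the range side.  It suffices to move the list to the unit columns
    ([reach_unitcols], [GL_gen]).

    Degree.  Words alternating between the two sides give a normal form of [L],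
    and so a degree on columns ([fil]); that the normal form is faithful is
    [coords_eq0].  Only two properties of the degree matter.  If the columns of
    a cell have degree at most [d] on one side, they have degree at most [d + 1]
    on the other ([fil_other]).  And no cancellation occurs between leading
    terms: if elements [p_b] of various cells, of degree at most [d + 1] on both
    sides, have columns at the vertex [v] whose sum has degree at most [d], then
    every [p_b] has degree at most [d] on that side ([fil_free]).

    Reduction.  Cut the basis into pieces: single columns carrying a bound for
    their degree on one side (pure pieces), and whole cells carrying a bound for
    their degree on both sides (nodes).  A node of degree [d] weighs a little
    more than pure pieces of degree [d] and less than a pure piece of degree
    [d + 1].  In a state of minimal total weight
    - no combination of pure pieces of top degree drops in degree ([pure_min]);
    - no combination of nodes of top degree can be split on one side
      ([node_min]);
    - pure pieces that would fuse to a node of smaller degree are linearly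
      dependent ([pures_dependent]).
    Together with [fil_free] this yields that a combination of pieces of bounded
    weight whose degree is smaller than the weights suggest is already a
    combination of lighter pieces ([strict_minimal], [strict_zero]).  Unit
    columns have degree zero, so they are [K]-combinations of the nodes of
    degree zero at the vertices; a Steinitz exchange ([exchange]) moves them into
    the basis, and nothing else can remain because they already generate.  *)

(** * Cells and corners *)

Section Corners.
Variable (H : hypergraph).
Notation V := (vertex H).

(** A vertex or a hyperedge: the objects over which the source side and the
    range side are amalgamated. *)
Definition cell : finType := (V + hedge H)%type.

(** The side [true] is the source side, [false] the range side.  A vertex is
    treated as a hyperedge with itself as only source and only range, so that
    vertices and hyperedges need no separate treatment later. *)
Definition arity (e : bool) (a : cell) : nat :=
  match a with inl _ => 1 | inr h => if e then nsrc h else nrng h end.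

Lemma arity_gt0 e a : (0 < arity e a)%N.
Proof. by case: a => [//|h]; case: e; rewrite /= (nsrc_gt0, nrng_gt0). Qed.

(** All coordinates of all cells on both sides, gathered in one finite type:
    an element of a cell is then a plain function of corners, free of dependent
    types. *)
Definition corner : finType := {ea : bool * cell & 'I_(arity ea.1 ea.2)}.

Definition mk (e : bool) (a : cell) (i : 'I_(arity e a)) : corner :=
  existT (fun ea : bool * cell => 'I_(arity ea.1 ea.2)) (e, a) i.

Definition side (c : corner) : bool := (tag c).1.
Definition cellof (c : corner) : cell := (tag c).2.
Definition posof (c : corner) : 'I_(arity (side c) (cellof c)) := tagged c.

Lemma corner_ind (P : corner -> Prop) :
  (forall e a i, P (@mk e a i)) -> forall c, P c.
Proof. by move=> mkP [[e a] i]; exact: mkP. Qed.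

Lemma mk_inj e a : injective (@mk e a).
Proof. by move=> i j /eqP; rewrite /mk -tag_eqE /tag_eq /= eqxx tagged_asE /= => /eqP. Qed.

(** Among the diagonal matrix units of a cell one is redundant modulo the
    others, since on either side they sum to the identity of the cell.  The base
    corner is the index of the one that the normal form avoids. *)
Definition base (e : bool) (a : cell) : corner := mk (Ordinal (arity_gt0 e a)).

Definition is_base (c : corner) : bool := c == base (side c) (cellof c).

Definition labof (e : bool) (a : cell) : 'I_(arity e a) -> V :=
  match a with
  | inl v => fun _ => v
  | inr h => match e with
             | true => fun i : 'I_(nsrc h) => hsrc i
             | false => fun j : 'I_(nrng h) => hrng j
             end
  end.

Definition lab (c : corner) : V := labof (posof c).

Definition vcorner (e : bool) (v : V) : corner := base e (inl v).

Lemma lab_vcorner e v : lab (vcorner e v) = v. Proof. by []. Qed.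
Lemma vcornerP c v : cellof c = inl v -> c = vcorner (side c) v.
Proof.
elim/corner_ind: c => e a i; rewrite /cellof /= => av; subst a.
by congr mk; apply: val_inj; case: i => [[]].
Qed.

Lemma is_base_base e a : is_base (base e a). Proof. exact: eqxx. Qed.

Lemma is_baseP c d : is_base c -> is_base d -> side c = side d ->
  cellof c = cellof d -> c = d.
Proof.
by move=> /eqP cE /eqP dE sE aE; rewrite cE sE aE -dE.
Qed.

End Corners.

(** * Change of coordinates between the two sides of a cell *)

Section Transition.
Variables (K : fieldType) (H : hypergraph).
Notation V := (vertex H).
Notation L := (lpa K H).
Notation corner := (corner H).

Definition trans (e : bool) (a : cell H) :
    'I_(arity e a) -> 'I_(arity (~~ e) a) -> L :=
  match a with
  | inl v => fun _ _ => lvert v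
  | inr h => match e with
             | true => fun (i : 'I_(nsrc h)) (j : 'I_(nrng h)) => ledge i j
             | false => fun (j : 'I_(nrng h)) (i : 'I_(nsrc h)) => lstar i j
             end
  end.

(** The scalar by which the coordinate [q] of an element of a cell
    contributes to its coordinate [u]: generators of the algebra if the sides
    differ, Kronecker symbols if they agree. *)
Definition trans_elt (q u : corner) : L :=
  (if q == u then lvert (lab q) else 0) +
  \sum_(j : 'I_(arity (~~ side q) (cellof q)) | mk j == u) trans (posof q) j.

Lemma trans_elt_same q u : side q = side u ->
  trans_elt q u = if q == u then lvert (lab q) else 0.
Proof.
move=> squ; rewrite /trans_elt big1 ?addr0 // => j /eqP ju.
exfalso; move: squ; rewrite -ju /side /=; by case: (tag q).1.
Qed.

Lemma trans_elt_diag q : trans_elt q q = lvert (lab q).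
Proof. by rewrite trans_elt_same // eqxx. Qed.

Lemma trans_elt_trans e a (i : 'I_(arity e a)) j : trans_elt (mk i) (mk j) = trans i j.
Proof.
rewrite /trans_elt ifF; last first.
  by apply/eqP => /(congr1 (@side H)); rewrite /side /=; case: (e).
by rewrite add0r (big_pred1 j) // => k /=; rewrite (inj_eq (@mk_inj _ _ _)).
Qed.

Lemma trans_elt_cell q u : cellof q != cellof u -> trans_elt q u = 0.
Proof.
move=> qu; rewrite /trans_elt ifF; last by apply: contraNF qu => /eqP->.
rewrite add0r big1 // => j /eqP ju.
by move: qu; rewrite -ju /cellof eqxx.
Qed.

Lemma lab_trans e a (i : 'I_(arity e a)) j :
  lvert (labof i) * trans i j = trans i j /\
  trans i j * lvert (labof j) = trans i j.
Proof.
case: a i j => [v|h] i j /=; first by rewrite lvertM eqxx.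
case: e i j => /= i j; first by rewrite lsrc_edge ledge_rng.
by rewrite lrng_star lstar_src.
Qed.

Lemma lab_trans_elt q u : lvert (lab q) * trans_elt q u = trans_elt q u.
Proof.
rewrite /trans_elt mulrDr; congr (_ + _); first by case: eqP; rewrite ?mulr0 ?lvertM ?eqxx.
by rewrite mulr_sumr; apply: eq_bigr => j _; rewrite (lab_trans _ _).1.
Qed.

Lemma trans_elt_lab q u : trans_elt q u * lvert (lab u) = trans_elt q u.
Proof.
rewrite /trans_elt mulrDl; congr (_ + _).
  by case: eqP => [->|]; rewrite ?mul0r ?lvertM ?eqxx.
rewrite mulr_suml; apply: eq_bigr => j /eqP <-.
by rewrite (lab_trans _ _).2.
Qed.

Lemma trans_inv e a (i i' : 'I_(arity e a)) :
  \sum_j trans i j * trans_elt (mk j) (mk i') = if i == i' then lvert (labof i) else 0.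
Proof.
case: e i i' => i i'.
  transitivity (\sum_j trans i j * @trans false a j i').
    by apply: eq_bigr => j _; rewrite -(@trans_elt_trans false a j i').
  case: a i i' => [v|h] i i'; last exact: ledge_star.
  by rewrite big_ord1 /= lvertM eqxx (ord1 i) (ord1 i').
transitivity (\sum_j trans i j * @trans true a j i').
  by apply: eq_bigr => j _; rewrite -(@trans_elt_trans true a j i').
case: a i i' => [v|h] i i'; last exact: lstar_edge.
by rewrite big_ord1 /= lvertM eqxx (ord1 i) (ord1 i').
Qed.

(** The matrix of a hyperedge and that of its starred generators are inverse to
    each other: passing from one side of a cell to the other and back changes
    nothing. *)
Lemma trans_elt_comp e q u : \sum_(t | side t == e) trans_elt q t * trans_elt t u = trans_elt q u.
Proof.
have [->|ne] := eqVneq e (side q).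
  rewrite (bigD1 q) //= trans_elt_diag lab_trans_elt big1 ?addr0 // => t /andP[/eqP st tq].
  by rewrite trans_elt_same // eq_sym (negPf tq) mul0r.
have {ne} -> : e = ~~ side q by case: (e) (side q) ne => [] [].
have [su|su] := eqVneq (side u) (~~ side q).
  rewrite (bigD1 u) ?su //= trans_elt_diag trans_elt_lab big1 ?addr0 // => t /andP[/eqP st tu].
  by rewrite [trans_elt t u]trans_elt_same ?su // (negPf tu) mulr0.
have {}su : side u = side q by case: (side u) (side q) su => [] [].
transitivity (\sum_j trans (posof q) j * trans_elt (mk j) u).
  transitivity (\sum_(t | side t == ~~ side q)
      \sum_(j | mk j == t) trans (posof q) j * trans_elt t u).
    apply: eq_bigr => t /eqP st; rewrite {1}/trans_elt ifF ?add0r ?mulr_suml //.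
    by apply/eqP => qt; move: st; rewrite qt; case: (side t).
  rewrite (exchange_big_dep xpredT) //=; apply: eq_bigr => j _.
  rewrite (big_pred1 (mk j)) // => t /=.
  by apply/andP/eqP => [[_ /eqP->]|->].
elim/corner_ind: q su => e' a i; rewrite {1}/side /= => su.
have [cu|cu] := eqVneq (cellof u) a; last first.
  rewrite trans_elt_cell 1?eq_sym // big1 // => j _.
  by rewrite [trans_elt _ u]trans_elt_cell ?mulr0 // eq_sym.
elim/corner_ind: u su cu => e2 a2 i'; rewrite /side /cellof /= => ??; subst.
by rewrite trans_inv trans_elt_same // (inj_eq (@mk_inj _ _ _)).
Qed.

End Transition.

(** * Normal words and matrix units acting on functions of words *)

Section Words.
Variables (K : fieldType) (H : hypergraph).
Notation V := (vertex H).
Notation L := (lpa K H).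
Notation corner := (corner H).

(** A word is a starting vertex and a list of steps, the last step first.  A
    step [(t, u)] stands for the matrix unit from the corner [t] to the corner
    [u], both on the same side. *)
Definition nfword : eqType := (V * seq (corner * corner))%type.
Implicit Types (w : nfword) (p q t u : corner) (f g : nfword -> K).

Definition wcons t u w : nfword := (w.1, (t, u) :: w.2).
Definition nflen w := size w.2.

Definition wend w : cell H :=
  if w.2 is (_, u) :: _ then cellof u else inl w.1.

Definition wlast (e : bool) w : bool :=
  if w.2 is (_, u) :: _ then side u == e else false.

(** The corners between which there is a matrix unit. *)
Definition compat t u : bool := (side t == side u) && (lab t == lab u).

(** The steps alternate between the sides, and the matrix unit at a base
    corner is excluded, being a combination of the identity and of the others. *)
Fixpoint valid_steps (v : V) (s : seq (corner * corner)) : bool :=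
  if s is (t, u) :: s' then
    [&& compat t u, ~~ ((t == u) && is_base u), cellof t == wend (v, s'),
        ~~ wlast (side t) (v, s') & valid_steps v s']
  else true.
Definition valid w : bool := valid_steps w.1 w.2.

(** Words that carry no information about the side of [t] yet, and after
    which a matrix unit starting at [t] makes sense. *)
Definition extensible w t : bool :=
  [&& valid w, ~~ wlast (side t) w & cellof t == wend w].

(** The coefficient of the function [f] at the word [w] followed by the matrix
    unit [(t, u)], when all matrix units of one side are used as coordinates,
    the base ones included.  The identity is the sum of the diagonal units,
    which is why [f w] contributes when [t = u]. *)
Definition Ecoef t u f w : K :=
  (if t == u then f w else 0) +
  (if (t == u) && is_base u then 0 else f (wcons t u w)).

(** Right multiplication by the matrix unit from [p] to [q].  The formula is
    forced by [Ecoef_Eop]: it solves the triangular system that expresses the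
    values on words by the coefficients [Ecoef]. *)
Definition Eop p q f w : K :=
  if ~~ compat p q || ~~ valid w then 0
  else if wlast (side q) w then
    if w.2 is (t, u) :: s then
      (if u == q then Ecoef t p f (w.1, s) else 0) -
      (if [&& t == u, is_base q & cellof q == cellof u]
       then Ecoef q p f (w.1, s) else 0)
    else 0
  else if is_base q && (cellof q == wend w) then Ecoef q p f w else 0.

Lemma valid_wcons t u w :
  valid (wcons t u w) =
  [&& compat t u, ~~ ((t == u) && is_base u) & extensible w t].
Proof.
case: w => v s; rewrite /extensible.
transitivity ([&& compat t u, ~~ ((t == u) && is_base u),
    cellof t == wend (v, s), ~~ wlast (side t) (v, s) & valid (v, s)]) => //.
by do 2 congr andb; rewrite andbC andbAC andbC.
Qed.

(** In the coordinates [Ecoef] of one side the matrix units of that side act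
    as they should; all relations between them follow from this. *)
Lemma Ecoef_Eop p q t u f w :
  compat p q -> compat t u -> side u = side q -> extensible w t ->
  Ecoef t u (Eop p q f) w = if u == q then Ecoef t p f w else 0.
Proof.
move=> cpq ctu suq ext; have /and3P[vw nlw /eqP tw] := ext.
have stu : side t = side u by case/andP: ctu => /eqP.
have EN : Eop p q f w = if is_base q && (cellof q == wend w) then Ecoef q p f w else 0.
  by rewrite /Eop cpq vw /= -suq -stu (negPf nlw).
rewrite /Ecoef EN.
have [tb|ntb] := boolP ((t == u) && is_base u).
  case/andP: tb => /eqP tu bu; subst u; rewrite eqxx addr0.
  have -> : is_base q && (cellof q == wend w) = (t == q).
    apply/andP/eqP => [[bq /eqP qw]|<-]; last by rewrite bu tw.
    by apply: is_baseP => //; rewrite tw qw.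
  by case: eqP => // ->.
have vc : valid (wcons t u w) by rewrite valid_wcons ctu ntb.
rewrite {1}/Eop cpq vc /= /wlast /= suq eqxx -surjective_pairing.
have [tu|] := eqVneq t u; last by rewrite add0r subr0.
by subst u; rewrite -tw addrC subrK.
Qed.

(** Functions with the same coefficients have the same image, since [Eop] reads
    its argument through coefficients only. *)
Lemma eq_E p q f g :
  (forall w t, extensible w t -> compat t p -> Ecoef t p f w = Ecoef t p g w) ->
  Eop p q f = Eop p q g.
Proof.
move=> fg; apply: funext => w; rewrite /Eop.
case cpq: (compat p q) => //=; case vw: (valid w) => //=.
have cqp : compat q p by move: cpq; rewrite /compat => /andP[/eqP-> /eqP->]; rewrite !eqxx.
have [lw|lw] := boolP (wlast (side q) w).
  case: w vw lw => v [//|[t u] s] vw; rewrite /wlast /= => suq.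
  rewrite -/(wcons t u (v, s)) valid_wcons in vw.
  have /and3P[ctu _ ext] := vw; congr (_ - _).
    case: eqP => // uq; apply: fg => //.
    move: ctu cqp; rewrite uq /compat => /andP[/eqP-> /eqP->]; by [].
  case: and3P => // -[/eqP tu bq /eqP qu]; subst u.
  apply: fg => //; have /and3P[v1 v2 v3] := ext; apply/and3P; split => //.
    by rewrite -(eqP suq).
  by rewrite qu.
case: ifP => // /andP[bq qw]; apply: fg => //.
by apply/and3P; split.
Qed.

Lemma Eop_comp p q t f : compat p q -> Eop q t (Eop p q f) = Eop p t f.
Proof.
move=> cpq.
have H1 : forall w u, extensible w u -> compat u q -> Ecoef u q (Eop p q f) w = Ecoef u p f w.
  by move=> w u ext cuq; rewrite Ecoef_Eop // eqxx.
have cc : compat q t = compat p t.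
  by rewrite /compat; case/andP: cpq => /eqP-> /eqP->.
apply: funext => w; rewrite /Eop cc.
case cpt: (compat p t) => //=; case vw: (valid w) => //=.
have ctq : compat t q.
  by move: cpq cpt; rewrite /compat => /andP[/eqP<- /eqP<-] /andP[/eqP-> /eqP->]; rewrite !eqxx.
have [lw|lw] := boolP (wlast (side t) w).
  case: w vw lw => v [//|[t1 u1] s] vw; rewrite /wlast /= => suq.
  rewrite -/(wcons t1 u1 (v, s)) valid_wcons in vw.
  have /and3P[ctu _ ext] := vw; congr (_ - _).
    case: eqP => // uq; apply: H1 => //.
    by move: ctu ctq; rewrite uq /compat => /andP[/eqP-> /eqP->].
  case: and3P => // -[/eqP tu bq /eqP qu]; subst u1.
  apply: H1 => //; have /and3P[v1 v2 v3] := ext; apply/and3P; split => //.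
    by rewrite -(eqP suq).
  by rewrite qu.
case: ifP => // /andP[bq qw]; apply: H1 => //.
by apply/and3P; split.
Qed.

Lemma Eop_eq0 p q f :
  (forall w t, extensible w t -> compat t p -> Ecoef t p f w = 0) -> Eop p q f = fun _ => 0.
Proof.
move=> f0; rewrite (@eq_E p q f (fun _ => 0)).
  apply: funext => w; rewrite /Eop /Ecoef; case: ifP => //= _.
  case: ifP => _; last by rewrite !if_same addr0 !if_same.
  by case: w.2 => [//|[t u] s]; rewrite !if_same addr0 !if_same subr0.
by move=> w t ext ctp; rewrite f0 // /Ecoef !if_same addr0.
Qed.

Lemma Eop_ortho p q q' t f : q != q' -> side q = side q' -> Eop q' t (Eop p q f) = fun _ => 0.
Proof.
move=> qq' sqq'; apply: Eop_eq0 => w u ext cuq'.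
have [cpq|ncpq] := boolP (compat p q).
  by rewrite Ecoef_Eop // 1?eq_sym 1?eq_sym ?ifN // 1?eq_sym.
by rewrite /Ecoef /Eop ncpq /= !if_same addr0.
Qed.

Lemma Eop_valid p q f w : Eop p q f w != 0 -> valid w && (wend w == cellof q).
Proof.
rewrite /Eop; case: compat => /=; last by rewrite eqxx.
case vw: (valid w) => /=; last by rewrite eqxx.
have [lw|lw] := boolP (wlast (side q) w).
  case: w vw lw => v [//|[t u] s] vw; rewrite /wlast /= => suq.
  rewrite /wend /=; case: (u =P q) => [->|_]; first by rewrite eqxx.
  rewrite sub0r oppr_eq0; case: and3P => [[_ _ /eqP->]|]; first by rewrite eqxx.
  by rewrite eqxx.
by case: ifP => [/andP[_ /eqP->]|]; rewrite eqxx.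
Qed.

Definition supp (a : cell H) f := forall w, f w != 0 -> valid w && (wend w == a).

Lemma Eop_support p q f : supp (cellof q) (Eop p q f).
Proof. exact: Eop_valid. Qed.

Lemma Eop_cell p q a f : supp a f -> a != cellof p -> Eop p q f = fun _ => 0.
Proof.
move=> sf ap; apply: Eop_eq0 => w t ext ctp; rewrite /Ecoef.
have f0 w' : wend w' == cellof p -> f w' = 0.
  move=> /eqP wp; apply: contraNeq ap => /sf/andP[_].
  by rewrite wp eq_sym.
have /and3P[_ _ /eqP tw] := ext.
case: eqP => [tp|_] /=; last by rewrite add0r f0.
rewrite !f0 ?if_same ?addr0 //; first by rewrite -tw tp.
Qed.

Definition proj (a : cell H) f w : K := if valid w && (wend w == a) then f w else 0.

Lemma proj_supp a f : supp a f -> proj a f = f.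
Proof.
move=> sf; apply: funext => w; rewrite /proj; case: ifPn => // vw.
by apply/eqP; rewrite eq_sym; apply: contraR vw => /sf.
Qed.

Lemma supp_proj a f : supp a (proj a f).
Proof. by move=> w; rewrite /proj; case: ifP => //; rewrite eqxx. Qed.

(** The diagonal units of a cell sum to the projection to that cell, on either
    side.  The two sides are amalgamated through this common identity. *)
Lemma sum_Eop e a f w :
  \sum_(t | (side t == e) && (cellof t == a)) Eop t t f w = proj a f w.
Proof.
have ct t : compat t t by rewrite /compat !eqxx.
rewrite /proj; case: ifPn => [/andP[vw /eqP wa]|nvw]; last first.
  rewrite big1 // => t /andP[/eqP st /eqP ct']; apply/eqP.
  by apply: contraR nvw => /Eop_valid; rewrite ct'.
have [lw|lw] := boolP (wlast e w).
  case: w vw wa lw => v [//|[t u] s] vw; rewrite /wend /wlast /= => ua /eqP ue.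
  have := vw; rewrite -/(wcons t u (v, s)) valid_wcons => /and3P[ctu ntu ext].
  under eq_bigr => q /andP[/eqP sq /eqP cq].
    rewrite /Eop (ct q) vw /= /wlast /= ue sq eqxx -/(wcons _ _ _) cq ua eqxx andbT.
    over.
  rewrite sumrB -big_mkcondr /=.
  rewrite (big_pred1 u); last first.
    by move=> q /=; rewrite [u == q]eq_sym; case: (q =P u) => [->|]; rewrite ?andbF // ue ua !eqxx.
  rewrite -big_mkcondr /=.
  have [tu|ntu'] := eqVneq t u; last first.
    by rewrite big_pred0 ?subr0 => [|q]; rewrite /Ecoef ?(negPf ntu') ?add0r ?andbF.
  subst u; rewrite (big_pred1 (base e a)); last first.
    move=> q /=; apply/andP/eqP => [[/andP[/eqP sq /eqP cq] bq]|->].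
      by rewrite (eqP bq) sq cq.
    by rewrite /side /cellof /= !eqxx is_base_base.
  rewrite /Ecoef !eqxx is_base_base /= addr0.
  by move: ntu; rewrite eqxx /= => /negPf->; rewrite addrC addKr.
under eq_bigr => q /andP[/eqP sq /eqP cq].
  rewrite /Eop (ct q) vw /= sq (negPf lw) cq wa eqxx andbT.
  over.
rewrite -big_mkcondr /= (big_pred1 (base e a)).
  by rewrite /Ecoef eqxx is_base_base /= addr0.
move=> q /=; apply/andP/eqP => [[/andP[/eqP sq /eqP cq] bq]|->].
  by rewrite (eqP bq) sq cq.
by rewrite /side /cellof /= !eqxx is_base_base.
Qed.

Definition lcomb (I : Type) (s : seq I) (k : I -> K) (F : I -> nfword -> K) w :=
  \sum_(i <- s) k i * F i w.

(** Stated for combinations indexed by a list, so that sums, multiples and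
    zero are special cases. *)
Definition linear_op (op : (nfword -> K) -> (nfword -> K)) :=
  forall (I : Type) (s : seq I) k F, op (lcomb s k F) = lcomb s k (fun i => op (F i)).

Lemma Ecoef_linear t u I (s : seq I) k F w :
  Ecoef t u (lcomb s k F) w = \sum_(i <- s) k i * Ecoef t u (F i) w.
Proof.
rewrite /Ecoef /lcomb; case: (t == u) => /=; case: (is_base u) => /=;
  under [RHS]eq_bigr do rewrite ?add0r ?addr0 ?mulrDr.
all: by rewrite ?big_split ?add0r ?addr0.
Qed.

Lemma Eop_linear p q : linear_op (Eop p q).
Proof.
move=> I s k F; apply: funext => w; rewrite /lcomb /Eop.
have z0 : 0 = \sum_(i <- s) k i * 0 :> K by rewrite big1 // => i _; rewrite mulr0.
case: ifP => // _; case: ifP => _.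
  case: w.2 => [//|[t u] s']; case: (u == q); case: [&& _, _ & _];
   rewrite ?subr0 ?sub0r -/(lcomb s k F) ?Ecoef_linear -?sumrB -?sumrN //;
   apply: eq_bigr => i _; rewrite ?subr0 ?sub0r ?mulrBr ?mulrN ?mulr0 //.
by case: ifP => // _; rewrite -/(lcomb s k F) Ecoef_linear.
Qed.

Lemma proj_linear a : linear_op (proj a).
Proof.
move=> I s k F; apply: funext => w; rewrite /lcomb /proj; case: ifP => // _.
by rewrite big1 // => i _; rewrite mulr0.
Qed.

End Words.

(** * The right action of the algebra *)

Section Action.
Variables (K : fieldType) (H : hypergraph).
Notation V := (vertex H).
Notation L := (lpa K H).
Notation corner := (corner H).
Notation nfword := (nfword H).
Implicit Types (w : nfword) (p q : corner) (f g : nfword -> K).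

(** The corner of the vertex under [t] taken as a cell, on the side of [t]. *)
Definition vc (t : corner) : corner := vcorner (side t) (lab t).

Lemma compat_vc t : compat (vc t) t.
Proof. by rewrite /compat !eqxx. Qed.

Lemma compat_vc' t : compat t (vc t).
Proof. by rewrite /compat !eqxx. Qed.

Lemma sum_corners (A : nmodType) e a (F : corner -> A) :
  \sum_(t | (side t == e) && (cellof t == a)) F t =
  \sum_(i : 'I_(arity e a)) F (mk i).
Proof.
transitivity (\sum_(i : 'I_(arity e a)) \sum_(t | mk i == t) F t); last first.
  by apply: eq_bigr => i _; rewrite (big_pred1 (mk i)) // => t; rewrite eq_sym.
rewrite (exchange_big_dep (fun t => (side t == e) && (cellof t == a))) /=; last first.
  by move=> i t _ /eqP <-; rewrite /side /cellof /= !eqxx.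
apply: eq_bigr; elim/corner_ind => e' a' i; rewrite /side /cellof /=.
move=> /andP[/eqP ? /eqP ?]; subst.
by rewrite (big_pred1 i) // => j; rewrite (inj_eq (@mk_inj _ _ _)).
Qed.

Lemma Eop_proj p q f : Eop p q (proj (cellof p) f) = Eop p q f.
Proof.
apply: eq_E => w t ext ctp; have /and3P[vw _ /eqP tw] := ext.
rewrite /Ecoef /proj valid_wcons ctp ext vw.
case: (t =P p) => [tp|_]; last by rewrite /wend /= eqxx.
by rewrite -tw tp /wend /= !eqxx; case: (is_base p).
Qed.

Lemma proj_Eop p q f : proj (cellof q) (Eop p q f) = Eop p q f.
Proof. exact/proj_supp/Eop_support. Qed.

Lemma Eop_vcorner e v f : Eop (vcorner e v) (vcorner e v) f = proj (inl v) f.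
Proof.
apply: funext => w; rewrite -(sum_Eop e) sum_corners big_ord1.
by congr (Eop _ _ f w); symmetry; apply: vcornerP.
Qed.

Section LinearOp.
Variable (op : (nfword -> K) -> (nfword -> K)).
Hypothesis op_lin : linear_op op.

Lemma op_zero : op (fun _ => 0) = fun _ => 0.
Proof.
have := op_lin (Datatypes.nil : seq bool) (fun=> 0) (fun=> fun=> 0).
have E0 I (F : I -> nfword -> K) : lcomb [::] (fun=> 0) F = fun=> 0.
  by apply: funext => w; rewrite /lcomb big_nil.
by rewrite !E0.
Qed.

Lemma op_add f g : op (fun w => f w + g w) = fun w => op f w + op g w.
Proof.
have := op_lin [:: true; false] (fun=> 1) (fun b => if b then f else g).
have E2 (F : bool -> nfword -> K) :
    lcomb [:: true; false] (fun=> 1) F = fun w => F true w + F false w.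
  by apply: funext => w; rewrite /lcomb !big_cons big_nil addr0 !mul1r.
by rewrite !E2.
Qed.

Lemma op_scale k f : op (fun w => k * f w) = fun w => k * op f w.
Proof.
have := op_lin [:: true] (fun=> k) (fun=> f).
have E1 (F : bool -> nfword -> K) :
    lcomb [:: true] (fun=> k) F = fun w => k * F true w.
  by apply: funext => w; rewrite /lcomb big_seq1.
by rewrite !E1.
Qed.

Lemma op_sum (I : finType) (P : pred I) (F : I -> nfword -> K) :
  op (fun w => \sum_(i | P i) F i w) = fun w => \sum_(i | P i) op (F i) w.
Proof.
have := op_lin (filter P (index_enum I)) (fun=> 1) F.
have ES (G : I -> nfword -> K) :
    lcomb (filter P (index_enum I)) (fun=> 1) G = fun w => \sum_(i | P i) G i w.
  apply: funext => w; rewrite /lcomb big_filter.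
  by apply: eq_bigr => i _; rewrite mul1r.
by rewrite !ES.
Qed.

End LinearOp.

(** The generator of the algebra between corners [q] and [u] of one cell enters
    the cell from the vertex under [q], and leaves it at the vertex under [u]. *)
Definition jump q (u : corner) f := Eop u (vc u) (Eop (vc q) q f).

Fixpoint term_act (t : lterm K H) f : nfword -> K :=
  match t with
  | TVert v => proj (inl v) f
  | TEdge h i j => jump (@mk H true (inr h) i) (@mk H false (inr h) j) f
  | TStar h i j => jump (@mk H false (inr h) j) (@mk H true (inr h) i) f
  | TZero => fun _ => 0
  | TAdd t u => fun w => term_act t f w + term_act u f w
  | TScale a t => fun w => a * term_act t f w
  | TMul t u => term_act u (term_act t f)
  end.

Lemma term_act_linear t : linear_op (term_act t).
Proof.
elim: t => [v|h i j|h i j||t IHt u IHu|a t IHt|t IHt u IHu] I s k F /=.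
- exact: proj_linear.
- by rewrite /jump !Eop_linear.
- by rewrite /jump !Eop_linear.
- by apply: funext => w; rewrite /lcomb big1 // => i _; rewrite mulr0.
- rewrite IHt IHu; apply: funext => w; rewrite /lcomb -big_split /=.
  by apply: eq_bigr => i _; rewrite mulrDr.
- rewrite IHt; apply: funext => w; rewrite /lcomb mulr_sumr.
  by apply: eq_bigr => i _; rewrite mulrCA.
- by rewrite IHt IHu.
Qed.

(** The defining relations of a hyperedge hold for the operators: the units met
    in the middle are diagonal and sum to the identity of the cell. *)
Lemma jump_comp e a (i i' : 'I_(arity e a)) f w :
  \sum_(j : 'I_(arity (~~ e) a)) jump (mk j) (mk i') (jump (mk i) (mk j) f) w =
  if i == i' then proj (inl (labof i)) f w else 0.
Proof.
pose g := Eop (vc (mk i)) (mk i) f.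
have -> : \sum_(j : 'I_(arity (~~ e) a)) jump (mk j) (mk i') (jump (mk i) (mk j) f) w =
    Eop (mk i') (vc (mk i')) (fun w => \sum_(j : 'I_(arity (~~ e) a)) Eop (mk j) (mk j) g w) w.
  rewrite (op_sum (@Eop_linear _ _ _ _)); apply: eq_bigr => j _.
  by rewrite /jump Eop_comp // compat_vc'.
have -> : (fun w => \sum_(j : 'I_(arity (~~ e) a)) Eop (mk j) (mk j) g w) = g.
  apply: funext => w'; rewrite -(sum_corners (~~ e) a (fun t => Eop t t g w')) sum_Eop.
  by rewrite proj_supp // => w'' /Eop_support.
have [<-|ii'] := eqVneq i i'.
  by rewrite /g Eop_comp ?compat_vc // Eop_vcorner.
by rewrite /g Eop_ortho // (inj_eq (@mk_inj _ _ _)).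
Qed.

Lemma term_act_big (I : finType) (F : I -> lterm K H) f w :
  term_act (\big[@TAdd K H/TZero]_i F i) f w = \sum_i term_act (F i) f w.
Proof.
by apply: (big_morph (fun t => term_act t f w)).
Qed.

(** The action respects the defining relations, so it descends to the
    algebra. *)
Lemma term_act_congr t u : lcongr t u -> term_act t = term_act u.
Proof.
elim => {t u} //=.
- by move=> t u w _ -> _ ->.
- by move=> t t' u u' _ -> _ ->.
- by move=> a t t' _ ->.
- by move=> t t' u u' _ -> _ ->.
- by move=> t u w; apply: funext => f; apply: funext => x; rewrite addrA.
- by move=> t u; apply: funext => f; apply: funext => x; rewrite addrC.
- by move=> t; apply: funext => f; apply: funext => x; rewrite add0r.
- by move=> t; apply: funext => f; apply: funext => x; rewrite mulN1r addNr.
- by move=> a b t; apply: funext => f; apply: funext => x; rewrite mulrA.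
- by move=> t; apply: funext => f; apply: funext => x; rewrite mul1r.
- by move=> a t u; apply: funext => f; apply: funext => x; rewrite mulrDr.
- by move=> a b t; apply: funext => f; apply: funext => x; rewrite mulrDl.
- by move=> t u w; apply: funext => f; rewrite (op_add (@term_act_linear w)).
- by move=> a t u; apply: funext => f; rewrite (op_scale (@term_act_linear u)).
- move=> u v; apply: funext => f; have [<-|uv] := eqVneq u v.
    by rewrite /= proj_supp //; apply: supp_proj.
  apply: funext => w /=; rewrite /proj; case: ifP => // /andP[_ /eqP ->].
  by rewrite ifF // andbC; apply/negP => /andP[/eqP[uv']]; rewrite uv' eqxx in uv.
- move=> h i j; apply: funext => f.
  by rewrite /jump -[inl _]/(cellof (vc (@mk H true (inr h) i))) Eop_proj.
- move=> h i j; apply: funext => f.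
  by rewrite /jump -[inl _]/(cellof (vc (@mk H false (inr h) j))) proj_Eop.
- move=> h i j; apply: funext => f.
  by rewrite /jump -[inl _]/(cellof (vc (@mk H false (inr h) j))) Eop_proj.
- move=> h i j; apply: funext => f.
  by rewrite /jump -[inl _]/(cellof (vc (@mk H true (inr h) i))) proj_Eop.
- move=> h i i'; apply: funext => f; apply: funext => w; rewrite term_act_big /=.
  rewrite (@jump_comp true (inr h) i i' f w).
  by case: eqP.
- move=> h j j'; apply: funext => f; apply: funext => w; rewrite term_act_big /=.
  rewrite (@jump_comp false (inr h) j j' f w).
  by case: eqP.
Qed.

Definition actL (y : L) f : nfword -> K := term_act (repr y) f.

Lemma actL_lpi t f : actL (lpi t) f = term_act t f.
Proof. by rewrite /actL (term_act_congr (repr_lpi t)). Qed.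

Lemma actLD y z f : actL (y + z) f = fun w => actL y f w + actL z f w.
Proof.
elim/lpa_ind: y => t; elim/lpa_ind: z => u.
by rewrite -lpi_add !actL_lpi.
Qed.

Lemma actLZ k y f : actL (k *: y) f = fun w => k * actL y f w.
Proof. by elim/lpa_ind: y => t; rewrite -lpi_scale !actL_lpi. Qed.

Lemma actLM y z f : actL (y * z) f = actL z (actL y f).
Proof.
elim/lpa_ind: y => t; elim/lpa_ind: z => u.
by rewrite -lpi_mul !actL_lpi.
Qed.

Lemma actL0 f : actL 0 f = fun _ => 0.
Proof. by rewrite -lpi_zero actL_lpi. Qed.

Lemma actL_sum (I : finType) (P : pred I) (F : I -> L) f :
  actL (\sum_(i | P i) F i) f = fun w => \sum_(i | P i) actL (F i) f w.
Proof.
apply: funext => w; apply: (big_morph (fun y => actL y f w)); last by rewrite actL0.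
by move=> y z; rewrite actLD.
Qed.

Lemma actL_vert v f : actL (lvert v) f = proj (inl v) f.
Proof. by rewrite actL_lpi. Qed.

Lemma actL_trans e a (i : 'I_(arity e a)) j f :
  actL (trans K i j) f = jump (mk i) (mk j) f.
Proof.
case: a i j => [v|h] i j; last by case: e i j => i j; rewrite /trans actL_lpi.
rewrite actL_vert /jump.
have -> : vc (mk i) = mk i by rewrite [RHS](@vcornerP _ _ v).
have -> : vc (mk j) = mk j by rewrite [RHS](@vcornerP _ _ v).
rewrite (@vcornerP _ (mk i) v) // (@vcornerP _ (mk j) v) // !Eop_vcorner.
by rewrite [RHS]proj_supp //; apply: supp_proj.
Qed.

Lemma actL_trans_elt q u f : actL (trans_elt K q u) f = jump q u f.
Proof.
have [cqu|ncqu] := eqVneq (cellof q) (cellof u); last first.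
  rewrite trans_elt_cell // actL0 /jump.
  have [squ|nsqu] := eqVneq (side q) (side u).
    by rewrite Eop_ortho //; apply: contra_neq ncqu => ->.
  by rewrite (@Eop_cell _ _ _ _ (cellof q)) //; apply: Eop_support.
have [squ|nsqu] := eqVneq (side q) (side u).
  rewrite trans_elt_same //; have [<-|qu] := eqVneq q u.
    by rewrite actL_vert /jump Eop_comp ?compat_vc // Eop_vcorner.
  by rewrite actL0 /jump Eop_ortho.
elim/corner_ind: q cqu nsqu => e a i; elim/corner_ind: u => e' a' j.
rewrite /cellof /side /= => ? ee'; subst a'.
have ? : e' = ~~ e by case: e e' ee' {i j} => [] [].
by subst e'; rewrite trans_elt_trans actL_trans.
Qed.

End Action.

(** * Faithfulness of the normal form *)

Section NormalForm.
Variables (K : fieldType) (H : hypergraph).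
Notation V := (vertex H).
Notation L := (lpa K H).
Notation corner := (corner H).
Notation nfword := (nfword H).
Notation trans_elt := (@trans_elt K H).
Implicit Types (w : nfword) (p q : corner) (f g : nfword -> K).

(** The sum of the empty words; [coords] records the orbit of this vector, on
    which the algebra acts freely. *)
Definition Omega : nfword -> K := fun w => if w.2 is [::] then 1 else 0.

Definition coords (y : L) : nfword -> K := actL y Omega.

Definition delta w0 : nfword -> K := fun w => if w == w0 then 1 else 0.

(** The product of matrix units spelled by a word, as a family of
    coordinates over the algebra. *)
Fixpoint word_family_steps (v : V) (s : seq (corner * corner)) (u : corner) : L :=
  if s is (t, q) :: s' then word_family_steps v s' t * trans_elt q u
  else trans_elt (vcorner true v) u.
Definition word_family w u := word_family_steps w.1 w.2 u.

(** A family indexed by corners that comes from elements of cells: the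
    coordinates on either side determine all the others. *)
Definition coherent (x : corner -> L) : Prop :=
  forall e u, x u = \sum_(t | side t == e) x t * trans_elt t u.

Lemma trans_elt_vcorner e v u :
  trans_elt (vcorner e v) u = if cellof u == inl v then lvert v else 0.
Proof.
case: eqP => [cu|/eqP cu]; last by rewrite trans_elt_cell // eq_sym.
rewrite (vcornerP cu); have [->|se] := eqVneq (side u) e; first by rewrite trans_elt_diag.
have -> : side u = ~~ e by case: (side u) e se => [] [].
by rewrite trans_elt_trans.
Qed.

Lemma coherent_trans_elt (y : L) q : coherent (fun u => y * trans_elt q u).
Proof.
move=> e u; rewrite -(trans_elt_comp K e q u) mulr_sumr.
by apply: eq_bigr => t _; rewrite mulrA.
Qed.

Lemma word_family_coherent w : coherent (word_family w).
Proof.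
case: w => v [|[t q] s]; rewrite /word_family /=; last exact: coherent_trans_elt.
by move=> e u; rewrite -(trans_elt_comp K e).
Qed.

Lemma coherent_lab x u : coherent x -> x u * lvert (lab u) = x u.
Proof.
move=> xc; rewrite (xc (side u) u) mulr_suml; apply: eq_bigr => t _.
by rewrite -mulrA trans_elt_lab.
Qed.

Lemma coherent_vcorner x v : coherent x -> x (vcorner false v) = x (vcorner true v).
Proof.
move=> xc; rewrite (xc true) (bigD1 (vcorner true v)) //= trans_elt_vcorner eqxx.
rewrite (coherent_lab (vcorner true v)) // big1 ?addr0 // => t /andP[/eqP st tv].
rewrite trans_elt_cell ?mulr0 //; apply: contraNneq tv => /vcornerP ->.
by rewrite st.
Qed.

(** A function of words and a coherent family with the same expansion in
    words.  This relation is the graph of an isomorphism; following the algebra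
    along it shows that no element is lost in [coords]. *)
Definition represents f (x : corner -> L) : Prop :=
  exists s : seq (K * nfword),
    [/\ all (fun kw => valid kw.2) s,
        f = fun w => \sum_(kw <- s) kw.1 * delta kw.2 w &
        x = fun u => \sum_(kw <- s) kw.1 *: word_family kw.2 u].

Lemma represents0 : represents (fun _ => 0) (fun _ => 0).
Proof. by exists [::]; split=> //; apply: funext => ?; rewrite big_nil. Qed.

Lemma representsD f g x y : represents f x -> represents g y ->
  represents (fun w => f w + g w) (fun u => x u + y u).
Proof.
move=> [s [vs -> ->]] [s' [vs' -> ->]]; exists (s ++ s').
by split; rewrite ?all_cat ?vs //; apply: funext => ?; rewrite big_cat.
Qed.

Lemma representsZ k f x : represents f x ->
  represents (fun w => k * f w) (fun u => k *: x u).
Proof.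
move=> [s [vs -> ->]]; exists [seq (k * kw.1, kw.2) | kw <- s]; split.
- by rewrite all_map.
- by apply: funext => w; rewrite big_map mulr_sumr; apply: eq_bigr => i _; rewrite mulrA.
- by apply: funext => w; rewrite big_map scaler_sumr; apply: eq_bigr => i _; rewrite scalerA.
Qed.

Lemma represents_sum (I : Type) (s : seq I) (P : pred I) (F : I -> nfword -> K)
    (X : I -> corner -> L) :
  (forall i, P i -> represents (F i) (X i)) ->
  represents (fun w => \sum_(i <- s | P i) F i w) (fun u => \sum_(i <- s | P i) X i u).
Proof.
move=> FX; elim: s => [|i s IHs].
  have := represents0; congr (represents _ _); apply: funext => ?; by rewrite big_nil.
have [Pi|nPi] := boolP (P i); last first.
  by move: IHs; congr (represents _ _); apply: funext => ?; rewrite big_cons (negPf nPi).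
have := representsD (FX i Pi) IHs.
by congr (represents _ _); apply: funext => ?; rewrite big_cons Pi.
Qed.

Lemma represents_delta w : valid w -> represents (delta w) (word_family w).
Proof.
move=> vw; exists [:: (1, w)]; split; first by rewrite /= vw.
  by apply: funext => w'; rewrite big_seq1 mul1r.
by apply: funext => u; rewrite big_seq1 scale1r.
Qed.

Lemma represents_coherent f x : represents f x -> coherent x.
Proof.
move=> [s [_ _ ->]] e u; rewrite (eq_bigr (fun kw => kw.1 *: \sum_(t | side t == e) word_family kw.2 t * trans_elt t u)).
  under eq_bigr do rewrite scaler_sumr.
  rewrite exchange_big; apply: eq_bigr => t _; rewrite mulr_suml.
  by apply: eq_bigr => i _; rewrite lpaZAl.
by move=> i _; rewrite -(word_family_coherent i.2 e u).
Qed.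

Lemma Ecoef_delta t p w w1 : ~~ wlast (side p) w -> Ecoef t p (delta w) w1 =
  if (t == p) && (w1 == w) then 1 else 0.
Proof.
move=> nlw; rewrite /Ecoef /delta.
have -> : (wcons t p w1 == w) = false.
  by apply: contraNF nlw => /eqP <-; rewrite /wlast /=.
by case: (t == p) => /=; rewrite ?if_same ?addr0.
Qed.

(** Words are built from the empty words by matrix units. *)
Lemma Eop_delta_wcons p q w : extensible w p -> compat p q ->
  ~~ ((p == q) && is_base q) -> Eop p q (delta w) = delta (wcons p q w).
Proof.
move=> ext cpq npq; have /and3P[vw nlw /eqP pw] := ext.
apply: funext => w1; rewrite /Eop cpq /=.
case vw1: (valid w1) => /=; last first.
  rewrite /delta; case: eqP => // w1E.
  by move: vw1; rewrite w1E valid_wcons cpq npq ext.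
have [lw1|lw1] := boolP (wlast (side q) w1).
  case: w1 vw1 lw1 => v [//|[t u] s] vw1; rewrite /wlast /= => suq.
  rewrite !Ecoef_delta //.
  have -> : (if [&& t == u, is_base q & cellof q == cellof u] then
     if (q == p) && ((v, s) == w) then 1 else 0 else 0) = 0 :> K.
    case: ifP => // /and3P[_ bq _]; case: ifP => // /andP[/eqP qp _].
    by move: npq; rewrite qp eqxx -qp bq.
  rewrite subr0 /delta; case: w {ext vw nlw pw} => v' s'.
  rewrite /wcons /= -[(v, _ :: _) == _]/((v == v') && (((t, u) == (p, q)) && (s == s'))).
  rewrite -[(v, s) == _]/((v == v') && (s == s')) xpair_eqE.
  by case: (u == q) (t == p) (v == v') (s == s') => [] [] [] [].
have -> : delta (wcons p q w) w1 = 0.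
  rewrite /delta; case: eqP => // w1E; move: lw1.
  by rewrite w1E /wlast /= eqxx.
case: ifP => // /andP[bq _]; rewrite Ecoef_delta //; case: ifP => // /andP[/eqP qp _].
by move: npq; rewrite qp eqxx -qp bq.
Qed.

Lemma delta_supp w : valid w -> supp (wend w) (delta w).
Proof.
move=> vw w1; rewrite /delta; case: (w1 =P w) => [->|]; last by rewrite eqxx.
by rewrite vw eqxx.
Qed.

Lemma word_family_cell w u : cellof u != wend w -> word_family w u = 0.
Proof.
case: w => v [|[t q] s]; rewrite /wend /word_family /= => cu.
  by rewrite trans_elt_vcorner (negPf cu).
by rewrite trans_elt_cell ?mulr0 // eq_sym.
Qed.

(** A matrix unit after a word of the other side makes a longer normal word,
    unless it is the base unit, which is rewritten as the identity minus the
    other diagonal units. *)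
Lemma represents_Eop_new w p q : valid w -> ~~ wlast (side p) w -> compat p q ->
  represents (Eop p q (delta w)) (fun u => word_family w p * trans_elt q u).
Proof.
move=> vw nlw cpq.
have [pw|pw] := eqVneq (cellof p) (wend w); last first.
  rewrite (@Eop_cell _ _ p q _ _ (delta_supp vw)) 1?eq_sym // word_family_cell //.
  by have := represents0; congr represents; apply: funext => u; rewrite mul0r.
have ext t : side t = side p -> cellof t = cellof p -> extensible w t.
  by move=> st ct; rewrite /extensible vw st nlw ct pw eqxx.
have step t r : side t = side p -> cellof t = cellof p -> compat t r ->
    ~~ ((t == r) && is_base r) ->
    represents (Eop t r (delta w)) (fun u => word_family w t * trans_elt r u).
  move=> st ct ctr ntr; rewrite Eop_delta_wcons ?ext //.
  by apply: represents_delta; rewrite valid_wcons ctr ntr ext.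
have [/andP[/eqP pq bq]|] := boolP ((p == q) && is_base q); last exact: step.
rewrite -pq in bq *.
pose P t := (side t == side p) && (cellof t == cellof p).
have Pp : P p by rewrite /P !eqxx.
have -> : Eop p p (delta w) = fun w' => delta w w' +
    \sum_(t | P t && (t != p)) -1 * Eop t t (delta w) w'.
  apply: funext => w'; rewrite -mulr_sumr mulN1r.
  have <- := congr1 (fun f => f w') (proj_supp (delta_supp vw)).
  by rewrite /= -(sum_Eop (side p)) -pw (bigD1 p) ?Pp //= addrK.
have -> : (fun u => word_family w p * trans_elt p u) = fun u => word_family w u +
    \sum_(t | P t && (t != p)) -1 *: (word_family w t * trans_elt t u).
  apply: funext => u; rewrite -scaler_sumr scaleN1r (word_family_coherent w (side p) u).
  rewrite (bigID P) /= [X in _ + X - _]big1 ?addr0; last first.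
    move=> t /andP[st]; rewrite /P st /= => ct.
    by rewrite word_family_cell ?mul0r // -pw.
  rewrite (bigD1 p) ?Pp ?eqxx //= [X in _ + X - _](eq_bigl (fun t => P t && (t != p))) ?addrK //.
  by move=> t; rewrite /P; case: (side t == _).
apply: representsD; first exact: represents_delta.
apply: represents_sum => t /andP[/andP[/eqP st /eqP ct] tp].
apply: representsZ; apply: step => //; first by rewrite /compat !eqxx.
rewrite eqxx /=; apply: contra tp => bt; apply/eqP; exact: is_baseP.
Qed.

(** If the word ends with the same side, the two last units are multiplied
    first, which leads back to the previous case. *)
Lemma represents_Eop f x p q : compat p q -> represents f x ->
  represents (Eop p q f) (fun u => x p * trans_elt q u).
Proof.
move=> cpq [s [vs -> ->]].
have -> : Eop p q (fun w => \sum_(kw <- s) kw.1 * delta kw.2 w) =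
    fun w => \sum_(kw <- s) kw.1 * Eop p q (delta kw.2) w.
  exact: (Eop_linear p q s (fun kw => kw.1) (fun kw => delta kw.2)).
have -> : (fun u => (\sum_(kw <- s) kw.1 *: word_family kw.2 p) * trans_elt q u) =
    fun u => \sum_(kw <- s) kw.1 *: (word_family kw.2 p * trans_elt q u).
  by apply: funext => u; rewrite mulr_suml; apply: eq_bigr => i _; rewrite lpaZAl.
elim: s vs => [_|[k w] s IHs /= /andP[vw vs]].
  by have := represents0; congr represents; apply: funext => ?; rewrite big_nil.
have -> : (fun w0 => \sum_(kw <- (k, w) :: s) kw.1 * Eop p q (delta kw.2) w0) =
   fun w0 => k * Eop p q (delta w) w0 + \sum_(kw <- s) kw.1 * Eop p q (delta kw.2) w0.
  by apply: funext => w0; rewrite big_cons.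
have -> : (fun u => \sum_(kw <- (k, w) :: s) kw.1 *: (word_family kw.2 p * trans_elt q u)) =
   fun u => k *: (word_family w p * trans_elt q u) + \sum_(kw <- s) kw.1 *: (word_family kw.2 p * trans_elt q u).
  by apply: funext => u; rewrite big_cons.
apply: representsD (IHs vs); apply: representsZ.
have [lw|] := boolP (wlast (side p) w); last by move=> nl; exact: represents_Eop_new.
case: w vw lw => v [//|[t r] s'] vw; rewrite /wlast /= => /eqP srp.
have := vw; rewrite -/(wcons t r (v, s')) valid_wcons => /and3P[ctr ntr ext].
have /and3P[vw' nlw' _] := ext.
rewrite -(Eop_delta_wcons ext ctr) //.
have -> : word_family (wcons t r (v, s')) p = word_family (v, s') t * trans_elt r p by [].
have [rp|rp] := eqVneq r p.
  rewrite -rp Eop_comp //.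
  have -> : (fun u => word_family (v, s') t * trans_elt r r * trans_elt q u) = fun u => word_family (v, s') t * trans_elt q u.
    apply: funext => u; rewrite trans_elt_diag -mulrA; congr (_ * _).
    by move: cpq; rewrite -rp => /andP[_ /eqP ->]; rewrite lab_trans_elt.
  apply: represents_Eop_new => //.
  by move: ctr cpq; rewrite rp /compat => /andP[/eqP -> /eqP ->].
rewrite Eop_ortho //; have := represents0; congr represents; apply: funext => u.
by rewrite trans_elt_same // (negPf rp) mulr0 mul0r.
Qed.

(** The coordinates of [x y], for [y] in the algebra, at the cells that are
    vertices. *)
Definition vertex_family (x : corner -> L) (y : L) : corner -> L := fun u =>
  if cellof u is inl v then (\sum_v' x (vcorner true v')) * y * lvert v else 0.

Lemma coherent_sum x v : coherent x ->
  (\sum_v' x (vcorner true v')) * lvert v = x (vcorner true v).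
Proof.
move=> xc; rewrite mulr_suml (bigD1 v) //= (coherent_lab (vcorner true v)) //.
rewrite big1 ?addr0 // => v' v'v.
by rewrite -(coherent_lab (vcorner true v') xc) -mulrA lvertM (negPf v'v) mulr0.
Qed.

Lemma vertex_family_sum x y : (\sum_v' vertex_family x y (vcorner true v')) = (\sum_v' x (vcorner true v')) * y.
Proof. by rewrite /vertex_family /= -mulr_sumr -lpa_oneE mulr1. Qed.

Lemma vertex_familyM x y z : vertex_family (vertex_family x y) z = vertex_family x (y * z).
Proof.
apply: funext => u; rewrite /vertex_family; case cu: (cellof u) => [v|//].
by rewrite -!/(vertex_family _ _ _) vertex_family_sum !mulrA.
Qed.

Lemma represents_vertex_family f x (t : lterm K H) :
  represents f x -> represents (term_act t f) (vertex_family x (lpi t)).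
Proof.
have jumpE q u g y : represents g y ->
    represents (jump q u g) (fun r => y (vc q) * trans_elt q u * trans_elt (vc u) r).
  by move=> gy; apply: represents_Eop (compat_vc' _) (represents_Eop (compat_vc _) gy).
elim: t f x => [v|h i j|h i j||t IHt u IHu|a t IHt|t IHt u IHu] f x fx.
- rewrite /= -(Eop_vcorner true).
  have := represents_Eop (compat_vc (vcorner true v)) fx; rewrite /vc /=.
  congr represents; apply: funext => u; rewrite trans_elt_vcorner /vertex_family.
  case cu: (cellof u) => [v'|h] /=; last by rewrite mulr0.
  rewrite -mulrA -/(lvert v) lvertM.
  rewrite -[inl v' == inl v]/(v' == v) eq_sym; case: eqP => [->|_]; rewrite ?mulr0 //.
  rewrite (coherent_sum _ (represents_coherent fx)).
  exact: (coherent_lab (vcorner true v') (represents_coherent fx)).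
- have := jumpE (@mk H true (inr h) i) (@mk H false (inr h) j) _ _ fx.
  congr represents; apply: funext => u.
  rewrite (@trans_elt_trans K H true (inr h) i j) /= trans_elt_vcorner /vertex_family.
  case cu: (cellof u) => [v'|h'] /=; last by rewrite mulr0.
  rewrite -/(ledge i j) -[ledge i j in RHS]lsrc_edge mulrA.
  rewrite (coherent_sum _ (represents_coherent fx)).
  rewrite -[inl v' == inl _]/(v' == hrng j); case: (v' =P hrng j) => [->|/eqP v'j].
    by [].
  rewrite mulr0 -mulrA -[ledge i j]ledge_rng -mulrA lvertM.
  by rewrite eq_sym (negPf v'j) !mulr0.
- have := jumpE (@mk H false (inr h) j) (@mk H true (inr h) i) _ _ fx.
  congr represents; apply: funext => u.
  rewrite (@trans_elt_trans K H false (inr h) j i) /= trans_elt_vcorner /vertex_family.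
  rewrite /vc /= (coherent_vcorner _ (represents_coherent fx)).
  case cu: (cellof u) => [v'|h'] /=; last by rewrite mulr0.
  rewrite -/(lstar i j) -[lstar i j in RHS]lrng_star mulrA.
  rewrite (coherent_sum _ (represents_coherent fx)).
  rewrite -[inl v' == inl _]/(v' == hsrc i); case: (v' =P hsrc i) => [->|/eqP v'j].
    by [].
  rewrite mulr0 -mulrA -[lstar i j]lstar_src -mulrA lvertM.
  by rewrite eq_sym (negPf v'j) !mulr0.
- have := represents0; congr represents; apply: funext => u; rewrite /vertex_family.
  by case: (cellof u) => // v; rewrite lpi_zero mulr0 mul0r.
- have := representsD (IHt _ _ fx) (IHu _ _ fx); congr represents.
  apply: funext => r; rewrite /vertex_family; case: (cellof r) => [v|_]; last by rewrite addr0.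
  by rewrite lpi_add mulrDr mulrDl.
- have := representsZ a (IHt _ _ fx); congr represents.
  apply: funext => r; rewrite /vertex_family; case: (cellof r) => [v|_]; last by rewrite scaler0.
  by rewrite lpi_scale -lpaZAr -lpaZAl.
- by rewrite lpi_mul -vertex_familyM; apply: IHu; apply: IHt.
Qed.

Lemma represents_Omega :
  represents Omega (fun u => \sum_v trans_elt (vcorner true v) u).
Proof.
have -> : Omega = fun w => \sum_v delta (v, [::]) w.
  apply: funext => -[v [|a s]]; rewrite /Omega /delta /=.
    rewrite (bigD1 v) //= eqxx big1 ?addr0 // => v' v'v.
    by rewrite xpair_eqE eq_sym (negPf v'v).
  by rewrite big1 // => v' _; rewrite xpair_eqE /= andbF.
by apply: represents_sum => v _; apply: (@represents_delta (v, [::])).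
Qed.

Lemma represents_coords y :
  represents (coords y) (fun u => if cellof u is inl v then y * lvert v else 0).
Proof.
elim/lpa_ind: y => t; rewrite /coords actL_lpi.
have := represents_vertex_family t represents_Omega; congr represents.
apply: funext => u; rewrite /vertex_family; case: (cellof u) => // v; congr (_ * _).
suff -> : \sum_v' \sum_v0 trans_elt (vcorner true v0) (vcorner true v') = 1 by rewrite mul1r.
rewrite lpa_oneE; apply: eq_bigr => v' _.
rewrite (bigD1 v') //= trans_elt_diag big1 ?addr0 // => v0 v0v.
by rewrite trans_elt_vcorner; case: eqP => // -[E0]; rewrite E0 eqxx in v0v.
Qed.

Lemma represents_eq0 x : represents (fun _ => 0) x -> x = fun _ => 0.
Proof.
move=> [s [_ s0 ->]]; apply: funext => u.
have -> : \sum_(kw <- s) kw.1 *: word_family kw.2 u =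
    \sum_(w <- undup [seq kw.2 | kw <- s]) (\sum_(kw <- s) kw.1 * delta kw.2 w) *: word_family w u.
  under [RHS]eq_bigr do rewrite scaler_suml.
  rewrite exchange_big /= big_seq [RHS]big_seq; apply: eq_bigr => -[k w] kws /=.
  rewrite (bigD1_seq w) ?undup_uniq ?mem_undup ?(map_f snd kws) //=.
  rewrite /delta eqxx mulr1 big1 ?addr0 // => w' w'w.
  by rewrite (negPf w'w) mulr0 scale0r.
by rewrite big1 // => w _; rewrite -(congr1 (fun f => f w) s0) scale0r.
Qed.

(** Normal words span: an element whose coordinates vanish is an empty
    combination of words. *)
Lemma coords_eq0 y : coords y = (fun _ => 0) -> y = 0.
Proof.
move=> y0; have := represents_coords y; rewrite y0 => r0; have E0 := @represents_eq0 _ r0.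
rewrite -[y]mulr1 lpa_oneE mulr_sumr big1 // => v _.
by have := congr1 (fun x : corner -> L => x (vcorner true v)) E0.
Qed.

Lemma coords_vert v : coords (lvert v) = delta (v, [::]).
Proof.
apply: funext => -[v' s]; rewrite /coords actL_vert /proj /delta /Omega.
case: s => [|a s] /=; last by rewrite if_same; case: eqP => // -[].
by rewrite xpair_eqE andbT /wend /=.
Qed.

(** The coordinates of a vertex are those of an empty word. *)
Lemma lvert_neq0 v : lvert v != 0 :> L.
Proof.
apply/eqP => v0; have := coords_vert v; rewrite v0 /coords actL0.
move=> /(congr1 (fun f => f (v, [::]))); rewrite /delta eqxx => /eqP.
by rewrite eq_sym oner_eq0.
Qed.

End NormalForm.

(** * The degree filtration *)

Section Filtration.
Variables (K : fieldType) (H : hypergraph).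
Notation V := (vertex H).
Notation L := (lpa K H).
Notation corner := (corner H).
Notation nfword := (nfword H).
Notation trans_elt := (@trans_elt K H).
Implicit Types (w : nfword) (c t u : corner) (y : L).

Definition located (a : cell H) (x : corner -> L) : Prop :=
  forall c, cellof c != a -> x c = 0.

(** The coordinates of an element of a cell.  Its source coordinates are used
    to define it; by [Eop_family_coords] the range coordinates lead to the same
    function. *)
Definition family_coords (x : corner -> L) : nfword -> K :=
  fun w => \sum_(t | side t == true) Eop (vc t) t (coords (x t)) w.

(** Every corner, on either side, recovers its own entry: the change of
    coordinates acts as it should by [actL_trans_elt]. *)
Lemma Eop_family_coords x u : coherent x -> Eop u (vc u) (family_coords x) = coords (x u).
Proof.
move=> xc; rewrite /family_coords (op_sum (@Eop_linear _ _ _ _)).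
rewrite [in RHS](xc true u) /coords actL_sum; apply: funext => w.
by apply: eq_bigr => t _; rewrite actLM actL_trans_elt.
Qed.

Lemma supp_family_coords a x : located a x -> supp a (family_coords x).
Proof.
move=> xa w; apply: contraR => nw; apply/eqP; apply: big1 => t _.
apply/eqP; apply: contraR nw => nz.
have [<-|ta] := eqVneq (cellof t) a; first exact: Eop_support nz.
move: nz; rewrite xa // /coords actL0.
by rewrite (op_zero (@Eop_linear _ _ _ _)) eqxx.
Qed.

Lemma Ecoef_family_coords x c t w : coherent x -> compat c t -> extensible w c ->
  Ecoef c (vc t) (coords (x t)) w = Ecoef c t (family_coords x) w.
Proof.
move=> xc cct ext; rewrite -Eop_family_coords // Ecoef_Eop ?eqxx ?compat_vc' //.
Qed.

Definition vanish (d : nat) (f : nfword -> K) := forall w, (d <= nflen w)%N -> f w = 0.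

(** The columns at [v] of degree at most [d] on the side [e]: if all the matrix
    units of that side that end at [v] are split off, only words of length less
    than [d] remain.  In particular a nonzero element has degree at least one
    ([fil_eq0]). *)
Definition fil (e : bool) (d : nat) (v : V) (y : L) : Prop :=
  forall c w, side c = e -> lab c = v -> extensible w c -> (d <= nflen w)%N ->
    Ecoef c (vcorner e v) (coords y) w = 0.

Lemma fil0 e d v : fil e d v 0.
Proof. by move=> c w _ _ _ _; rewrite /coords actL0 /Ecoef !if_same addr0. Qed.

Lemma filD e d v y z : fil e d v y -> fil e d v z -> fil e d v (y + z).
Proof.
move=> fy fz c w sc lc ext dw; rewrite /coords actLD -/(coords y) -/(coords z).
rewrite -[RHS]addr0 -{1}(fy c w) // -(fz c w) // /Ecoef.
by case: (c == _); case: is_base; rewrite ?add0r ?addr0 // addrACA.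
Qed.

Lemma filZ e d v k y : fil e d v y -> fil e d v (k *: y).
Proof.
move=> fy c w sc lc ext dw; rewrite /coords actLZ -/(coords y).
rewrite -[RHS](mulr0 k) -(fy c w) // /Ecoef mulrDr.
by case: (c == _); case: is_base; rewrite /= ?mulr0.
Qed.

Lemma fil_mono e d d' v y : (d <= d')%N -> fil e d v y -> fil e d' v y.
Proof. by move=> dd' fy c w sc lc ext dw; apply: fy => //; apply: leq_trans dw. Qed.

Lemma coords_supp v y : y * lvert v = y -> supp (inl v) (coords y).
Proof. by move=> <-; rewrite /coords actLM actL_vert; apply: supp_proj. Qed.

(** Degree zero forbids every word. *)
Lemma fil_eq0 e v y : y * lvert v = y -> fil e 0 v y -> y = 0.
Proof.
move=> yv fy; apply: coords_eq0; apply: funext => w.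
apply/eqP; apply/negPn/negP => nz; have := nz; have := coords_supp yv nz.
move=> /andP[vw /eqP wv]; case/negP; apply/eqP.
have bc : is_base (vcorner e v) by exact: is_base_base.
have [lw|lw] := boolP (wlast e w); last first.
  have := fy (vcorner e v) w erefl erefl; rewrite /Ecoef eqxx bc addr0; apply => //.
  by rewrite /extensible vw lw wv /= eqxx.
case: w vw wv {nz} lw => v' [//|[t u] s] vw; rewrite /wlast /wend /= => uv /eqP ue.
have uE : u = vcorner e v by rewrite (vcornerP uv) ue.
have := vw; rewrite -/(wcons t u (v', s)) valid_wcons => /and3P[ctu ntu ext].
have /andP[/eqP stu /eqP ltu] := ctu.
have := fy t (v', s); rewrite stu ltu uE => /(_ erefl erefl ext (leq0n _)).
rewrite /Ecoef /wcons /=; move: ntu; rewrite uE bc andbT => /negPf->.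
by rewrite add0r.
Qed.

Lemma fil_exists y : exists d, forall e v, fil e d v y.
Proof.
have [s [_ yE _]] := represents_coords y.
have [d ds] : exists d, forall kw, kw \in s -> (nflen kw.2 < d)%N.
  elim: (s) => [|a s' [d ds']]; first by exists 0%N.
  exists (maxn (nflen a.2).+1 d) => kw; rewrite inE leq_max => /orP[/eqP->|/ds'->].
    by rewrite ltnSn.
  by rewrite orbT.
have van w : (d <= nflen w)%N -> coords y w = 0.
  move=> dw; rewrite yE big_seq big1 // => kw /ds kwd; rewrite /delta.
  case: eqP => [wE|]; last by rewrite mulr0.
  by move: dw; rewrite wE leqNgt kwd.
exists d => e v c w _ _ _ dw; rewrite /Ecoef !van ?if_same ?addr0 //.
by rewrite /nflen /=; apply: leq_trans dw (leqnSn _).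
Qed.

Lemma vanish_fil x d : coherent x -> vanish d (family_coords x) ->
  forall c, fil (side c) d (lab c) (x c).
Proof.
move=> xc van c t w st lt ext dw; rewrite -[vcorner _ _]/(vc c).
have ctc : compat t c by rewrite /compat st lt !eqxx.
rewrite Ecoef_family_coords // /Ecoef !van ?if_same ?addr0 //.
by rewrite /nflen /=; apply: leq_trans dw (leqnSn _).
Qed.

(** At a word that does not end with the side [e], the value of an element of
    a cell is its coefficient at the base unit of that side. *)
Lemma family_coords_nolast a x e d w : coherent x -> located a x ->
  (forall c, side c = e -> fil e d (lab c) (x c)) ->
  ~~ wlast e w -> (d <= nflen w)%N -> family_coords x w = 0.
Proof.
move=> xc xa fx lw dw; apply/eqP; apply/negPn/negP => nz.
have /andP[vw /eqP wa] := supp_family_coords xa nz; case/negP: nz; apply/eqP.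
have ext : extensible w (base e a) by rewrite /extensible vw lw wa eqxx.
have := fx (base e a) erefl (base e a) w erefl erefl ext dw.
rewrite -[vcorner _ _]/(vc (base e a)) Ecoef_family_coords //; last by rewrite /compat !eqxx.
by rewrite /Ecoef eqxx is_base_base addr0.
Qed.

(** A word ending with the side [e] is its predecessor followed by one unit,
    which costs one more letter than in [family_coords_nolast]. *)
Lemma family_coords_vanish a x e d : coherent x -> located a x ->
  (forall c, side c = e -> fil e d (lab c) (x c)) -> vanish d.+1 (family_coords x).
Proof.
move=> xc xa fx w dw.
have [lw|lw] := boolP (wlast e w); last exact: (family_coords_nolast xc xa fx lw (ltnW dw)).
apply/eqP; apply/negPn/negP => nz.
have /andP[vw /eqP wa] := supp_family_coords xa nz; case/negP: nz; apply/eqP.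
case: w vw wa lw dw => v [//|[t u] s] vw; rewrite /wend /wlast /nflen /= => ua /eqP ue dw.
have := vw; rewrite -/(wcons t u (v, s)) valid_wcons => /and3P[ctu ntu ext].
have /andP[/eqP st /eqP lt] := ctu.
have := fx u ue t (v, s); rewrite st lt ue => /(_ erefl erefl ext dw).
have -> : vcorner e (lab u) = vc u by rewrite /vc ue.
rewrite Ecoef_family_coords // /Ecoef (negPf ntu) => <-; rewrite -[LHS]add0r; congr (_ + _).
case: eqP => // _; symmetry; apply: (family_coords_nolast xc xa fx) => //.
by have /and3P[_ + _] := ext; rewrite st ue.
Qed.

(** A bound for one side bounds the length of all words that occur, and hence
    the degree on the other side, at the cost of one letter. *)
Lemma fil_other a x e d : coherent x -> located a x ->
  (forall c, side c = e -> fil e d (lab c) (x c)) ->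
  forall c, fil (side c) d.+1 (lab c) (x c).
Proof.
move=> xc xa fx; apply: vanish_fil => //; exact: (family_coords_vanish xc xa fx).
Qed.

(** A word that ends with one side does not end with the other, so bounds on
    both sides save the letter lost in [family_coords_vanish]. *)
Lemma family_coords_vanish2 a x d : coherent x -> located a x ->
  (forall c, fil (side c) d (lab c) (x c)) -> vanish d (family_coords x).
Proof.
move=> xc xa fx w dw.
have fe e c : side c = e -> fil e d (lab c) (x c) by move=> <-.
have [lw|lw] := boolP (wlast true w); last exact: (family_coords_nolast xc xa (fe true) lw dw).
apply: (family_coords_nolast xc xa (fe false)) dw.
by move: lw; rewrite /wlast; case: w.2 => // -[t u] s /eqP ->.
Qed.

(** Absence of cancellation.  The coefficient of the sum at a word [w] of
    length [d] followed by the unit from [c] receives the value at [w] of the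
    element [p c] only, because the words of the other summands that end with
    this unit have length greater than [d]. *)
Lemma fil_free e d v (p : corner -> corner -> L) :
  (forall b, side b = e -> lab b = v ->
     [/\ coherent (p b), located (cellof b) (p b) &
         forall c, fil (side c) d.+1 (lab c) (p b c)]) ->
  fil e d v (\sum_(b | (side b == e) && (lab b == v)) p b b) ->
  forall b c, side b = e -> lab b = v -> side c = e -> fil e d (lab c) (p b c).
Proof.
move=> hp fs.
have van b : side b = e -> lab b = v -> vanish d.+1 (family_coords (p b)).
  by move=> sb lb; have [piece_at pl pf] := hp b sb lb; exact: (family_coords_vanish2 piece_at pl pf).
have top c w : side c = e -> lab c = v -> extensible w c -> (d <= nflen w)%N ->
    family_coords (p c) w = 0.
  move=> sc lc ext dw; have := fs c w sc lc ext dw.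
  have -> : coords (\sum_(b | (side b == e) && (lab b == v)) p b b) =
      fun w => \sum_(b | (side b == e) && (lab b == v)) coords (p b b) w.
    by rewrite /coords actL_sum.
  have -> : Ecoef c (vcorner e v)
      (fun w => \sum_(b | (side b == e) && (lab b == v)) coords (p b b) w) w =
      \sum_(b | (side b == e) && (lab b == v)) Ecoef c b (family_coords (p b)) w.
    transitivity (\sum_(b | (side b == e) && (lab b == v)) Ecoef c (vcorner e v) (coords (p b b)) w).
      rewrite /Ecoef; case: (c == vcorner e v) => /=; case: (is_base (vcorner e v)) => /=.
      - by rewrite addr0; apply: eq_bigr => b _; rewrite addr0.
      - by rewrite big_split.
      - by rewrite add0r; apply: eq_bigr => b _; rewrite add0r.
      - by rewrite add0r; apply: eq_bigr => b _; rewrite add0r.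
    apply: eq_bigr => b /andP[/eqP sb /eqP lb]; have [piece_at _ _] := hp b sb lb.
    by rewrite -Ecoef_family_coords // /vc ?sb ?lb // /compat sc lc sb lb !eqxx.
  rewrite (bigD1 c) ?sc ?lc ?eqxx //= big1 ?addr0.
    by rewrite {1}/Ecoef eqxx /= [family_coords _ (wcons _ _ _)]van ?if_same ?addr0.
  move=> b /andP[/andP[/eqP sb /eqP lb] bc].
  by rewrite /Ecoef eq_sym (negPf bc) /= add0r van.
move=> b c sb lb sc t w st lt ext dw.
have [piece_at pl pf] := hp b sb lb.
have -> : vcorner e (lab c) = vc c by rewrite /vc sc.
rewrite Ecoef_family_coords //; last by rewrite /compat st sc lt !eqxx.
rewrite /Ecoef [family_coords _ (wcons _ _ _)]van // if_same addr0; case: eqP => // _.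
apply/eqP; apply/negPn/negP => nz.
have /andP[vw /eqP wb] := supp_family_coords pl nz; case/negP: nz; apply/eqP; apply: top => //.
have /and3P[_ nlw _] := ext.
by rewrite /extensible vw sb -st nlw wb eqxx.
Qed.

Lemma fil_vert e v : fil e 1 v (lvert v).
Proof.
move=> c w sc lc ext dw; rewrite /Ecoef coords_vert /delta.
case: w dw ext => v' [//|a s] _ _; rewrite /wcons /= !xpair_eqE /= !andbF.
by rewrite !if_same addr0.
Qed.

End Filtration.

(** * Columns as a right module *)

Section RightScaling.
Variables (K : fieldType) (H : hypergraph) (m : nat).
Notation L := (lpa K H).
Implicit Types (x : 'cV[L]_m) (y z : L).

Definition rsc x y : 'cV[L]_m := x *m (y%:M : 'M_1).

Lemma rscE x y i j : rsc x y i j = x i j * y.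
Proof. by rewrite /rsc !mxE big_ord1 !mxE (ord1 j) eqxx mulr1n. Qed.

Lemma rscDl x x' y : rsc (x + x') y = rsc x y + rsc x' y.
Proof. exact: mulmxDl. Qed.
Lemma rscDr x y z : rsc x (y + z) = rsc x y + rsc x z.
Proof. by apply/matrixP => i j; rewrite !(rscE, mxE) mulrDr. Qed.
Lemma rscA x y z : rsc (rsc x y) z = rsc x (y * z).
Proof. by apply/matrixP => i j; rewrite !rscE mulrA. Qed.
Lemma rsc1 x : rsc x 1 = x.
Proof. by apply/matrixP => i j; rewrite rscE mulr1. Qed.
Lemma rsc0 x : rsc x 0 = 0.
Proof. by apply/matrixP => i j; rewrite rscE mulr0 mxE. Qed.
Lemma rsc0l y : rsc 0 y = 0.
Proof. exact: mul0mx. Qed.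
Lemma rscBl x x' y : rsc (x - x') y = rsc x y - rsc x' y.
Proof. exact: mulmxBl. Qed.
Lemma rsc_suml (I : Type) (s : seq I) (P : pred I) (F : I -> 'cV[L]_m) y :
  rsc (\sum_(i <- s | P i) F i) y = \sum_(i <- s | P i) rsc (F i) y.
Proof. exact: mulmx_suml. Qed.
Lemma rsc_sumr (I : Type) (s : seq I) (P : pred I) (F : I -> L) x :
  rsc x (\sum_(i <- s | P i) F i) = \sum_(i <- s | P i) rsc x (F i).
Proof. by apply: (big_morph (rsc x)); [exact: rscDr | exact: rsc0]. Qed.

(** The field acts through the centre of the algebra. *)
Definition ksc (k : K) x : 'cV[L]_m := rsc x (k *: (1 : L)).

Lemma kscE k x i j : ksc k x i j = k *: x i j.
Proof. by rewrite /ksc rscE -lpaZAr mulr1. Qed.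
Lemma kscDr k x x' : ksc k (x + x') = ksc k x + ksc k x'.
Proof. exact: rscDl. Qed.
Lemma kscBr k x x' : ksc k (x - x') = ksc k x - ksc k x'.
Proof. exact: rscBl. Qed.
Lemma kscDl k k' x : ksc (k + k') x = ksc k x + ksc k' x.
Proof. by rewrite /ksc scalerDl rscDr. Qed.
Lemma kscA k k' x : ksc k (ksc k' x) = ksc (k * k') x.
Proof. by apply/matrixP => i j; rewrite !kscE scalerA. Qed.
Lemma ksc1 x : ksc 1 x = x.
Proof. by apply/matrixP => i j; rewrite !kscE scale1r. Qed.
Lemma ksc0 x : ksc 0 x = 0.
Proof. by apply/matrixP => i j; rewrite !kscE scale0r mxE. Qed.
Lemma ksc0r k : ksc k 0 = 0.
Proof. exact: rsc0l. Qed.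
Lemma kscN1 x : ksc (-1) x = - x.
Proof. by apply/matrixP => i j; rewrite !kscE scaleN1r mxE. Qed.
Lemma kscNl k x : ksc (- k) x = - ksc k x.
Proof. by apply/matrixP => i j; rewrite !(kscE, mxE) scaleNr. Qed.
Lemma ksc_rsc k x y : ksc k (rsc x y) = rsc (ksc k x) y.
Proof. by apply/matrixP => i j; rewrite !(rscE, kscE) lpaZAl. Qed.
Lemma ksc_sumr (I : Type) (s : seq I) (P : pred I) (F : I -> 'cV[L]_m) k :
  ksc k (\sum_(i <- s | P i) F i) = \sum_(i <- s | P i) ksc k (F i).
Proof. exact: rsc_suml. Qed.
Lemma ksc_suml (I : Type) (s : seq I) (P : pred I) (F : I -> K) x :
  ksc (\sum_(i <- s | P i) F i) x = \sum_(i <- s | P i) ksc (F i) x.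
Proof.
by apply: (big_morph (ksc^~ x)) => [a b|]; [exact: kscDl | exact: ksc0].
Qed.

(** The right submodule generated by a set of columns. *)
Inductive lspan (X : 'cV[L]_m -> Prop) : 'cV[L]_m -> Prop :=
| lspan_nil : lspan X 0
| lspan_cons x y p : X x -> lspan X p -> lspan X (rsc x y + p).

Lemma lspan_gen (X : 'cV[L]_m -> Prop) x : X x -> lspan X x.
Proof. by move=> Xx; rewrite -[x]addr0 -{1}[x]rsc1; apply: lspan_cons => //; left. Qed.

Lemma lspanD (X : 'cV[L]_m -> Prop) p q : lspan X p -> lspan X q -> lspan X (p + q).
Proof.
move=> Xp Xq; elim: Xp => [|x y p' Xx _ IH]; first by rewrite add0r.
by rewrite -addrA; apply: lspan_cons.
Qed.

Lemma lspan_rsc (X : 'cV[L]_m -> Prop) p z : lspan X p -> lspan X (rsc p z).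
Proof.
elim=> [|x y p' Xx _ IH]; first by rewrite rsc0l; left.
by rewrite rscDl rscA; apply: lspan_cons.
Qed.

Lemma lspan_ksc (X : 'cV[L]_m -> Prop) p k : lspan X p -> lspan X (ksc k p).
Proof. exact: lspan_rsc. Qed.

Lemma lspanN (X : 'cV[L]_m -> Prop) p : lspan X p -> lspan X (- p).
Proof. by rewrite -kscN1; apply: lspan_ksc. Qed.

Lemma lspanB (X : 'cV[L]_m -> Prop) p q : lspan X p -> lspan X q -> lspan X (p - q).
Proof. by move=> Xp Xq; apply: lspanD => //; apply: lspanN. Qed.

Lemma lspan_sum (X : 'cV[L]_m -> Prop) (I : Type) (s : seq I) (P : pred I) (F : I -> 'cV[L]_m) :
  (forall i, P i -> lspan X (F i)) -> lspan X (\sum_(i <- s | P i) F i).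
Proof.
by move=> XF; apply: (big_ind (lspan X)) => //; [left | exact: lspanD].
Qed.

Lemma lspan_sub (X Y : 'cV[L]_m -> Prop) p :
  (forall x, X x -> lspan Y x) -> lspan X p -> lspan Y p.
Proof.
move=> XY; elim=> [|x y p' Xx _ IH]; first by left.
by apply: lspanD => //; apply/lspan_rsc/XY.
Qed.

End RightScaling.

(** * Generated matrices *)

Section Moves.
Variables (K : fieldType) (H : hypergraph).
Notation V := (vertex H).
Notation L := (lpa K H).

(** Closure under inverses is not built in: the moves below need none, since
    the block matrices of a hyperedge come with their inverses. *)
Inductive gen_mx : forall m n, m.-tuple V -> n.-tuple V -> 'M[L]_(m, n) -> Prop :=
| gen_E n (s : n.-tuple V) A : in_E s A -> gen_mx s s A
| gen_F m n (s : m.-tuple V) (t : n.-tuple V) A : in_F s t A -> gen_mx s t A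
| gen_P n (s t : n.-tuple V) A : in_P s t A -> gen_mx s t A
| gen_mul m n p (s : m.-tuple V) (t : n.-tuple V) (r : p.-tuple V) A B :
    gen_mx s t A -> gen_mx t r B -> gen_mx s r (A *m B).

Lemma in_GL_elem n (s : n.-tuple V) i j (x : L) :
  i != j -> in_corner (tnth s i) (tnth s j) x -> in_GL s s (elem_mx s i j x).
Proof.
move=> ij cx; have /in_cornerP [ux xv] := cx.
have inM y : in_corner (tnth s i) (tnth s j) y -> in_M s s (elem_mx s i j y).
  move=> cy a b; have /in_cornerP [uy yv] := cy.
  rewrite /elem_mx /Imx !mxE; apply/in_cornerP; split.
    rewrite mulrDr; congr (_ + _).
      by case: eqP => [->|]; rewrite ?mulr0n ?mulr0 // mulr1n lvertM eqxx.
    by case: ifP => [/andP[/eqP -> _]//|]; rewrite mulr0.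
  rewrite mulrDl; congr (_ + _).
    by case: eqP => [->|]; rewrite ?mulr0n ?mul0r // mulr1n lvertM eqxx.
  by case: ifP => [/andP[_ /eqP ->]//|]; rewrite mul0r.
have inv y : in_corner (tnth s i) (tnth s j) y ->
    elem_mx s i j y *m elem_mx s i j (- y) = Imx K s.
  move=> cy; have /in_cornerP [uy yv] := cy.
  pose D (z : L) : 'M[L]_n := \matrix_(k, l) (if (k == i) && (l == j) then z else 0).
  have IsD z : lvert (tnth s i) * z = z -> Imx K s *m D z = D z.
    move=> uz; rewrite /Imx mul_diag_mx; apply/matrixP => a b; rewrite !mxE.
    by case: ifP => [/andP[/eqP -> _]//|]; rewrite mulr0.
  have DIs z : z * lvert (tnth s j) = z -> D z *m Imx K s = D z.
    move=> uz; rewrite /Imx mul_mx_diag; apply/matrixP => a b; rewrite !mxE.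
    by case: ifP => [/andP[_ /eqP ->]//|]; rewrite mul0r.
  have DD z z' : D z *m D z' = 0.
    apply/matrixP => a b; rewrite !mxE big1 // => k _; rewrite !mxE.
    case: ifP => [/andP[_ /eqP ->]|]; last by rewrite mul0r.
    by rewrite eq_sym (negPf ij) mulr0.
  rewrite /elem_mx -!/(D _) mulmxDl !mulmxDr Imx_idem DD IsD ?DIs ?mulrN ?uy //.
  rewrite addr0 -addrA -[X in _ + X]/(D (- y) + D y).
  have -> : D (- y) + D y = 0.
    by apply/matrixP => a b; rewrite !mxE; case: ifP; rewrite ?addr0 ?addNr.
  by rewrite addr0.
have cNx : in_corner (tnth s i) (tnth s j) (- x).
  by apply/in_cornerP; rewrite mulrN ux mulNr xv.
split; first exact: inM.
by exists (elem_mx s i j (- x)); split; [exact: inM | exact: inv | rewrite -{2}[x]opprK; exact: inv].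
Qed.

Lemma in_E_GL n (s : n.-tuple V) (A : 'M[L]_n) : in_E s A -> in_GL s s A.
Proof.
elim=> [i j x ij cx||A1 B1 _ A1s _ B1s|A1 B1 _ [A1s _] B1s AB BA].
- exact: in_GL_elem.
- exact: in_GL_Imx.
- exact: in_GL_mul A1s B1s.
- by split=> //; exists A1.
Qed.

Lemma gen_GL m n (s : m.-tuple V) (t : n.-tuple V) (A : 'M[L]_(m, n)) :
  gen_mx s t A -> in_GL s t A.
Proof.
elim=> {m n s t A} [n s A|m n s t A|n s t A|m n p s t r A B _ sA _ tB].
- exact: in_E_GL.
- by case.
- by case.
- exact: in_GL_mul sA tB.
Qed.

Lemma in_P_intro n (s t : n.-tuple V) (pi : 'S_n) (k : 'I_n -> K) :
  (forall i, tnth s i = tnth t (pi i)) -> (forall i, k i != 0) ->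
  in_P s t (\matrix_(i, j) if j == pi i then k i *: lvert (tnth s i) else 0 : L).
Proof.
move=> st k0; split; last by exists pi, k; split=> // i j; rewrite mxE.
have cor v (a : K) : in_corner v v (a *: lvert v : L).
  by apply/in_cornerP; rewrite -lpaZAr -lpaZAl lvertM eqxx.
have cor0 u v : in_corner u v (0 : L) by apply/in_cornerP; rewrite mulr0 mul0r.
split; first by move=> i j; rewrite mxE; case: eqP => [->|]; rewrite -?st.
exists (\matrix_(j, i) if j == pi i then (k i)^-1 *: lvert (tnth s i) else 0); split.
- by move=> j i; rewrite mxE; case: eqP => [->|]; rewrite -?st.
- apply/matrixP => i i'; rewrite !mxE (bigD1 (pi i)) //= !mxE eqxx big1 ?addr0; last first.
    by move=> j /negPf ji; rewrite !mxE ji mul0r.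
  rewrite (inj_eq perm_inj); case: eqP => [<-|]; last by rewrite mulr0 mulr0n.
  by rewrite -lpaZAl -lpaZAr scalerA divff // scale1r lvertM eqxx mulr1n.
- apply/matrixP => j j'; rewrite !mxE (bigD1 ((pi^-1)%g j)) //= !mxE permKV eqxx big1 ?addr0; last first.
    move=> i ij; rewrite !mxE; case: eqP => [jE|]; last by rewrite mul0r.
    by rewrite jE permK eqxx in ij.
  rewrite [j == j']eq_sym; case: (j' =P j) => [_|]; last by rewrite mulr0 mulr0n.
  by rewrite -lpaZAl -lpaZAr scalerA mulVf // scale1r lvertM eqxx mulr1n st permKV.
Qed.

End Moves.

(** * Moves on lists of columns *)

Section Reach.
Variables (K : fieldType) (H : hypergraph) (m : nat).
Notation V := (vertex H).
Notation L := (lpa K H).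
Notation corner := (corner H).
Notation M := ('cV[L]_m).
Definition vcolumn : eqType := (V * M)%type.
Notation col := vcolumn.
Implicit Types (cs ds : seq col).

Definition mxt n (t : n.-tuple col) : 'M[L]_(m, n) :=
  \matrix_(i, k) (tnth t k).2 i 0.
Definition wdt n (t : n.-tuple col) : n.-tuple V := map_tuple fst t.

(** Two lists of columns related by right multiplication with a generated
    matrix.  The words of the matrix are the vertices that accompany the
    columns. *)
Inductive reach : seq col -> seq col -> Prop :=
| Reach n n' (t : n.-tuple col) (t' : n'.-tuple col) G of
    gen_mx (wdt t) (wdt t') G & mxt t' = mxt t *m G : reach t t'.

Definition wfc cs : Prop := forall c, c \in cs -> rsc c.2 (lvert c.1) = c.2.

Lemma wfc_cat cs ds : wfc (cs ++ ds) <-> wfc cs /\ wfc ds.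
Proof.
split=> [wf|[wc wd] c]; last by rewrite mem_cat => /orP[/wc|/wd].
by split=> c cin; apply: wf; rewrite mem_cat cin ?orbT.
Qed.

Lemma wfc_perm cs ds : perm_eq cs ds -> wfc cs -> wfc ds.
Proof. by move=> /perm_mem p wf c; rewrite -p; apply: wf. Qed.

Lemma wfc_cons c cs : wfc (c :: cs) <-> rsc c.2 (lvert c.1) = c.2 /\ wfc cs.
Proof.
split=> [wf|[wc wd] d]; last by rewrite inE => /orP[/eqP->|/wd].
by split=> [|d din]; apply: wf; rewrite inE ?eqxx // din orbT.
Qed.

Lemma reach_in_tuple cs ds : reach cs ds ->
  exists2 G, gen_mx (wdt (in_tuple cs)) (wdt (in_tuple ds)) G &
    mxt (in_tuple ds) = mxt (in_tuple cs) *m G.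
Proof.
case=> {cs ds} n n' t t' G.
case: t => s e; case: t' => s' e'.
have E := eqP e; have E' := eqP e'; subst n n'.
rewrite (_ : Tuple e = in_tuple s); last exact: val_inj.
rewrite (_ : Tuple e' = in_tuple s'); last exact: val_inj.
by exists G.
Qed.

Lemma reach_trans cs ds es : reach cs ds -> reach ds es -> reach cs es.
Proof.
move=> /reach_in_tuple[G gG dE] /reach_in_tuple[G' gG' eE].
rewrite -[cs]/(tval (in_tuple cs)) -[es]/(tval (in_tuple es)).
apply: (@Reach _ _ _ _ (G *m G')); first exact: gen_mul gG gG'.
by rewrite mulmxA -dE.
Qed.

Lemma tnth_wdt n (t : n.-tuple col) i : tnth (wdt t) i = (tnth t i).1.
Proof. by rewrite tnth_map. Qed.

Lemma wfc_tnth n (t : n.-tuple col) i : wfc t ->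
  rsc (tnth t i).2 (lvert (tnth t i).1) = (tnth t i).2.
Proof. by move=> wf; apply: wf; exact: mem_tnth. Qed.

Lemma reach_refl cs : wfc cs -> reach cs cs.
Proof.
move=> wf; rewrite -[cs]/(tval (in_tuple cs)).
apply: (@Reach _ _ _ _ (Imx K (wdt (in_tuple cs)))); first exact/gen_E/in_E_one.
rewrite /Imx mul_mx_diag; apply/matrixP => i j; rewrite !mxE tnth_wdt.
by rewrite -rscE wfc_tnth.
Qed.

Lemma reach_wfc cs ds : reach cs ds -> wfc ds.
Proof.
case=> {cs ds} n n' t t' G /gen_GL[/in_MP[_ GI] _] t'E c /tnthP[k ->].
rewrite -tnth_wdt; apply/matrixP => i j; rewrite rscE ord1.
have t'I : mxt t' *m Imx K (wdt t') = mxt t' by rewrite t'E -mulmxA GI.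
by have := congr1 (fun A : 'M_(_, _) => A i k) t'I; rewrite /Imx mul_mx_diag !mxE.
Qed.

(** These are the moves by the generalised permutation matrices. *)
Lemma reach_monomial n (t t' : n.-tuple col) (p : 'S_n) (k : 'I_n -> K) :
  wfc t -> (forall i, k i != 0) ->
  (forall i, tnth t' i = ((tnth t (p i)).1, ksc (k i) (tnth t (p i)).2)) ->
  reach t t'.
Proof.
move=> wf k0 tE.
have tpE i : tnth (wdt t) i = tnth (wdt t') ((p^-1)%g i).
  by rewrite !tnth_wdt tE permKV.
have := @in_P_intro K H n (wdt t) (wdt t') (p^-1)%g (k \o (p^-1)%g) tpE.
move=> /(_ (fun i => k0 _)) /gen_P gP; apply: Reach gP _.
apply/matrixP => i j; rewrite !mxE (bigD1 (p j)) //= !mxE permK eqxx big1 ?addr0.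
  rewrite tE /= kscE -lpaZAr tnth_wdt -rscE wfc_tnth //.
move=> l lj; rewrite !mxE; case: eqP => [jE|]; last by rewrite mulr0.
by rewrite jE permKV eqxx in lj.
Qed.

Lemma reach_perm cs ds : wfc cs -> perm_eq cs ds -> reach cs ds.
Proof.
move=> wf p; have sz : size ds = size cs by rewrite (perm_size p).
pose t' : (size cs).-tuple col := tcast sz (in_tuple ds).
have t'E : tval t' = ds by rewrite /t' val_tcast.
have [q tq] : exists q : 'S_(size cs), tval t' = [tuple tnth (in_tuple cs) (q i) | i < size cs].
  by apply/tuple_permP; rewrite t'E perm_sym.
rewrite -t'E -[cs]/(tval (in_tuple cs)).
apply: (@reach_monomial _ (in_tuple cs) t' q (fun=> 1)) => // [i|i].
  exact: oner_neq0.
have -> : t' = [tuple tnth (in_tuple cs) (q i) | i < size cs] by exact: val_inj.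
by rewrite tnth_mktuple ksc1; case: (tnth _ _).
Qed.

Lemma reach_scale v (x : M) k cs : wfc ((v, x) :: cs) -> k != 0 ->
  reach ((v, x) :: cs) ((v, ksc k x) :: cs).
Proof.
move=> wf k0.
have -> : (v, x) :: cs = [tuple of (v, x) :: in_tuple cs] by [].
have -> : (v, ksc k x) :: cs = [tuple of (v, ksc k x) :: in_tuple cs] by [].
apply: (@reach_monomial _ _ _ 1%g (fun i => if i == ord0 then k else 1)) => //.
  by move=> i; case: ifP => // _; exact: oner_neq0.
move=> i; rewrite perm1; case: (unliftP ord0 i) => [j ->|->].
  by rewrite !tnthS ksc1; case: (tnth _ j).
by rewrite !tnth0 eqxx.
Qed.

(** This is the move by an elementary matrix. *)
Lemma reach_elem v (x : M) v' (x' : M) y cs : wfc ((v, x) :: cs) ->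
  (v', x') \in cs ->
  reach ((v, x) :: cs) ((v, x + rsc (rsc x' y) (lvert v)) :: cs).
Proof.
move=> wf xcs.
have /tnthP[i iE] : (v', x') \in in_tuple cs by [].
have x'v : rsc x' (lvert v') = x'.
  by have /wfc_cons[_ wfcs] := wf; apply: (wfcs (v', x')).
pose t := [tuple of (v, x) :: in_tuple cs].
have -> : (v, x) :: cs = t by [].
have -> : (v, x + rsc (rsc x' y) (lvert v)) :: cs =
  [tuple of (v, x + rsc (rsc x' y) (lvert v)) :: in_tuple cs] by [].
have wE : wdt [tuple of (v, x + rsc (rsc x' y) (lvert v)) :: in_tuple cs] = wdt t.
  exact: val_inj.
pose G := elem_mx (wdt t) (lift ord0 i) ord0 (lvert v' * y * lvert v).
apply: (@Reach _ _ _ _ G).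
  rewrite wE; apply/gen_E/in_E_elem; first by rewrite eq_sym neq_lift.
  by rewrite !tnth_wdt tnth0 tnthS -iE; exists y.
rewrite /G /elem_mx mulmxDr /Imx mul_mx_diag; apply/matrixP => r c; rewrite !mxE tnth_wdt.
rewrite -rscE wfc_tnth //.
rewrite (bigD1 (lift ord0 i)) //= !mxE (eqxx (lift ord0 i)) andTb big1 ?addr0; last first.
  by move=> j /negPf ji; rewrite !mxE ji mulr0.
rewrite tnthS -iE; case: (unliftP ord0 c) => [j ->|->].
  by rewrite !tnthS [_ == ord0]eq_sym (negPf (neq_lift _ _)) mulr0 addr0.
by rewrite !tnth0 (eqxx ord0) mxE !rscE /= !mulrA -(rscE x' (lvert v')) x'v.
Qed.

Definition colspan cs : M -> Prop := lspan (fun x => exists v, (v, x) \in cs).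

Lemma colspan_sub cs ds (x : M) : {subset cs <= ds} -> colspan cs x -> colspan ds x.
Proof.
move=> sub; apply: lspan_sub => y [v vy]; apply: lspan_gen.
by exists v; apply: sub.
Qed.

(** A transvection by a combination of several columns is a sequence of
    elementary moves, one for each term. *)
Lemma reach_transvection v (x p : M) cs : wfc ((v, x) :: cs) -> colspan cs p ->
  rsc p (lvert v) = p -> reach ((v, x) :: cs) ((v, x + p) :: cs).
Proof.
move=> wf sp pv; rewrite -{}pv.
elim: sp x wf => [|x' y p' [v' x'cs] _ IH] x wf.
  by rewrite rsc0l addr0; apply: reach_refl.
have /wfc_cons[/= xv wfcs] := wf.
rewrite rscDl addrA; apply: (reach_trans (reach_elem y wf x'cs)).
by apply: IH; apply/wfc_cons; rewrite /= rscDl xv !rscA lvertM eqxx.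
Qed.

Lemma reach_replace v (x x' : M) k cs : wfc ((v, x) :: cs) -> k != 0 ->
  colspan cs (x' - ksc k x) -> rsc x' (lvert v) = x' ->
  reach ((v, x) :: cs) ((v, x') :: cs).
Proof.
move=> wf k0 sp x'v; apply: (reach_trans (reach_scale wf k0)).
have /wfc_cons[/= xv wfcs] := wf.
have -> : x' = ksc k x + (x' - ksc k x) by rewrite addrC subrK.
have kv : rsc (ksc k x) (lvert v) = ksc k x by rewrite -ksc_rsc xv.
apply: reach_transvection => //; last by rewrite rscBl x'v kv.
by apply/wfc_cons.
Qed.

(** Several columns can be replaced at once, provided that the corrections do
    not involve the columns being replaced. *)
Lemma reach_replaces (I : eqType) (s : seq I) (vx : I -> V) (x x' : I -> M) k cs :
  wfc ([seq (vx i, x i) | i <- s] ++ cs) -> k != 0 ->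
  (forall i, i \in s -> colspan cs (x' i - ksc k (x i)) /\ rsc (x' i) (lvert (vx i)) = x' i) ->
  reach ([seq (vx i, x i) | i <- s] ++ cs) ([seq (vx i, x' i) | i <- s] ++ cs).
Proof.
elim: s cs => [|i s IHs] cs wf k0 hx; first exact: reach_refl.
have wf' : wfc ([seq (vx i, x i) | i <- s] ++ cs) by have /wfc_cons[] := wf.
have [si vi] := hx i (mem_head _ _).
pose cs' := (vx i, x' i) :: cs.
apply: (reach_trans (ds := [seq (vx i, x i) | i <- s] ++ cs')).
  apply: (reach_trans (ds := (vx i, x' i) :: [seq (vx i, x i) | i <- s] ++ cs)).
    apply: (reach_replace (k := k)) => //.
    by apply: colspan_sub si => c; rewrite mem_cat => ->; rewrite orbT.
  apply: reach_perm; first by apply/wfc_cons.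
  by rewrite -cat1s perm_catCA.
have wf1 : wfc ([seq (vx i, x i) | i <- s] ++ cs').
  move: wf' => /wfc_cat[w1 w2]; apply/wfc_cat; split=> //.
  by apply/wfc_cons.
have hx1 j : j \in s -> colspan cs' (x' j - ksc k (x j)) /\ rsc (x' j) (lvert (vx j)) = x' j.
  move=> js; have [] := hx j; first by rewrite inE js orbT.
  by move=> sj vj; split=> //; apply: colspan_sub sj => c; rewrite inE orbC => ->.
apply: (reach_trans (IHs cs' wf1 k0 hx1)).
apply: reach_perm; last by rewrite /cs' /= -(cat1s (vx i, x' i) cs) perm_catCA.
move: wf1 => /wfc_cat[_ w2]; apply/wfc_cat; split=> //.
by move=> c /mapP[j js ->] /=; case: (hx1 j js).
Qed.

Lemma mxt_cat n n' (t : n.-tuple col) (t' : n'.-tuple col) :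
  mxt (cat_tuple t t') = row_mx (mxt t) (mxt t').
Proof.
apply/matrixP => i j; rewrite !mxE; case: (split_ordP j) => l ->.
  by rewrite !mxE tnth_lshift.
by rewrite !mxE tnth_rshift.
Qed.

Lemma in_GL_block n n' p p' (s : n.-tuple V) (s' : n'.-tuple V) (t : p.-tuple V)
  (t' : p'.-tuple V) (A : 'M[L]_(n, p)) (B : 'M[L]_(n', p')) :
  in_GL s t A -> in_GL s' t' B ->
  in_GL (cat_tuple s s') (cat_tuple t t') (block_mx A 0 0 B).
Proof.
have inM q q' r r' (s1 : q.-tuple V) (s2 : q'.-tuple V) (t1 : r.-tuple V) (t2 : r'.-tuple V)
    (C : 'M[L]_(q, r)) (D : 'M[L]_(q', r')) :
    in_M s1 t1 C -> in_M s2 t2 D -> in_M (cat_tuple s1 s2) (cat_tuple t1 t2) (block_mx C 0 0 D).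
  have cor0 u v : in_corner u v (0 : L) by apply/in_cornerP; rewrite mulr0 mul0r.
  move=> hC hD i j; case: (split_ordP i) => a ->; case: (split_ordP j) => b ->.
  - by rewrite block_mxEul !tnth_lshift.
  - by rewrite block_mxEur mxE.
  - by rewrite block_mxEdl mxE.
  - by rewrite block_mxEdr !tnth_rshift.
have Iblock q q' (s1 : q.-tuple V) (s2 : q'.-tuple V) :
    Imx K (cat_tuple s1 s2) = block_mx (Imx K s1) 0 0 (Imx K s2).
  apply/matrixP => i j; rewrite /Imx.
  case: (split_ordP i) => a ->; case: (split_ordP j) => b ->.
  - by rewrite block_mxEul !mxE tnth_lshift eq_lshift.
  - by rewrite block_mxEur !mxE eq_lrshift.
  - by rewrite block_mxEdl !mxE eq_rlshift.
  - by rewrite block_mxEdr !mxE tnth_rshift eq_rshift.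
move=> [hA [A' [hA' AA A'A]]] [hB [B' [hB' BB B'B]]].
split; first exact: inM.
exists (block_mx A' 0 0 B'); split; first exact: inM.
  by rewrite mulmx_block !mulmx0 !mul0mx !addr0 !add0r AA BB Iblock.
by rewrite mulmx_block !mulmx0 !mul0mx !addr0 !add0r A'A B'B Iblock.
Qed.

Notation BVert := (@BVert H).

(** A list of columns of the length that the block matrix with one block for
    each of its vertices has by definition; this avoids casts between
    propositionally equal dimensions. *)
Fixpoint vrows cs : (srows [seq BVert c.1 | c <- cs]).-tuple col :=
  if cs is c :: cs' then cat_tuple [tuple c] (vrows cs') else [tuple].

Fixpoint vcols cs : (scols [seq BVert c.1 | c <- cs]).-tuple col :=
  if cs is c :: cs' then cat_tuple [tuple c] (vcols cs') else [tuple].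

Lemma vrowsE cs : tval (vrows cs) = cs.
Proof. by elim: cs => //= c cs ->. Qed.

Lemma vcolsE cs : tval (vcols cs) = cs.
Proof. by elim: cs => //= c cs ->. Qed.

Lemma wdt_cat n n' (t : n.-tuple col) (t' : n'.-tuple col) :
  wdt (cat_tuple t t') = cat_tuple (wdt t) (wdt t').
Proof. by apply: val_inj; rewrite /= map_cat. Qed.

Lemma GL_verts cs :
  in_GL (wdt (vrows cs)) (wdt (vcols cs)) (block_diag K [seq BVert c.1 | c <- cs]).
Proof.
elim: cs => [|c cs IHs] /=.
  by split=> [[]//|]; exists 0; split=> [[]//||]; apply/matrixP => -[].
rewrite !wdt_cat; apply: in_GL_block => //.
rewrite (_ : const_mx _ = Imx K (wdt [tuple c])); last first.
  by apply/matrixP => i j; rewrite !mxE !ord1 eqxx mulr1n tnth_wdt.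
exact: in_GL_Imx.
Qed.

Lemma mxt_verts cs : wfc cs ->
  mxt (vcols cs) = mxt (vrows cs) *m block_diag K [seq BVert c.1 | c <- cs].
Proof.
elim: cs => [|c cs IHs] /= wf; first by apply/matrixP => i [].
have /wfc_cons[cv wfcs] := wf.
rewrite !mxt_cat mul_row_block !mulmx0 addr0 add0r -IHs //; congr row_mx.
apply/matrixP => i j; rewrite !mxE big_ord1 !mxE !ord1 !tnth0.
by rewrite -rscE cv.
Qed.

(** The move by a matrix of [F] with one block of any kind followed by
    vertices. *)
Lemma reach_block (b : block H) (t : (brows b).-tuple col) (t' : (bcols b).-tuple col) cs :
  in_GL (wdt t) (wdt t') (block_mat K b) -> mxt t' = mxt t *m block_mat K b ->
  wfc cs -> reach (t ++ cs) (t' ++ cs).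
Proof.
move=> tGL t'E wf.
have -> : t ++ cs = cat_tuple t (vrows cs) by rewrite /= vrowsE.
have -> : t' ++ cs = cat_tuple t' (vcols cs) by rewrite /= vcolsE.
apply: (@Reach _ _ _ _ (block_diag K (b :: [seq BVert c.1 | c <- cs]))).
  apply: gen_F; split.
    by rewrite !wdt_cat; apply: in_GL_block => //; apply: GL_verts.
  by exists (b :: [seq BVert c.1 | c <- cs]), erefl, erefl; rewrite castmx_id.
by rewrite !mxt_cat /= mul_row_block !mulmx0 addr0 add0r -mxt_verts // t'E.
Qed.

Definition mcoherent (x : corner -> M) : Prop :=
  forall e u, x u = \sum_(t | side t == e) rsc (x t) (trans_elt K t u).

Definition mlocated (a : cell H) (x : corner -> M) : Prop :=
  forall c, cellof c != a -> x c = 0.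

Lemma mcoherent_lab x u : mcoherent x -> rsc (x u) (lvert (lab u)) = x u.
Proof.
move=> xc; rewrite (xc (side u) u) rsc_suml; apply: eq_bigr => t _.
by rewrite rscA trans_elt_lab.
Qed.

Lemma mcoherent_flip x e a (j : 'I_(arity (~~ e) a)) : mcoherent x ->
  x (mk j) = \sum_(i : 'I_(arity e a)) rsc (x (mk i)) (trans K i j).
Proof.
move=> xc; rewrite (xc e) (bigID (fun t => cellof t == a)) /=.
rewrite [X in _ + X]big1 ?addr0; last first.
  by move=> t /andP[_ ta]; rewrite trans_elt_cell ?rsc0.
rewrite sum_corners; apply: eq_bigr => i _; by rewrite trans_elt_trans.
Qed.

Definition celltuple e a (x : corner -> M) : (arity e a).-tuple col :=
  map_tuple (fun i => (lab (mk i), x (mk i))) (ord_tuple (arity e a)).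

(** The columns of an element of a cell, as seen from the side [e]. *)
Definition cellcols e a (x : corner -> M) : seq col :=
  [seq (lab (mk i), x (mk i)) | i : 'I_(arity e a)].

Lemma celltupleE e a x : tval (celltuple e a x) = cellcols e a x.
Proof. by []. Qed.

Lemma tnth_celltuple e a x i : tnth (celltuple e a x) i = (lab (mk i), x (mk i)).
Proof. by rewrite tnth_map tnth_ord_tuple. Qed.

Lemma wfc_cellcols e a x : mcoherent x -> wfc (cellcols e a x).
Proof. by move=> xc c /mapP[i _ ->]; apply: mcoherent_lab. Qed.

Definition tmx e a : 'M[L]_(arity e a, arity (~~ e) a) := \matrix_(i, j) trans K i j.

Lemma mxt_flip e a x : mcoherent x ->
  mxt (celltuple (~~ e) a x) = mxt (celltuple e a x) *m tmx e a.
Proof.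
move=> xc; apply/matrixP => i j; rewrite !mxE tnth_celltuple /= (mcoherent_flip _ xc).
by rewrite summxE; apply: eq_bigr => l _; rewrite rscE !mxE tnth_celltuple.
Qed.

Lemma GL_flip e h x : in_GL (wdt (celltuple e (inr h) x)) (wdt (celltuple (~~ e) (inr h) x))
  (tmx e (inr h)).
Proof.
have inM e' : in_M (wdt (celltuple e' (inr h) x)) (wdt (celltuple (~~ e') (inr h) x))
    (tmx e' (inr h)).
  move=> i j; rewrite !mxE !tnth_wdt !tnth_celltuple; apply/in_cornerP.
  by have [] := lab_trans K i j.
have IE e' : Imx K (wdt (celltuple e' (inr h) x)) =
    \matrix_(i, j) if i == j then lvert (lab (mk i)) else 0.
  apply/matrixP => i i'; rewrite !mxE tnth_wdt tnth_celltuple.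
  by case: eqP => _; rewrite ?mulr1n ?mulr0n.
have es : tmx true (inr h) *m tmx false (inr h) = Imx K (wdt (celltuple true (inr h) x)).
  rewrite IE; apply/matrixP => i i'; rewrite !mxE; under eq_bigr do rewrite !mxE.
  exact: ledge_star.
have se : tmx false (inr h) *m tmx true (inr h) = Imx K (wdt (celltuple false (inr h) x)).
  rewrite IE; apply/matrixP => i i'; rewrite !mxE; under eq_bigr do rewrite !mxE.
  exact: lstar_edge.
split=> //; case: e.
  by exists (tmx false (inr h)); split=> //; apply: (inM false).
by exists (tmx true (inr h)); split=> //; apply: (inM true).
Qed.

(** The free transfer: an element of a cell may be listed by its columns on
    either side. *)
Lemma reach_flip e a x cs : mcoherent x -> wfc cs ->
  reach (cellcols e a x ++ cs) (cellcols (~~ e) a x ++ cs).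
Proof.
move=> xc wf; case: a => [v|h]; last first.
  rewrite -!celltupleE; case: e.
    apply: (@reach_block (BEdge h) (celltuple true (inr h) x) (celltuple false (inr h) x)) => //.
      exact: (GL_flip true h x).
    exact: (mxt_flip true (inr h) xc).
  apply: (@reach_block (BStar h) (celltuple false (inr h) x) (celltuple true (inr h) x)) => //.
    exact: (GL_flip false h x).
  exact: (mxt_flip false (inr h) xc).
have -> : cellcols (~~ e) (inl v) x = cellcols e (inl v) x.
  rewrite /cellcols /image_mem !enum_ordSl !enum_ord0 /=.
  congr ((_, _) :: _); rewrite (mcoherent_flip _ xc) big_ord1 /=.
  by rewrite -[lvert v]/(lvert (lab (@mk H e (inl v) ord0))) mcoherent_lab.
apply: reach_refl; apply/wfc_cat; split=> //; exact: wfc_cellcols.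
Qed.

End Reach.

(** * Degree of columns *)

Section ColumnFiltration.
Variables (K : fieldType) (H : hypergraph) (m : nat).
Notation V := (vertex H).
Notation L := (lpa K H).
Notation corner := (corner H).
Notation M := ('cV[L]_m).

Definition mfil (e : bool) (d : nat) (v : V) (x : M) : Prop :=
  forall i, fil e d v (x i 0).

Lemma mfil0 e d v : mfil e d v 0.
Proof. by move=> i; rewrite mxE; apply: fil0. Qed.

Lemma mfilD e d v x y : mfil e d v x -> mfil e d v y -> mfil e d v (x + y).
Proof. by move=> fx fy i; rewrite mxE; apply: filD. Qed.

Lemma mfil_ksc e d v k x : mfil e d v x -> mfil e d v (ksc k x).
Proof. by move=> fx i; rewrite kscE; apply: filZ. Qed.

Lemma mfilN e d v x : mfil e d v x -> mfil e d v (- x).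
Proof. by rewrite -kscN1; apply: mfil_ksc. Qed.

Lemma mfilB e d v x y : mfil e d v x -> mfil e d v y -> mfil e d v (x - y).
Proof. by move=> fx fy; apply/mfilD/mfilN. Qed.

Lemma mfil_sum e d v (I : Type) (s : seq I) (P : pred I) (F : I -> M) :
  (forall i, P i -> mfil e d v (F i)) -> mfil e d v (\sum_(i <- s | P i) F i).
Proof. by move=> h; apply: (big_ind (mfil e d v)) => //; [apply: mfil0 | apply: mfilD]. Qed.

Lemma mfil_mono e d d' v x : (d <= d')%N -> mfil e d v x -> mfil e d' v x.
Proof. by move=> dd fx i; apply: fil_mono (fx i). Qed.

Lemma mfil_eq0 e v x : rsc x (lvert v) = x -> mfil e 0 v x -> x = 0.
Proof.
move=> xv fx; apply/matrixP => i j; rewrite ord1 [RHS]mxE.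
by apply: (fil_eq0 (e := e) (v := v)); [rewrite -rscE xv | exact: fx].
Qed.

(** Every element is a finite combination of words. *)
Lemma mfil_exists x : exists d, forall e v, mfil e d v x.
Proof.
have [d hd] := choice (fun i => fil_exists (x i 0)).
exists (\max_i d i) => e v i; apply: fil_mono (hd i e v).
exact: leq_bigmax.
Qed.

Lemma coherent_entry (x : corner -> M) i : mcoherent x -> coherent (fun c => x c i 0 : L).
Proof.
move=> xc e u; rewrite (xc e u) summxE.
by apply: eq_bigr => t _; rewrite rscE.
Qed.

Lemma located_entry a (x : corner -> M) i : mlocated a x -> located a (fun c => x c i 0 : L).
Proof. by move=> xa c ca; rewrite xa // mxE. Qed.

Lemma mfil_other a (x : corner -> M) e d : mcoherent x -> mlocated a x ->
  (forall c, side c = e -> mfil e d (lab c) (x c)) ->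
  forall c, mfil (side c) d.+1 (lab c) (x c).
Proof.
move=> xc xa fx c i.
apply: (fil_other (coherent_entry i xc) (located_entry i xa) (e := e)) => c' sc'.
exact: fx.
Qed.

Lemma mfil_free e d v (p : corner -> corner -> M) :
  (forall b, side b = e -> lab b = v ->
     [/\ mcoherent (p b), mlocated (cellof b) (p b) &
         forall c, mfil (side c) d.+1 (lab c) (p b c)]) ->
  mfil e d v (\sum_(b | (side b == e) && (lab b == v)) p b b) ->
  forall b c, side b = e -> lab b = v -> side c = e -> mfil e d (lab c) (p b c).
Proof.
move=> hp fs b c sb lb sc i.
apply: (fil_free (v := v) (p := fun b c => p b c i 0)) => //.
  move=> b' sb' lb'; have [piece_at pl pf] := hp b' sb' lb'; split.
  - exact: coherent_entry.
  - exact: located_entry.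
  - by move=> c'; apply: pf.
by have := fs i; rewrite summxE.
Qed.

Lemma mcoherentD (x y : corner -> M) : mcoherent x -> mcoherent y -> mcoherent (fun c => x c + y c : M).
Proof.
move=> xc yc e u; rewrite (xc e u) (yc e u) -big_split.
by apply: eq_bigr => t _; rewrite rscDl.
Qed.

Lemma mcoherent_ksc k (x : corner -> M) : mcoherent x -> mcoherent (fun c => ksc k (x c) : M).
Proof.
move=> xc e u; rewrite (xc e u) ksc_sumr.
by apply: eq_bigr => t _; rewrite ksc_rsc.
Qed.

Lemma mcoherent0 : mcoherent (fun _ : corner => 0 : M).
Proof. by move=> e u; rewrite big1 // => t _; rewrite rsc0l. Qed.

Lemma mcoherentB (x y : corner -> M) : mcoherent x -> mcoherent y -> mcoherent (fun c => x c - y c : M).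
Proof.
move=> xc yc; have := mcoherentD xc (mcoherent_ksc (-1) yc).
by congr mcoherent; apply: funext => c; rewrite kscN1.
Qed.

Lemma mcoherent_sum (I : Type) (s : seq I) (P : pred I) (F : I -> corner -> M) :
  (forall i, P i -> mcoherent (F i)) -> mcoherent (fun c => \sum_(i <- s | P i) F i c).
Proof.
move=> h e u; rewrite (eq_bigr (fun i => \sum_(t | side t == e) rsc (F i t) (trans_elt K t u))).
  by rewrite exchange_big; apply: eq_bigr => t _; rewrite rsc_suml.
by move=> i Pi; apply: h.
Qed.

Lemma mcoherent_rsc_trans_elt (x : M) q : mcoherent (fun u => rsc x (trans_elt K q u)).
Proof.
move=> e u; rewrite -(trans_elt_comp K e q u) rsc_sumr.
by apply: eq_bigr => t _; rewrite rscA.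
Qed.

End ColumnFiltration.

Lemma zmod_exchange (A : zmodType) (y a c x t : A) :
  y - (a - c) = y - (x + a) - (t - (x + c)) + t.
Proof.
rewrite -[RHS]addrA [X in _ = _ + X]addrC [X in _ = _ + (_ + X)]opprB [X in _ = _ + X]addrC subrK.
by rewrite opprB opprD !addrA [y - x - a]addrAC subrK addrAC.
Qed.

(** * Steinitz exchange *)

Section Exchange.
Variables (K : fieldType) (H : hypergraph) (m : nat).
Notation V := (vertex H).
Notation L := (lpa K H).
Notation M := ('cV[L]_m).
Notation col := (vcolumn K H m).

(** Targets that are combinations of the columns [x k] modulo the span of [Z],
    with linearly independent coefficients, can be moved into the list, at the
    cost of as many of the [x k].  One target is treated at a time: it takes the
    place of a column in which it has a nonzero coefficient, this column is
    eliminated from the other targets, and the new column joins [Z]. *)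
Lemma exchange (I : eqType) (vx : I -> V) (x : I -> M)
    (T : seq (col * (I -> K))) (t0 : col * (I -> K)) (s : seq I) (Z : seq col) :
  uniq s -> wfc ([seq (vx k, x k) | k <- s] ++ Z) ->
  (forall i, (i < size T)%N -> let t := nth t0 T i in
    [/\ rsc t.1.2 (lvert t.1.1) = t.1.2,
        forall k, k \in s -> t.2 k != 0 -> vx k = t.1.1 &
        colspan Z (t.1.2 - \sum_(k <- s) ksc (t.2 k) (x k))]) ->
  (forall g : nat -> K,
    (forall k, k \in s -> \sum_(i < size T) g i * (nth t0 T i).2 k = 0) ->
    forall i, (i < size T)%N -> g i = 0) ->
  exists s', [/\ {subset s' <= s}, size s = (size T + size s')%N &
    reach ([seq (vx k, x k) | k <- s] ++ Z)
          ([seq t.1 | t <- T] ++ [seq (vx k, x k) | k <- s'] ++ Z)].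
Proof.
move: {2}(size T) (erefl (size T)) => n sz.
elim: n T sz s Z => [|n IHn] T sz s Z us wf hT indep.
  by rewrite (size0nil sz); exists s; split=> //; apply: reach_refl.
case: T sz hT indep => [//|[[v t] ka] T] [sz] hT indep.
have [k ks kk0] : exists2 k, k \in s & ka k != 0.
  apply: contrapT => nk; have : (1 : K) = 0.
    apply: (indep (fun i => if i is 0 then 1 else 0) _ 0%N) => // k ks.
    rewrite big_ord_recl /= big1 ?addr0 ?mul1r; last by move=> i _; rewrite mul0r.
    by apply/eqP; apply/negPn/negP => kk; apply: nk; exists k.
  by apply/eqP; exact: oner_neq0.
have [/= tv tvx tspan] := hT 0%N isT.
have vk := tvx k ks kk0.
pose s1 := rem k s.
have ps : perm_eq s (k :: s1) by exact: perm_to_rem.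
have us1 : uniq s1 by exact: rem_uniq.
have ss1 : {subset s1 <= s} by move=> j; apply: mem_rem.
have sumE F : \sum_(j <- s) F j = F k + \sum_(j <- s1) F j :> M.
  by rewrite (perm_big _ ps) big_cons.
have colsub (A : seq I) (B : seq col) j : j \in A ->
    colspan ([seq (vx k, x k) | k <- A] ++ B) (x j).
  move=> jA; apply: lspan_gen; exists (vx j); rewrite mem_cat; apply/orP; left.
  by apply/mapP; exists j.
pose Z' := (v, t) :: Z.
have p1 : perm_eq ([seq (vx k, x k) | k <- s] ++ Z)
    ((vx k, x k) :: [seq (vx k, x k) | k <- s1] ++ Z).
  by rewrite -cat_cons perm_cat2r; have := perm_map (fun k => (vx k, x k)) ps.
have wf1 := wfc_perm p1 wf.
have /wfc_cons[/= xkv wf2] := wf1.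
have wft : wfc ((v, t) :: [seq (vx k, x k) | k <- s1] ++ Z) by apply/wfc_cons.
have p2 : perm_eq ((v, t) :: [seq (vx k, x k) | k <- s1] ++ Z) ([seq (vx k, x k) | k <- s1] ++ Z').
  by rewrite -cat1s perm_catCA.
have r1 : reach ([seq (vx k, x k) | k <- s] ++ Z) ([seq (vx k, x k) | k <- s1] ++ Z').
  apply: (reach_trans (reach_perm wf p1)).
  apply: (reach_trans (ds := (v, t) :: [seq (vx k, x k) | k <- s1] ++ Z)); last exact: reach_perm.
  rewrite -vk; apply: (reach_replace (k := ka k)) => //; last by rewrite vk.
  rewrite -(subrK (\sum_(j <- s) ksc (ka j) (x j)) t) -addrA; apply: lspanD.
    by apply: colspan_sub tspan => c cZ; rewrite mem_cat cZ orbT.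
  rewrite sumE addrAC subrr add0r big_seq; apply: lspan_sum => j js.
  exact/lspan_ksc/colsub.
(* Elimination of [x k] from the other targets, by means of the target [t]. *)
pose tr (u : col * (I -> K)) : col * (I -> K) :=
  (u.1, fun j => u.2 j - u.2 k / ka k * ka j).
have wf' := reach_wfc r1.
have trE i : (i < size T)%N -> nth t0 (map tr T) i = tr (nth t0 T i).
  by move=> iT; rewrite (nth_map t0).
have hT' i : (i < size (map tr T))%N -> let t := nth t0 (map tr T) i in
    [/\ rsc t.1.2 (lvert t.1.1) = t.1.2,
        forall k, k \in s1 -> t.2 k != 0 -> vx k = t.1.1 &
        colspan Z' (t.1.2 - \sum_(k <- s1) ksc (t.2 k) (x k))].
  rewrite size_map => iT; rewrite trE //; have [/= uv uvx uspan] := hT i.+1 iT.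
  move: (nth t0 T i) uv uvx uspan => [[u y] kb] /= uv uvx uspan; split=> //.
    move=> j /ss1 js; have [kbj|kbj _] := eqVneq (kb j) 0; last exact: uvx.
    rewrite kbj sub0r oppr_eq0 !mulf_eq0 !negb_or => /andP[/andP[kbk _] kaj].
    by rewrite -(uvx k ks kbk) vk -(tvx j).
  pose c := kb k / ka k.
  have -> : y - \sum_(k <- s1) ksc (kb k - c * ka k) (x k) =
      (y - \sum_(k <- s) ksc (kb k) (x k)) -
      ksc c (t - \sum_(k <- s) ksc (ka k) (x k)) + ksc c t.
    have -> : \sum_(k <- s1) ksc (kb k - c * ka k) (x k) =
        \sum_(k <- s1) ksc (kb k) (x k) - ksc c (\sum_(k <- s1) ksc (ka k) (x k)).
      rewrite ksc_sumr -sumrB; apply: eq_bigr => j _.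
      by rewrite kscDl kscNl kscA.
    have -> : ksc c (t - \sum_(k <- s) ksc (ka k) (x k)) =
        ksc c t - (ksc (kb k) (x k) + ksc c (\sum_(k <- s1) ksc (ka k) (x k))).
      by rewrite sumE kscBr kscDr kscA divfK.
    by rewrite sumE; apply: zmod_exchange.
  apply: lspanD.
    apply: lspanB; last apply: lspan_ksc; apply: colspan_sub; [|exact: uspan| |exact: tspan];
      by move=> a aZ; rewrite inE aZ orbT.
  by apply/lspan_ksc/lspan_gen; exists v; rewrite mem_head.
have indep' (g : nat -> K) : (forall k, k \in s1 -> \sum_(i < size (map tr T)) g i * (nth t0 (map tr T) i).2 k = 0) ->
    forall i, (i < size (map tr T))%N -> g i = 0.
  rewrite size_map => hg i iT.
  pose g' i := if i is i'.+1 then g i' else - \sum_(i < size T) g i * ((nth t0 T i).2 k / ka k).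
  apply: (indep g' _ i.+1 iT) => j js; rewrite big_ord_recl /=.
  have [->|jk] := eqVneq j k.
    rewrite mulNr mulr_suml -sumrN -big_split big1 //= => l _.
    by rewrite -mulrA divfK // addNr.
  have js1 : j \in s1 by rewrite mem_rem_uniq // inE jk.
  rewrite -[RHS](hg j js1) mulNr mulr_suml -sumrN -big_split; apply: eq_bigr => l _.
  by rewrite trE //= mulrBr !mulrA addrC.
have [s' [ss' szs' r2]] := IHn (map tr T) (etrans (size_map tr T) sz) s1 Z' us1 wf' hT' indep'.
exists s'; split.
- by move=> j /ss' /ss1.
- by rewrite (perm_size ps) /= szs' size_map addSn.
- apply: (reach_trans r1); apply: (reach_trans r2).
  apply: (reach_perm (reach_wfc r2)); rewrite -map_comp.
  rewrite [map (_ \o _) T](eq_map (g := fst)) // /=.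
  by rewrite /Z' -(cat1s (v, t) Z) catA perm_catCA /= -!catA.
Qed.

End Exchange.

(** * States and their reduction *)

Section States.
Variables (K : fieldType) (H : hypergraph) (m : nat).
Notation V := (vertex H).
Notation L := (lpa K H).
Notation corner := (corner H).
Notation M := ('cV[L]_m).
Notation col := (vcolumn K H m).

(** [Pure e v d x] is a column at [v] of degree at most [d] on the side [e].
    [Node a d x] is an element of the cell [a] of degree at most [d], which is
    to say of degree at most [d + 1] on both sides. *)
Inductive piece : Type :=
| Pure of bool & V & nat & M
| Node of cell H & nat & (corner -> M).

HB.instance Definition _ := gen_eqMixin piece.

(** The order of the weights is what makes every reduction step a descent: a
    node of degree [d] may be traded for pure pieces of degree [d], and pure
    pieces of degree [d + 1] for a node of degree [d]. *)
Definition weight (g : piece) : nat :=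
  match g with Pure _ _ d _ => d.*2 | Node _ d _ => d.*2.+1 end.

Definition pcols (g : piece) : seq col :=
  match g with Pure _ v _ x => [:: (v, x)] | Node a _ x => cellcols true a x end.

Definition wfp (g : piece) : Prop :=
  match g with
  | Pure e v d x => rsc x (lvert v) = x /\ mfil e d v x
  | Node a d x => [/\ mcoherent x, mlocated a x &
                      forall c, mfil (side c) d.+1 (lab c) (x c)]
  end.

Definition wfst (st : seq piece) : Prop := forall g, g \in st -> wfp g.

Definition stcols (st : seq piece) : seq col := flatten [seq pcols g | g <- st].

(** One piece is traded for at most as many lighter ones as there are corners.
    With this radix a single heavier piece outweighs all of them. *)
Definition radix := #|corner|.+1.

Definition measure (st : seq piece) : nat := (\sum_(g <- st) radix ^ weight g)%N.

Lemma wfst_cons g st : wfst (g :: st) <-> wfp g /\ wfst st.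
Proof.
split=> [wf|[wg ws] h]; last by rewrite inE => /orP[/eqP->|/ws].
by split=> [|h hs]; apply: wf; rewrite inE ?eqxx // hs orbT.
Qed.

Lemma wfst_cat st st' : wfst (st ++ st') <-> wfst st /\ wfst st'.
Proof.
split=> [wf|[wg ws] h]; last by rewrite mem_cat => /orP[/wg|/ws].
by split=> h hs; apply: wf; rewrite mem_cat hs ?orbT.
Qed.

Lemma wfst_perm st st' : perm_eq st st' -> wfst st -> wfst st'.
Proof. by move=> /perm_mem p wf g; rewrite -p; apply: wf. Qed.

Lemma wfc_stcols st : wfst st -> wfc (stcols st).
Proof.
move=> wf c /flatten_mapP[g gst]; have := wf g gst.
by case: g {gst} => [e v d x [xv _]|a d x [xc _ _]] /=; [rewrite inE => /eqP -> | apply: wfc_cellcols].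
Qed.

Lemma stcols_perm st st' : perm_eq st st' -> perm_eq (stcols st) (stcols st').
Proof. by move=> p; apply/perm_flatten/perm_map. Qed.

Lemma measure_perm st st' : perm_eq st st' -> measure st = measure st'.
Proof. by move=> p; apply: perm_big. Qed.

Lemma measure_cons g st : measure (g :: st) = (radix ^ weight g + measure st)%N.
Proof. exact: big_cons. Qed.

Lemma measure_cat st st' : measure (st ++ st') = (measure st + measure st')%N.
Proof. exact: big_cat. Qed.

Lemma arity_lt_radix e (a : cell H) : (arity e a < radix)%N.
Proof.
rewrite ltnS -{1}(card_ord (arity e a)); apply: (leq_card (@mk H e a)).
exact: mk_inj.
Qed.

Definition reducible (st : seq piece) : Prop :=
  exists st', [/\ wfst st', reach (stcols st) (stcols st') &
                  (measure st' < measure st)%N].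

(** * Spans of bounded weight *)

Section Minimal.
Variable st : seq piece.
Hypothesis st_wf : wfst st.
Hypothesis st_min : ~ reducible st.

Notation I := ('I_(size st)).
Definition piece_at (k : I) : piece := tnth (in_tuple st) k.

Lemma piece_at_mem k : piece_at k \in st. Proof. exact: mem_tnth. Qed.

Lemma piece_at_wf k : wfp (piece_at k). Proof. exact/st_wf/piece_at_mem. Qed.

Definition pick_pieces (s : seq I) : seq piece := map piece_at s.

Lemma st_enum : st = pick_pieces (enum I).
Proof.
rewrite /pick_pieces /piece_at; have := map_tnth_enum (in_tuple st).
by move=> ->.
Qed.

Lemma perm_st (s : seq I) : perm_eq (enum I) s -> perm_eq st (pick_pieces s).
Proof. by move=> p; rewrite {1}st_enum; apply: perm_map. Qed.

Definition others (k : I) : seq piece := pick_pieces (rem k (enum I)).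

Lemma perm_others k : perm_eq st (piece_at k :: others k).
Proof.
by apply: (@perm_st (k :: rem k (enum I))); apply: perm_to_rem; rewrite mem_enum.
Qed.

Lemma others_mem k j : j != k -> piece_at j \in others k.
Proof.
move=> jk; apply/mapP; exists j => //.
by rewrite mem_rem_uniq ?enum_uniq // inE jk mem_enum.
Qed.

Definition low (n : nat) : M -> Prop :=
  lspan (fun x => exists k v, (weight (piece_at k) < n)%N /\ (v, x) \in pcols (piece_at k)).

Lemma low_others k x : low (weight (piece_at k)) x -> colspan (stcols (others k)) x.
Proof.
apply: lspan_sub => y [j [v [wj yj]]]; apply: lspan_gen; exists v.
apply/flatten_mapP; exists (piece_at j) => //; apply: others_mem.
by apply: contraTneq wj => ->; rewrite ltnn.
Qed.

Lemma low_mono n n' x : (n <= n')%N -> low n x -> low n' x.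
Proof.
move=> nn'; apply: lspan_sub => y [j [v [wj yj]]]; apply: lspan_gen.
by exists j, v; split=> //; apply: leq_trans nn'.
Qed.

(** The column of the [k]-th piece if it is pure, of the given side and vertex,
    and of a degree in [P], and zero otherwise; this lets all combinations range
    over all pieces. *)
Definition pure_elt (e : bool) (v : V) (P : pred nat) (k : I) : M :=
  if piece_at k is Pure e' v' d x then if [&& e' == e, v' == v & P d] then x else 0 else 0.

Definition node_elt (a : cell H) (P : pred nat) (k : I) (c : corner) : M :=
  if piece_at k is Node a' d x then if (a' == a) && P d then x c else 0 else 0.

Lemma pure_elt_lab e v P k : rsc (pure_elt e v P k) (lvert v) = pure_elt e v P k.
Proof.
rewrite /pure_elt; have := piece_at_wf k; case: (piece_at k) => [e' v' d x [xv _]|a d x _]; last exact: rsc0l.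
by case: ifP => [/and3P[_ /eqP <- _]|_] //; rewrite rsc0l.
Qed.

Lemma pure_elt_fil e v (P : pred nat) k D : (forall d, P d -> d <= D)%N -> mfil e D v (pure_elt e v P k).
Proof.
move=> PD; rewrite /pure_elt; have := piece_at_wf k.
case: (piece_at k) => [e' v' d x [_ xf]|a d x _]; last exact: mfil0.
case: ifP => [/and3P[/eqP <- /eqP <- Pd]|_]; last exact: mfil0.
exact: mfil_mono (PD _ Pd) xf.
Qed.

Lemma pure_elt_low e v (P : pred nat) k n : (forall d, P d -> d.*2 < n)%N -> low n (pure_elt e v P k).
Proof.
move=> Pn; rewrite /pure_elt; case E: (piece_at k) => [e' v' d x|a d x]; last by left.
case: ifP => [/and3P[_ _ Pd]|_]; last by left.
by apply: lspan_gen; exists k, v'; rewrite E /= mem_head; split=> //; apply: Pn.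
Qed.

Lemma node_elt_coherent a P k : mcoherent (node_elt a P k).
Proof.
have := piece_at_wf k; rewrite /mcoherent /node_elt.
case: (piece_at k) => [e' v' d x _|a' d x [xc _ _]]; first exact: mcoherent0.
case: ((a' == a) && P d); [exact: xc | exact: mcoherent0].
Qed.

Lemma node_elt_located a P k : mlocated a (node_elt a P k).
Proof.
move=> c ca; have := piece_at_wf k; rewrite /node_elt.
case: (piece_at k) => [//|a' d x [_ xl _]]; case: ifP => // /andP[/eqP aa _].
by apply: xl; rewrite aa.
Qed.

Lemma node_elt_fil a (P : pred nat) k D c : (forall d, P d -> d <= D)%N ->
  mfil (side c) D.+1 (lab c) (node_elt a P k c).
Proof.
move=> PD; rewrite /node_elt; have := piece_at_wf k.
case: (piece_at k) => [e' v' d x _|a' d x [_ _ xf]]; first exact: mfil0.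
case: ifP => [/andP[_ Pd]|_]; last exact: mfil0.
by apply: mfil_mono (xf c); rewrite ltnS PD.
Qed.

Lemma node_elt_low a (P : pred nat) k n c : (forall d, P d -> d.*2.+1 < n)%N -> low n (node_elt a P k c).
Proof.
move=> Pn; rewrite (node_elt_coherent a P k true c); apply: lspan_sum => t /eqP st'.
apply: lspan_rsc; rewrite /node_elt; case E: (piece_at k) => [e' v' d x|a' d x]; first by left.
case: ifP => [/andP[_ Pd]|_]; last by left.
have [xc xl _] : wfp (Node a' d x) by rewrite -E; apply: piece_at_wf.
have [ta|ta] := eqVneq (cellof t) a'; last by rewrite xl //; left.
apply: lspan_gen; exists k, (lab t); rewrite E /=; split; first exact: Pn.
elim/corner_ind: t st' ta => e2 a2 i; rewrite /side /cellof /= => ? ?; subst.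
by apply/mapP; exists i; rewrite ?mem_enum.
Qed.

(** The span of the pieces up to a given weight, among the elements of a cell:
    combinations of nodes, plus elements all of whose columns on the side [e]
    lie in the span [C] of columns. *)
Definition node_span (C : bool -> V -> M -> Prop) (D : nat) (e : bool) (a : cell H)
    (x : corner -> M) : Prop :=
  exists (ka : I -> K) (x' : corner -> M),
    [/\ mcoherent x', mlocated a x',
        forall c, side c = e -> C e (lab c) (x' c) &
        forall c, x c = \sum_k ksc (ka k) (node_elt a (fun d => d <= D)%N k c) + x' c].

(** The same for columns at a vertex: pure pieces, plus columns of elements of
    cells that are spanned, one degree lower, from the other side. *)
Definition col_span (G : bool -> cell H -> (corner -> M) -> Prop) (D : nat) (e : bool)
    (v : V) (x : M) : Prop :=
  exists (ka : I -> K) (p : corner -> corner -> M),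
    (forall b, side b = e -> lab b = v -> G (~~ e) (cellof b) (p b)) /\
    x = \sum_k ksc (ka k) (pure_elt e v (fun d => d <= D.+1)%N k) +
        \sum_(b | (side b == e) && (lab b == v)) p b b.

(** [Cspan D e v] contains the expected leading terms of degree [D] on the side
    [e] at [v].  Words alternate between the sides, which is why the recursion
    passes to the other side. *)
Fixpoint Cspan (D : nat) : bool -> V -> M -> Prop :=
  if D is D'.+1 then col_span (node_span (Cspan D') D') D' else fun _ _ x => x = 0.

Definition Nspan (D : nat) := node_span (Cspan D) D.

Definition klin (P : M -> Prop) : Prop :=
  [/\ P 0, forall x y, P x -> P y -> P (x + y) & forall k x, P x -> P (ksc k x)].

Definition klinf (P : (corner -> M) -> Prop) : Prop :=
  [/\ P (fun _ => 0), forall x y, P x -> P y -> P (fun c => x c + y c) &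
      forall k x, P x -> P (fun c => ksc k (x c))].

Lemma node_span_lin C D e a : (forall v, klin (C e v)) -> klinf (node_span C D e a).
Proof.
move=> hC; split.
- exists (fun _ => 0), (fun _ => 0); split=> //; first exact: mcoherent0.
  + by move=> c _; case: (hC (lab c)).
  + by move=> c; rewrite addr0 big1 // => k _; rewrite ksc0.
- move=> x y [ka [x' [x1 x2 x3 x4]]] [kb [y' [y1 y2 y3 y4]]].
  exists (fun k => ka k + kb k), (fun c => x' c + y' c); split.
  + exact: mcoherentD.
  + by move=> c ca; rewrite x2 // y2 // addr0.
  + by move=> c sc; case: (hC (lab c)) => _ + _; apply; [apply: x3 | apply: y3].
  + move=> c; rewrite x4 y4 addrACA -big_split; congr (_ + _).
    by apply: eq_bigr => k _; rewrite kscDl.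
- move=> k x [ka [x' [x1 x2 x3 x4]]].
  exists (fun j => k * ka j), (fun c => ksc k (x' c)); split.
  + exact: mcoherent_ksc.
  + by move=> c ca; rewrite x2 // ksc0r.
  + by move=> c sc; case: (hC (lab c)) => _ _; apply; apply: x3.
  + move=> c; rewrite x4 kscDr ksc_sumr; congr (_ + _).
    by apply: eq_bigr => j _; rewrite kscA.
Qed.

Lemma col_span_lin G D e v : (forall a, klinf (G (~~ e) a)) -> klin (col_span G D e v).
Proof.
move=> hG; split.
- exists (fun _ => 0), (fun _ _ => 0); split; first by move=> b _ _; case: (hG (cellof b)).
  by rewrite big1 ?big1 ?addr0 // => k _; rewrite ksc0.
- move=> x y [ka [p [p1 p2]]] [kb [q [q1 q2]]].
  exists (fun k => ka k + kb k), (fun b c => p b c + q b c); split.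
    by move=> b sb lb; case: (hG (cellof b)) => _ + _; apply; [apply: p1 | apply: q1].
  rewrite p2 q2 addrACA -!big_split; congr (_ + _).
  by apply: eq_bigr => k _; rewrite kscDl.
- move=> k x [ka [p [p1 p2]]].
  exists (fun j => k * ka j), (fun b c => ksc k (p b c)); split.
    by move=> b sb lb; case: (hG (cellof b)) => _ _; apply; apply: p1.
  rewrite p2 kscDr !ksc_sumr; congr (_ + _).
  by apply: eq_bigr => j _; rewrite kscA.
Qed.

Lemma Cspan_lin D e v : klin (Cspan D e v).
Proof.
elim: D e v => [|D IHD] e v /=.
  by split=> [|x y -> ->|k x ->]; rewrite ?addr0 ?ksc0r.
by apply: col_span_lin => a; apply: node_span_lin => v'.
Qed.

Lemma Nspan_lin D e a : klinf (Nspan D e a).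
Proof. by apply: node_span_lin => v; apply: Cspan_lin. Qed.

Lemma Cspan_sum D e v (J : Type) (s : seq J) (P : pred J) (F : J -> M) :
  (forall i, P i -> Cspan D e v (F i)) -> Cspan D e v (\sum_(i <- s | P i) F i).
Proof. by case: (Cspan_lin D e v) => z a _ h; apply: big_ind. Qed.

Lemma klinf_sum (Q : (corner -> M) -> Prop) (J : finType) (P : pred J)
    (F : J -> corner -> M) : klinf Q ->
  (forall i, P i -> Q (F i)) -> Q (fun c => \sum_(i | P i) F i c).
Proof.
move=> [z a _] h; elim: (index_enum J) => [|i s IHs].
  by move: z; congr Q; apply: funext => c; rewrite big_nil.
have [Pi|Pi] := boolP (P i); last first.
  by move: IHs; congr Q; apply: funext => c; rewrite big_cons (negPf Pi).
have := a _ _ (h i Pi) IHs.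
by congr Q; apply: funext => c; rewrite big_cons Pi.
Qed.

Lemma Nspan_coherent D e a x : Nspan D e a x -> mcoherent x.
Proof.
move=> [ka [x' [x1 x2 x3 x4]]].
have -> : x = fun c => \sum_k ksc (ka k) (node_elt a (fun d => d <= D)%N k c) + x' c.
  exact: funext.
apply: mcoherentD => //; apply: mcoherent_sum => k _.
exact/mcoherent_ksc/node_elt_coherent.
Qed.

Lemma Nspan_located D e a x : Nspan D e a x -> mlocated a x.
Proof.
move=> [ka [x' [x1 x2 x3 x4]]] c ca; rewrite x4 x2 // addr0 big1 // => k _.
by rewrite node_elt_located // ksc0r.
Qed.

Lemma Cspan_lab D e v x : Cspan D e v x -> rsc x (lvert v) = x.
Proof.
case: D => [|D] /=; first by move=> ->; rewrite rsc0l.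
move=> [ka [p [p1 ->]]]; rewrite rscDl !rsc_suml; congr (_ + _).
  by apply: eq_bigr => k _; rewrite -ksc_rsc pure_elt_lab.
apply: eq_bigr => b /andP[/eqP sb /eqP lb]; rewrite -lb.
exact/mcoherent_lab/(Nspan_coherent (p1 b sb lb)).
Qed.

Lemma Nspan_fil_of D e a x : (forall v y, Cspan D e v y -> mfil e D v y) ->
  Nspan D e a x -> forall c, mfil (side c) D.+1 (lab c) (x c).
Proof.
move=> hC [ka [x' [x1 x2 x3 x4]]] c; rewrite x4; apply: mfilD.
  by apply: mfil_sum => k _; apply/mfil_ksc/node_elt_fil.
by apply: (mfil_other (e := e) x1 x2) => c' sc'; apply/hC/x3.
Qed.

Lemma Cspan_fil D e v x : Cspan D e v x -> mfil e D v x.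
Proof.
elim: D e v x => [|D IHD] e v x /=; first by move=> ->; apply: mfil0.
move=> [ka [p [p1 ->]]]; apply: mfilD.
  by apply: mfil_sum => k _; apply/mfil_ksc/pure_elt_fil.
apply: mfil_sum => b /andP[/eqP sb /eqP lb]; rewrite -sb -lb.
by apply: (Nspan_fil_of _ (p1 b sb lb)) => v' y; apply: IHD.
Qed.

Lemma Nspan_fil D e a x : Nspan D e a x -> forall c, mfil (side c) D.+1 (lab c) (x c).
Proof. by apply: Nspan_fil_of => v y; apply: Cspan_fil. Qed.

Lemma Nspan_low_of D e a x : (forall v y, Cspan D e v y -> low D.*2.+1 y) ->
  Nspan D e a x -> forall c, low D.*2.+2 (x c).
Proof.
move=> hC [ka [x' [x1 x2 x3 x4]]] c; rewrite x4; apply: lspanD.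
  apply: lspan_sum => k _; apply/lspan_ksc/node_elt_low => d dD.
  by rewrite !ltnS leq_double.
rewrite (x1 e); apply: lspan_sum => t /eqP st'; apply: lspan_rsc.
by apply: (low_mono (leqnSn _)); apply/hC/x3.
Qed.

Lemma Cspan_low D e v x : Cspan D e v x -> low D.*2.+1 x.
Proof.
elim: D e v x => [|D IHD] e v x; first by move=> /= ->; left.
move=> [ka [p [p1 ->]]]; apply: lspanD.
  apply: lspan_sum => k _; apply/lspan_ksc/pure_elt_low => d dD.
  by rewrite ltnS leq_double.
apply: lspan_sum => b /andP[/eqP sb /eqP lb].
apply: (low_mono (leqnSn _)); rewrite doubleS.
by apply: (Nspan_low_of _ (p1 b sb lb)) => v' y; apply: IHD.
Qed.

Lemma Nspan_low D e a x : Nspan D e a x -> forall c, low D.*2.+2 (x c).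
Proof. by apply: Nspan_low_of => v y; apply: Cspan_low. Qed.

(** * Reduction steps forbidden in a minimal state *)

Lemma contra_min st' : wfst st' -> reach (stcols st) (stcols st') ->
  (measure st <= measure st')%N.
Proof.
move=> wf r; rewrite leqNgt; apply/negP => lt; apply: st_min; exists st'; by split.
Qed.

Lemma reach_others k : reach (stcols st) (pcols (piece_at k) ++ stcols (others k)).
Proof.
apply: (reach_perm (wfc_stcols st_wf)); exact: (stcols_perm (perm_others k)).
Qed.

Lemma wfst_others k : wfst (others k).
Proof. by have /wfst_cons[_ w] := wfst_perm (perm_others k) st_wf. Qed.

Lemma measure_others k : measure st = (radix ^ weight (piece_at k) + measure (others k))%N.
Proof. by rewrite (measure_perm (perm_others k)) measure_cons. Qed.

(** A combination of pieces minus one of its terms involves the other pieces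
    only, as does everything of smaller weight. *)
Lemma comb_others (F : I -> M) (ka : I -> K) (n : nat) p k :
  (forall j, F j != 0 -> exists v, (v, F j) \in pcols (piece_at j)) ->
  low n p -> weight (piece_at k) = n ->
  colspan (stcols (others k)) (\sum_j ksc (ka j) (F j) + p - ksc (ka k) (F k)).
Proof.
move=> hF lp wk; rewrite (bigD1 k) //= -[X in X - _]addrA [X in X - _]addrC addrK.
apply: lspanD; last by apply: low_others; rewrite wk.
apply: lspan_sum => j jk; apply: lspan_ksc.
have [->|/hF [v vF]] := eqVneq (F j) 0; first by left.
apply: lspan_gen; exists v; apply/flatten_mapP; exists (piece_at j) => //.
exact: others_mem.
Qed.

Lemma radix_gt1 (k : I) : (1 < radix)%N.
Proof.
rewrite ltnS; case: (piece_at k) => [e v _ _|b _ _]; apply/card_gt0P.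
  by exists (vcorner e v).
by exists (base true b).
Qed.

(** In a minimal state a piece cannot be exchanged for a lighter one. *)
Lemma weight_min k g : wfp g ->
  reach (stcols st) (pcols g ++ stcols (others k)) -> (weight (piece_at k) <= weight g)%N.
Proof.
move=> wg r; have wf' : wfst (g :: others k) by apply/wfst_cons; split=> //; apply: wfst_others.
have := @contra_min (g :: others k) wf' r.
rewrite (measure_others k) measure_cons leq_add2r leq_exp2l //.
exact: radix_gt1.
Qed.

(** Otherwise a pure piece of degree [D + 1] with nonzero coefficient could be
    replaced by [x], which has degree [D]. *)
Lemma pure_min D e v (ka : I -> K) (x p : M) :
  x = \sum_k ksc (ka k) (pure_elt e v (pred1 D.+1) k) + p -> low D.+1.*2 p ->
  rsc x (lvert v) = x -> mfil e D v x -> x = p.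
Proof.
move=> xE lp xv fx; rewrite xE big1 ?add0r // => k _.
apply/eqP; apply/negPn/negP => nz.
have kk : ka k != 0 by apply: contraNneq nz => ->; rewrite ksc0.
have pk : pure_elt e v (pred1 D.+1) k != 0 by apply: contraNneq nz => ->; rewrite ksc0r.
have [y pcE] : exists y, piece_at k = Pure e v D.+1 y.
  move: pk; rewrite /pure_elt; case: (piece_at k) => [e' v' d y|]; last by rewrite eqxx.
  case: ifP => [/and3P[/eqP-> /eqP-> /= /eqP->] _|]; last by rewrite eqxx.
  by exists y.
have pelk : pure_elt e v (pred1 D.+1) k = y by rewrite /pure_elt pcE /= !eqxx.
have wk : weight (piece_at k) = D.+1.*2 by rewrite pcE.
have yfix : rsc y (lvert v) = y by have := piece_at_wf k; rewrite pcE => -[].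
have r1 := reach_others k; rewrite pcE /= in r1.
suff : (weight (piece_at k) <= weight (Pure e v D x))%N by rewrite wk /= leq_double ltnn.
apply: weight_min => //; apply: (reach_trans r1).
apply: (reach_replace (k := ka k)) => //; first exact: (reach_wfc r1).
rewrite -pelk xE; apply: (@comb_others (pure_elt e v (pred1 D.+1)) ka D.+1.*2) => // j nzj.
move: nzj; rewrite /pure_elt; case: (piece_at j) => [e' v' d z|]; last by rewrite eqxx.
case: ifP => _; last by rewrite eqxx.
by exists v'; rewrite mem_head.
Qed.

(** Otherwise a node with nonzero coefficient could be replaced by [x], and
    then by the columns of [x] on the side [e]: pure pieces of the same degree,
    which together weigh less than the node. *)
Lemma node_min D a (ka : I -> K) (x p : corner -> M) e :
  (forall c, x c = \sum_k ksc (ka k) (node_elt a (pred1 D) k c) + p c) ->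
  (forall c, low D.*2.+1 (p c)) -> mcoherent x -> mlocated a x ->
  (forall c, side c = e -> mfil e D (lab c) (x c)) -> forall c, x c = p c.
Proof.
move=> xE lp xc xl fx c; rewrite xE big1 ?add0r // => k _.
apply/eqP; apply/negPn/negP => nz.
have kk : ka k != 0 by apply: contraNneq nz => ->; rewrite ksc0.
have pk : node_elt a (pred1 D) k c != 0 by apply: contraNneq nz => ->; rewrite ksc0r.
have [y pcE] : exists y, piece_at k = Node a D y.
  move: pk; rewrite /node_elt; case: (piece_at k) => [|a' d y]; first by rewrite eqxx.
  case: ifP => [/andP[/eqP-> /= /eqP->] _|]; last by rewrite eqxx.
  by exists y.
have nelk c' : node_elt a (pred1 D) k c' = y c' by rewrite /node_elt pcE /= !eqxx.
have wk : weight (piece_at k) = D.*2.+1 by rewrite pcE.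
have [yc yl _] : wfp (Node a D y) by rewrite -pcE; apply: piece_at_wf.
have r1 := reach_others k; rewrite pcE /= in r1.
have r2 : reach (stcols st) (cellcols true a x ++ stcols (others k)).
  apply: (reach_trans r1).
  apply: (reach_replaces (vx := fun i => lab (@mk H true a i))
           (x := fun i => y (mk i)) (x' := fun i => x (mk i)) (k := ka k)) => //.
    exact: (reach_wfc r1).
  move=> i _; split; last exact: mcoherent_lab.
  rewrite -nelk xE; apply: (@comb_others (fun j => node_elt a (pred1 D) j (mk i)) ka D.*2.+1) => // j nzj.
  move: nzj; rewrite /node_elt; case: (piece_at j) => [|a' d z]; first by rewrite eqxx.
  case: ifP => [/andP[/eqP -> _] _|]; last by rewrite eqxx.
  by exists (lab (@mk H true a i)); apply/mapP; exists i; rewrite ?mem_enum.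
have r3 : reach (stcols st) (cellcols e a x ++ stcols (others k)).
  case: (e) => //; apply: (reach_trans r2); apply: (reach_flip true) => //.
  exact/wfc_stcols/wfst_others.
pose new := [seq Pure e (lab (@mk H e a i)) D (x (mk i)) | i : 'I_(arity e a)].
have wfnew : wfst (new ++ others k).
  apply/wfst_cat; split; last exact: wfst_others.
  move=> g /mapP[i _ ->]; split; first exact: mcoherent_lab.
  by apply: fx.
have newE : stcols (new ++ others k) = cellcols e a x ++ stcols (others k).
  rewrite /stcols map_cat flatten_cat; congr (_ ++ _).
  by rewrite /new -map_comp /cellcols /image_mem; elim: (enum _) => //= i s ->.
have := @contra_min (new ++ others k) wfnew; rewrite newE => /(_ r3).
rewrite (measure_others k) measure_cat leq_add2r wk.
have -> : measure new = (arity e a * radix ^ D.*2)%N.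
  by rewrite /measure /new big_map big_enum /= sum_nat_const card_ord.
rewrite expnS leq_pmul2r ?expn_gt0 // leqNgt; apply/negP/negPn.
exact: arity_lt_radix.
Qed.

Definition is_pure (e : bool) (D : nat) (k : I) : bool :=
  if piece_at k is Pure e' _ d _ then (e' == e) && (d == D) else false.

Definition pvert (v0 : V) (k : I) : V := if piece_at k is Pure _ v _ _ then v else v0.
Definition pcol (k : I) : M := if piece_at k is Pure _ _ _ x then x else 0.

Lemma pure_eltE v0 e v D k : is_pure e D k ->
  pure_elt e v (pred1 D) k = if pvert v0 k == v then pcol k else 0.
Proof.
rewrite /is_pure /pure_elt /pvert /pcol; case: (piece_at k) => [e' v' d x|//].
by move=> /andP[-> dD] /=; rewrite dD andbT.
Qed.

Lemma pure_elt_notpure e v D k : ~~ is_pure e D k -> pure_elt e v (pred1 D) k = 0.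
Proof.
rewrite /is_pure /pure_elt; case: (piece_at k) => [e' v' d x|//].
by case: (e' == e) => //= /negPf ->; rewrite andbF.
Qed.

(** If the coefficients of the columns of [x] at the pure pieces of top degree
    were independent, these columns could take the place of as many pure pieces
    of degree [D + 1], and then be listed as one node of degree [D].  The
    dependence is stated one vertex at a time, because pieces at different
    vertices do not combine. *)
Lemma pures_dependent D e a (x : corner -> M) (ka : corner -> I -> K) (p : corner -> M) :
  mcoherent x -> mlocated a x ->
  (forall c, mfil (side c) D.+1 (lab c) (x c)) ->
  (forall c, side c = e -> cellof c = a ->
     x c = \sum_k ksc (ka c k) (pure_elt e (lab c) (pred1 D.+1) k) + p c /\
     low D.+1.*2 (p c)) ->
  exists2 g : corner -> K,
    exists c, [/\ side c = e, cellof c = a & g c != 0] &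
    forall v, \sum_k ksc (\sum_(c | [&& side c == e, cellof c == a & lab c == v])
        g c * ka c k) (pure_elt e v (pred1 D.+1) k) = 0.
Proof.
move=> xc xl fx xE; apply: contrapT => nog.
pose v0 := labof (Ordinal (arity_gt0 e a)).
pose s := [seq k <- enum I | is_pure e D.+1 k].
pose r := [seq k <- enum I | ~~ is_pure e D.+1 k].
have pst : perm_eq st (pick_pieces s ++ pick_pieces r).
  rewrite /pick_pieces -map_cat; apply: perm_st.
  by rewrite perm_sym; apply/permPl/perm_filterC.
have Zwf := wfst_perm pst st_wf.
have /wfst_cat[swf rwf] := Zwf.
pose vx := pvert v0.
have scolE (u : seq I) : {subset u <= s} -> stcols (pick_pieces u) = [seq (vx k, pcol k) | k <- u].
  elim: u => //= k u IHu us; rewrite -IHu; last by move=> j ju; apply: us; rewrite inE ju orbT.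
  have : is_pure e D.+1 k by have := us k (mem_head _ _); rewrite mem_filter => /andP[].
  by rewrite /stcols /= /is_pure /vx /pvert /pcol; case: (piece_at k).
pose T := [seq ((lab (mk i), x (mk i)),
   fun k => if vx k == lab (mk i) then ka (mk i) k else 0) | i : 'I_(arity e a)].
pose i0 := Ordinal (arity_gt0 e a).
pose t0 := ((lab (mk i0), x (mk i0)) : col, fun k => if vx k == lab (mk i0) then ka (mk i0) k else 0).
have szT : size T = arity e a by rewrite size_map -cardE card_ord.
have nthT i (iT : (i < arity e a)%N) : nth t0 T i =
   ((lab (mk (Ordinal iT)), x (mk (Ordinal iT))),
   fun k => if vx k == lab (mk (Ordinal iT)) then ka (mk (Ordinal iT)) k else 0).
  rewrite /T (nth_map i0) ?size_enum_ord //.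
  by have -> : nth i0 (enum 'I_(arity e a)) i = Ordinal iT by apply: val_inj; rewrite /= nth_enum_ord.
have us : uniq s by rewrite filter_uniq // enum_uniq.
have sumE c : \sum_k ksc (ka c k) (pure_elt e (lab c) (pred1 D.+1) k) =
    \sum_(k <- s) ksc (if vx k == lab c then ka c k else 0) (pcol k).
  rewrite big_filter big_enum_cond /= [RHS]big_mkcond /=; apply: eq_bigr => k _.
  case: ifPn => [kp|kp]; last by rewrite pure_elt_notpure // ksc0r.
  by rewrite (pure_eltE v0) // -/(vx k); case: eqP => //; rewrite ksc0r ksc0.
have hT i : (i < size T)%N -> let t := nth t0 T i in
    [/\ rsc t.1.2 (lvert t.1.1) = t.1.2,
        forall k, k \in s -> t.2 k != 0 -> vx k = t.1.1 &
        colspan (stcols (pick_pieces r)) (t.1.2 - \sum_(k <- s) ksc (t.2 k) (pcol k))].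
  rewrite szT => iT; rewrite nthT /=; split; first exact: mcoherent_lab.
    by move=> k _; case: (vx k =P _) => [-> //|_]; rewrite eqxx.
  have [xE1 lp] := xE (mk (Ordinal iT)) erefl erefl.
  rewrite xE1 sumE addrAC subrr add0r; apply: lspan_sub lp => y [j [v [wj yj]]].
  apply: lspan_gen; exists v; apply/flatten_mapP; exists (piece_at j) => //.
  apply/mapP; exists j => //; rewrite mem_filter mem_enum andbT.
  apply: contraTN wj; rewrite /is_pure; case: (piece_at j) => // e' v' d z /andP[_ /eqP ->].
  by rewrite /= ltnn.
have indep (g : nat -> K) :
    (forall k, k \in s -> \sum_(i < size T) g i * (nth t0 T i).2 k = 0) ->
    forall i, (i < size T)%N -> g i = 0.
  rewrite szT => hg i iT; apply: contrapT => gi; apply: nog.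
  exists (fun c => g (posof c)); first by exists (mk (Ordinal iT)); split=> //; apply/eqP.
  move=> v; apply: big1 => k _.
  have [kp|kp] := boolP (is_pure e D.+1 k); last by rewrite pure_elt_notpure // ksc0r.
  rewrite (pure_eltE v0) // -/(vx k); case: eqP => [vk|]; last by rewrite ksc0r.
  rewrite (_ : \sum_(c | _) _ = 0) ?ksc0 //.
  have ks : k \in s by rewrite mem_filter kp mem_enum.
  rewrite -[RHS](hg k ks).
  transitivity (\sum_(c | (side c == e) && (cellof c == a))
      if vx k == lab c then g (posof c) * ka c k else 0).
    rewrite -big_mkcondr; apply: eq_bigl => c.
    by rewrite -andbA vk [v == _]eq_sym.
  rewrite sum_corners; apply: eq_bigr => j _; rewrite (nthT j (ltn_ord j)) /=.
  have -> : Ordinal (ltn_ord j) = j by apply: val_inj.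
  by case: ifP => _; rewrite ?mulr0.
have wf1 : wfc ([seq (vx k, pcol k) | k <- s] ++ stcols (pick_pieces r)).
  rewrite -scolE //; apply/wfc_cat; split; exact: wfc_stcols.
have [s' [ss' szs r1]] := @exchange K H m I vx pcol T t0 s (stcols (pick_pieces r)) us wf1 hT indep.
have fstT : [seq t.1 | t <- T] = cellcols e a x by rewrite /T -map_comp.
rewrite fstT -!scolE // in r1.
have r2 : reach (stcols st) (stcols (pick_pieces s) ++ stcols (pick_pieces r)).
  apply: (reach_perm (wfc_stcols st_wf)); rewrite /stcols -flatten_cat -map_cat.
  exact: stcols_perm.
have r3 : reach (stcols st) (stcols (Node a D x :: pick_pieces s' ++ pick_pieces r)).
  rewrite /stcols /= map_cat flatten_cat -!/(stcols _).
  apply: (reach_trans r2); move: r1; case: (e) => r1.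
    exact: r1.
  apply: (reach_trans r1).
  apply: (reach_flip false) => //; apply/wfc_cat; split; last exact: wfc_stcols.
  by apply: wfc_stcols => g /mapP[k /ss' ks ->]; apply/swf/map_f.
have wf3 : wfst (Node a D x :: pick_pieces s' ++ pick_pieces r).
  apply/wfst_cons; split=> //; apply/wfst_cat; split=> //.
  by move=> g /mapP[k /ss' ks ->]; apply/swf/map_f.
have := contra_min wf3 r3; rewrite (measure_perm pst) measure_cons !measure_cat addnA leq_add2r.
have mE u : {subset u <= s} -> measure (pick_pieces u) = (size u * radix ^ D.+1.*2)%N.
  elim: u => [|k u IHu] us'; first by rewrite /measure big_nil.
  rewrite /= measure_cons IHu; last by move=> j ju; apply: us'; rewrite inE ju orbT.
  have : is_pure e D.+1 k by have := us' k (mem_head _ _); rewrite mem_filter => /andP[].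
  by rewrite /is_pure mulSn; case: (piece_at k) => // e' v' d z /andP[_ /eqP ->].
rewrite !mE // szs szT mulnDl leq_add2r /= leqNgt => /negP; apply.
have : (radix ^ D.*2.+1 < radix ^ D.+1.*2)%N.
  rewrite ltn_exp2l // ?doubleS //; apply: (leq_trans _ (arity_lt_radix e a)).
  by rewrite ltnS arity_gt0.
by move=> /leq_trans; apply; rewrite leq_pmull // arity_gt0.
Qed.
(** * No drop of degree in a minimal state *)

Lemma pure_elt_split e v D (ka : I -> K) :
  \sum_k ksc (ka k) (pure_elt e v (fun d => d <= D.+1)%N k) =
  \sum_k ksc (ka k) (pure_elt e v (pred1 D.+1) k) +
  \sum_k ksc (ka k) (pure_elt e v (fun d => d <= D)%N k).
Proof.
rewrite -big_split /=; apply: eq_bigr => k _; rewrite -kscDr; congr ksc.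
rewrite /pure_elt; case: (piece_at k) => [e' v' d x|a d x]; last by rewrite addr0.
case: (e' == e) => /=; last by rewrite addr0.
case: (v' == v) => /=; last by rewrite addr0.
rewrite leq_eqVlt ltnS; case: eqP => [->|_] /=; last by rewrite add0r.
by rewrite ltnn addr0.
Qed.

Lemma node_elt_split a D (ka : I -> K) c :
  \sum_k ksc (ka k) (node_elt a (fun d => d <= D.+1)%N k c) =
  \sum_k ksc (ka k) (node_elt a (pred1 D.+1) k c) +
  \sum_k ksc (ka k) (node_elt a (fun d => d <= D)%N k c).
Proof.
rewrite -big_split /=; apply: eq_bigr => k _; rewrite -kscDr; congr ksc.
rewrite /node_elt; case: (piece_at k) => [e' v' d x|a' d x]; first by rewrite addr0.
case: (a' == a) => /=; last by rewrite addr0.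
rewrite leq_eqVlt ltnS; case: eqP => [->|_] /=; last by rewrite add0r.
by rewrite ltnn addr0.
Qed.

Lemma pure_elt_le e v D D' (ka : I -> K) : (D <= D')%N -> exists kb : I -> K,
  \sum_k ksc (ka k) (pure_elt e v (fun d => d <= D)%N k) =
  \sum_k ksc (kb k) (pure_elt e v (fun d => d <= D')%N k).
Proof.
move=> DD'.
exists (fun k => if piece_at k is Pure _ _ d _ then if (d <= D)%N then ka k else 0 else 0).
apply: eq_bigr => k _; rewrite /pure_elt; case: (piece_at k) => [e' v' d x|]; last by rewrite !ksc0r.
case: (e' == e) => /=; last by rewrite !ksc0r.
case: (v' == v) => /=; last by rewrite !ksc0r.
case: ifP => dD; first by rewrite (leq_trans dD DD').
by rewrite ksc0 ksc0r.
Qed.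

Lemma node_elt_le a D D' (ka : I -> K) : (D <= D')%N -> exists kb : I -> K, forall c,
  \sum_k ksc (ka k) (node_elt a (fun d => d <= D)%N k c) =
  \sum_k ksc (kb k) (node_elt a (fun d => d <= D')%N k c).
Proof.
move=> DD'.
exists (fun k => if piece_at k is Node _ d _ then if (d <= D)%N then ka k else 0 else 0) => c.
apply: eq_bigr => k _; rewrite /node_elt; case: (piece_at k) => [|a' d x]; first by rewrite !ksc0r.
case: (a' == a) => /=; last by rewrite !ksc0r.
case: ifP => dD; first by rewrite (leq_trans dD DD').
by rewrite ksc0 ksc0r.
Qed.

Lemma Nspan_mono_of D D' e a x : (D <= D')%N -> (forall v y, Cspan D e v y -> Cspan D' e v y) ->
  Nspan D e a x -> Nspan D' e a x.
Proof.
move=> DD' hC [ka [x' [x1 x2 x3 x4]]]; have [kb kbE] := node_elt_le a ka DD'.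
exists kb, x'; split=> //; first by move=> c sc; apply/hC/x3.
by move=> c; rewrite x4 kbE.
Qed.

Lemma Cspan_monoS D e v x : Cspan D e v x -> Cspan D.+1 e v x.
Proof.
elim: D e v x => [|D IHD] e v x.
  by move=> ->; case: (Cspan_lin 1 e v).
move=> [ka [p [p1 ->]]]; have [kb kbE] := pure_elt_le e v ka (leqnSn D.+1).
exists kb, p; split; last by rewrite kbE.
by move=> b sb lb; apply: (Nspan_mono_of (leqnSn D) _ (p1 b sb lb)) => v' y; apply: IHD.
Qed.

Lemma Cspan_mono D D' e v x : (D <= D')%N -> Cspan D e v x -> Cspan D' e v x.
Proof.
move=> /subnK <-; elim: (D' - D)%N => [//|k IHk] Cx; rewrite addSn.
exact/Cspan_monoS/IHk.
Qed.

Lemma Nspan_nodes D e a (ka : I -> K) :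
  Nspan D e a (fun c => \sum_k ksc (ka k) (node_elt a (fun d => d <= D)%N k c)).
Proof.
exists ka, (fun _ => 0); split=> //; first exact: mcoherent0.
  by move=> c _; case: (Cspan_lin D e (lab c)).
by move=> c; rewrite addr0.
Qed.

Lemma Nspan_family D e a (x : corner -> M) : mcoherent x -> mlocated a x ->
  (forall c, side c = e -> Cspan D e (lab c) (x c)) -> Nspan D e a x.
Proof.
move=> xc xl xC; exists (fun _ => 0), x; split=> // c.
by rewrite big1 ?add0r // => k _; rewrite ksc0.
Qed.

Lemma Nspan_flip_Cspan D e a x : Nspan D (~~ e) a x ->
  forall c, side c = e -> Cspan D.+1 e (lab c) (x c).
Proof.
move=> Gx c sc; have [ca|ca] := eqVneq (cellof c) a; last first.
  by rewrite (Nspan_located Gx ca); case: (Cspan_lin D.+1 e (lab c)).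
exists (fun _ => 0), (fun b c' => if b == c then x c' else 0); split.
  move=> b _ _; have [->|bc] := eqVneq b c; first by rewrite ca.
  by case: (Nspan_lin D (~~ e) (cellof b)).
rewrite big1 ?add0r => [|k _]; last by rewrite ksc0.
rewrite (bigD1 c) ?sc ?eqxx //= big1 ?addr0 // => b /andP[_ /negPf ->].
by [].
Qed.

(** The columns of a spanned element are spanned on both sides, at the cost of
    one degree. *)
Lemma Nspan_Cspan D e a x : Nspan D e a x -> forall c, Cspan D.+1 (side c) (lab c) (x c).
Proof.
move=> Gx c; have [se|se] := eqVneq (side c) e; last first.
  have eE : e = ~~ side c by case: (e) (side c) se => [] [].
  by rewrite eE in Gx; apply: Nspan_flip_Cspan Gx c erefl.
move: Gx => [ka [x' [x1 x2 x3 x4]]]; rewrite x4.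
have [_ cadd _] := Cspan_lin D.+1 (side c) (lab c); apply: cadd.
  exact: (Nspan_flip_Cspan (@Nspan_nodes D (~~ side c) a ka) erefl).
by rewrite se; apply/Cspan_monoS/x3.
Qed.

(** A spanned column of smaller degree than its span suggests lies in the span
    of smaller degree. *)
Definition strict_col D e := forall v x, Cspan D.+1 e v x -> mfil e D v x -> Cspan D e v x.

(** The same for elements of cells, where the leading term on one side is
    measured by the degree on the other side. *)
Definition strict_node D e := forall a x, Nspan D.+1 e a x ->
  (forall c, side c = ~~ e -> mfil (~~ e) D.+1 (lab c) (x c)) ->
  exists y z, [/\ Nspan D e a y, Nspan D (~~ e) a z & x = fun c => y c + z c].

Lemma strict_col0 e : strict_col 0 e.
Proof.
move=> v x Cx fx /=; exact: (mfil_eq0 (Cspan_lab Cx) fx).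
Qed.

(** By [pure_min] no pure piece of top degree occurs.  By [fil_free] the
    elements of cells whose columns occur then drop in degree one by one, so
    that [strict_node] applies to each of them. *)
Lemma strict_colS D e : strict_node D (~~ e) -> strict_col D.+1 e.
Proof.
move=> hS v x Cx fx; have xv := Cspan_lab Cx; move: Cx => [ka [p [p1 xE]]].
rewrite pure_elt_split -addrA in xE.
have {}p1 b : side b = e -> lab b = v -> Nspan D.+1 (~~ e) (cellof b) (p b) := p1 b.
pose q := \sum_(b | (side b == e) && (lab b == v)) p b b.
have plow : low D.+2.*2 (\sum_k ksc (ka k) (pure_elt e v (fun d => (d <= D.+1)%N) k) + q).
  apply: lspanD.
    apply: lspan_sum => k _; apply/lspan_ksc/pure_elt_low => d dD.
    by rewrite ltn_double ltnS.
  apply: lspan_sum => b /andP[/eqP sb /eqP lb]; rewrite doubleS.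
  exact: (@Nspan_low D.+1 (~~ e) (cellof b) (p b) (p1 b sb lb) b).
have {}xE := pure_min xE plow xv fx.
have fq : mfil e D.+1 v q.
  have -> : q = x - \sum_k ksc (ka k) (pure_elt e v (fun d => (d <= D.+1)%N) k).
    by rewrite xE addrAC subrr add0r.
  by apply: mfilB => //; apply: mfil_sum => k _; apply/mfil_ksc/pure_elt_fil.
have fp := mfil_free (e := e) (d := D.+1) (v := v) (p := p) _ fq.
rewrite xE; have [_ cadd _] := Cspan_lin D.+1 e v; apply: cadd.
  exists ka, (fun _ _ => 0); split; last by rewrite [X in _ + X]big1 ?addr0.
  by move=> b _ _; case: (Nspan_lin D (~~ e) (cellof b)).
apply: Cspan_sum => b /andP[/eqP sb /eqP lb].
have [||y [z [Gy Gz pE]]] := hS (cellof b) (p b).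
- exact: p1.
- rewrite negbK => c sc; apply: fp => // b' sb' lb'.
  by have Gb := p1 b' sb' lb'; split; [apply: Nspan_coherent Gb | apply: Nspan_located Gb | apply: Nspan_fil Gb].
rewrite pE -sb -lb; have [_ cadd' _] := Cspan_lin D.+1 (side b) (lab b); apply: cadd'.
  exact: Nspan_Cspan Gy b.
exact: Nspan_Cspan Gz b.
Qed.

(** By [node_min] no node of top degree occurs.  The rest [x'] has columns on
    the side [e] which combine pure pieces of top degree and columns of elements
    of cells spanned from the other side.  A linear relation between the
    coefficients of the pure pieces, given by [pures_dependent], yields a
    combination of columns of [x'] and of columns of those elements in which the
    pure pieces no longer occur; [fil_free] then shows that [x'] agrees, up to
    smaller degree, with an element [z] spanned from the other side.  The columns of the difference drop in degree, and
    [strict_col] applies to them. *)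
Lemma strict_nodeS D e : strict_col D e -> strict_node D e.
Proof.
move=> hSC a x Gx fx; have xc := Nspan_coherent Gx; have xl := Nspan_located Gx.
move: (Gx) => [ka [x' [x1 x2 x3 x4]]].
pose nd c := \sum_k ksc (ka k) (node_elt a (fun d => (d <= D)%N) k c).
have Gnd : Nspan D e a nd by exact: Nspan_nodes.
have xE : forall c, x c = nd c + x' c.
  apply: (node_min (D := D.+1) (a := a) (ka := ka) (e := ~~ e)) => //.
    by move=> c; rewrite x4 node_elt_split -addrA.
  move=> c; apply: lspanD; first exact: (low_mono _ (Nspan_low Gnd c)).
  rewrite (x1 e); apply: lspan_sum => t /eqP st'; apply: lspan_rsc.
  exact/Cspan_low/x3.
have f1 c : mfil (side c) D.+1 (lab c) (x' c).
  have [se|se] := eqVneq (side c) e; first by rewrite se; apply/Cspan_fil/x3.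
  have seE : side c = ~~ e by case: (e) (side c) se => [] [].
  have -> : x' c = x c - nd c by rewrite xE addrC addKr.
  by apply: mfilB; [rewrite seE; apply: fx | apply: Nspan_fil Gnd c].
have /choice [kc hkc] : forall c, exists kc : (I -> K) * (corner -> corner -> M),
    side c = e -> (forall b, side b = e -> lab b = lab c -> Nspan D (~~ e) (cellof b) (kc.2 b)) /\
    x' c = \sum_k ksc (kc.1 k) (pure_elt e (lab c) (fun d => d <= D.+1)%N k) +
        \sum_(b | (side b == e) && (lab b == lab c)) kc.2 b b.
  move=> c; have [se|se] := eqVneq (side c) e; last by exists (fun _ => 0, fun _ _ => 0) => /eqP; rewrite (negPf se).
  by have [k1 [p1 [p2 p3]]] := x3 c se; exists (k1, p1).
pose lo c := \sum_k ksc ((kc c).1 k) (pure_elt e (lab c) (fun d => d <= D)%N k).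
pose pq c := \sum_(b | (side b == e) && (lab b == lab c)) (kc c).2 b b.
have x'E c : side c = e ->
    x' c = \sum_k ksc ((kc c).1 k) (pure_elt e (lab c) (pred1 D.+1) k) + (lo c + pq c).
  by move=> sc; have [_ ->] := hkc c sc; rewrite pure_elt_split -addrA.
have [|g [c0 [sc0 cc0 gc0]] gE] := @pures_dependent D e a x' (fun c => (kc c).1) (fun c => lo c + pq c) x1 x2 f1.
  move=> c sc cc; split; first exact: x'E.
  apply: lspanD.
    apply: lspan_sum => k _; apply/lspan_ksc/pure_elt_low => d dD.
    by rewrite ltn_double ltnS.
  apply: lspan_sum => b /andP[/eqP sb /eqP lb]; rewrite doubleS.
  by have [h _] := hkc c sc; apply: (Nspan_low (h b sb lb)).
pose v := lab c0.
pose A c := [&& side c == e, cellof c == a & lab c == v].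
have AP c : A c -> [/\ side c = e, cellof c = a & lab c = v].
  by move=> /and3P[/eqP -> /eqP -> /eqP ->].
pose Pb b c := \sum_(c' | A c') ksc (g c') ((kc c').2 b c).
have GPb b : side b = e -> lab b = v -> Nspan D (~~ e) (cellof b) (Pb b).
  move=> sb lb; apply: klinf_sum; first exact: Nspan_lin.
  move=> c' /AP[sc' _ lc']; have [_ _ gz] := Nspan_lin D (~~ e) (cellof b); apply: gz.
  by have [h _] := hkc c' sc'; apply: h => //; rewrite lc'.
(* The pure pieces of top degree cancel in the sum of the [Q b b]; collecting
   the columns by the corner at which they are taken prepares [fil_free]. *)
pose Q b c := (if A b then ksc (g b) (x' c) else 0) - Pb b c.
have hQ b : side b = e -> lab b = v ->
     [/\ mcoherent (Q b), mlocated (cellof b) (Q b) &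
         forall c, mfil (side c) D.+1 (lab c) (Q b c)].
  move=> sb lb; have GP := GPb b sb lb; split.
  - apply: mcoherentB; last exact: Nspan_coherent GP.
    by case: (A b); [apply: mcoherent_ksc | apply: mcoherent0].
  - move=> c cb; rewrite /Q (Nspan_located GP cb) subr0; case: ifP => // /AP[_ ba _].
    by rewrite x2 ?ksc0r // -ba.
  - move=> c; apply: mfilB; last exact: Nspan_fil GP c.
    by case: (A b); [apply/mfil_ksc/f1 | apply: mfil0].
have fQ : mfil e D v (\sum_(b | (side b == e) && (lab b == v)) Q b b).
  have -> : \sum_(b | (side b == e) && (lab b == v)) Q b b =
      \sum_(c | A c) ksc (g c) (lo c).
    rewrite sumrB -big_mkcondr /=.
    rewrite (eq_bigl A); last first.
      by move=> b; rewrite /A; case: (side b == e) (lab b == v) (cellof b == a) => [] [] [].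
    have -> : \sum_(b | (side b == e) && (lab b == v)) Pb b b = \sum_(c | A c) ksc (g c) (pq c).
      rewrite exchange_big; apply: eq_bigr => c /AP[_ _ lc].
      by rewrite -ksc_sumr /pq lc.
    rewrite -sumrB.
    transitivity (\sum_(c | A c) (ksc (g c) (\sum_k ksc ((kc c).1 k) (pure_elt e v (pred1 D.+1) k)) + ksc (g c) (lo c))).
      apply: eq_bigr => c /AP[sc _ lc]; rewrite (x'E c sc) lc !kscDr addrA addrK.
      by [].
    rewrite big_split /=; rewrite (_ : \sum_(c | A c) _ = 0) ?add0r //.
    rewrite -[RHS](gE v); under eq_bigr do rewrite ksc_sumr.
    rewrite exchange_big; apply: eq_bigr => k _; rewrite ksc_suml.
    by apply: eq_bigr => c _; rewrite kscA.
  apply: mfil_sum => c /AP[_ _ <-]; apply: mfil_ksc; apply: mfil_sum => k _.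
  exact/mfil_ksc/pure_elt_fil.
have fQ0 := mfil_free hQ fQ sc0 erefl.
have Ac0 : A c0 by rewrite /A sc0 cc0 !eqxx.
(* As [g c0] is nonzero, the bound for [Q c0] solves for [x'] up to smaller
   degree. *)
pose z c := ksc (g c0)^-1 (Pb c0 c).
have Gz : Nspan D (~~ e) a z.
  have [_ _ gz] := Nspan_lin D (~~ e) a; apply: gz; rewrite -cc0; exact: GPb.
pose y c := x' c - z c.
have Gy : Nspan D e a y.
  apply: Nspan_family.
  - by apply: mcoherentB => //; apply: Nspan_coherent Gz.
  - by move=> c ca; rewrite /y x2 // (Nspan_located Gz ca) subr0.
  - move=> c sc; apply: hSC.
      have [_ cadd cz] := Cspan_lin D.+1 e (lab c); apply: cadd; first exact: x3.
      by rewrite -kscN1; apply: cz; apply: Nspan_flip_Cspan Gz c sc.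
    have := mfil_ksc (g c0)^-1 (fQ0 c sc); rewrite /Q Ac0 kscBr kscA mulVf // ksc1.
    by [].
have [_ gadd _] := Nspan_lin D e a.
exists (fun c => nd c + y c), z; split=> //; first exact: gadd.
by apply: funext => c; rewrite xE /y -addrA subrK.
Qed.

Lemma strict_minimal D e : strict_col D e.
Proof.
elim: D e => [|D IHD] e; first exact: strict_col0.
exact/strict_colS/strict_nodeS/IHD.
Qed.

(** Nodes may be counted on either side.  Once they are all counted on the
    first, the degree of each of the two parts is bounded by that of the other
    and of the sum. *)
Lemma strict_both D a y z :
  Nspan D.+1 true a y -> Nspan D.+1 false a z ->
  (forall c, mfil (side c) D.+1 (lab c) (y c + z c)) ->
  exists y' z', [/\ Nspan D true a y', Nspan D false a z' &
    (fun c => y c + z c) = fun c => y' c + z' c].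
Proof.
move=> Gy Gz fyz; move: (Gz) => [ka [z' [z1 z2 z3 z4]]].
pose nd c := \sum_k ksc (ka k) (node_elt a (fun d => (d <= D.+1)%N) k c).
(* All nodes are counted on the side [true]. *)
pose y1 c := y c + nd c.
have Gy1 : Nspan D.+1 true a y1.
  by have [_ gadd _] := Nspan_lin D.+1 true a; apply: gadd => //; apply: Nspan_nodes.
have Gz' : Nspan D.+1 false a z' by exact: Nspan_family.
have yzE c : y c + z c = y1 c + z' c by rewrite z4 addrA.
have [|u1 [u2 [Gu1 Gu2 y1E]]] := strict_nodeS (@strict_minimal D true) Gy1.
  move=> c sc; have -> : y1 c = (y c + z c) - z' c by rewrite yzE addrK.
  apply: mfilB; first by have := fyz c; rewrite sc.
  by apply/Cspan_fil/z3; rewrite sc.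
have [|w1 [w2 [Gw1 Gw2 z'E]]] := strict_nodeS (@strict_minimal D false) Gz'.
  move=> c sc; have -> : z' c = (y c + z c) - (u1 c + u2 c).
    by rewrite yzE y1E addrC addKr.
  apply: mfilB; first by have := fyz c; rewrite sc.
  have f1 := Nspan_fil (c := c) Gu1; have f2 := Nspan_fil (c := c) Gu2.
  by apply: mfilD; [move: f1 | move: f2]; rewrite sc.
have [_ ga _] := Nspan_lin D true a; have [_ gb _] := Nspan_lin D false a.
exists (fun c => u1 c + w2 c), (fun c => u2 c + w1 c); split.
- exact: ga.
- exact: gb.
- by apply: funext => c; rewrite yzE y1E z'E /= [w1 c + _]addrC addrACA.
Qed.

Lemma strict_zero D a y z :
  Nspan D true a y -> Nspan D false a z ->
  (forall c, mfil (side c) 1 (lab c) (y c + z c)) ->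
  exists y' z', [/\ Nspan 0 true a y', Nspan 0 false a z' &
    (fun c => y c + z c) = fun c => y' c + z' c].
Proof.
elim: D y z => [|D IHD] y z Gy Gz f1; first by exists y, z.
have [|y' [z' [Gy' Gz' E1]]] := strict_both Gy Gz.
  by move=> c; apply: mfil_mono (f1 c).
rewrite E1; apply: IHD => // c.
by have := congr1 (fun f : corner -> M => f c) E1 => /= <-.
Qed.
Lemma trans_elt_Nspan D q x : Cspan D (side q) (lab q) x ->
  Nspan D (side q) (cellof q) (fun u => rsc x (trans_elt K q u)).
Proof.
move=> Cx; apply: Nspan_family; first exact: mcoherent_rsc_trans_elt.
  by move=> c cq; rewrite trans_elt_cell ?rsc0 // eq_sym.
move=> c sc; rewrite trans_elt_same //; case: eqP => [<-|_].
  by rewrite (Cspan_lab Cx).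
by rewrite rsc0; case: (Cspan_lin D (side q) (lab c)).
Qed.

Lemma trans_elt_Cspan D q x : Cspan D (side q) (lab q) x ->
  forall u, Cspan D.+1 (side u) (lab u) (rsc x (trans_elt K q u)).
Proof. by move=> Cx u; apply: Nspan_Cspan (trans_elt_Nspan Cx) u. Qed.

Lemma Cspan_flip D e e' v x : Cspan D e v x -> Cspan D.+1 e' v x.
Proof.
move=> Cx; have := @trans_elt_Cspan D (vcorner e v) x Cx (vcorner e' v).
by rewrite trans_elt_vcorner eqxx (Cspan_lab Cx).
Qed.

(** The span of all the pieces, without a bound on the weight. *)
Definition reachedC v x := exists D, Cspan D true v x.

Lemma reachedC0 v : reachedC v 0. Proof. by exists 0%N. Qed.

Lemma reachedCD v x y : reachedC v x -> reachedC v y -> reachedC v (x + y).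
Proof.
move=> [D Cx] [D' Cy]; exists (maxn D D').
have [_ cadd _] := Cspan_lin (maxn D D') true v; apply: cadd.
  exact: Cspan_mono (leq_maxl _ _) Cx.
exact: Cspan_mono (leq_maxr _ _) Cy.
Qed.

Lemma reachedC_ksc v k x : reachedC v x -> reachedC v (ksc k x).
Proof. by move=> [D Cx]; exists D; case: (Cspan_lin D true v) => _ _; apply. Qed.

Lemma reachedC_sum v (J : finType) (P : pred J) (F : J -> M) :
  (forall i, P i -> reachedC v (F i)) -> reachedC v (\sum_(i | P i) F i).
Proof. by move=> h; apply: big_ind => //; [exact: reachedC0 | exact: reachedCD]. Qed.

Lemma reachedC_Cspan D e v x : Cspan D e v x -> reachedC v x.
Proof. by move=> Cx; exists D.+1; apply: Cspan_flip Cx. Qed.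

Lemma reachedC_lab v x : reachedC v x -> rsc x (lvert v) = x.
Proof. by move=> [D /Cspan_lab]. Qed.

(** The union of the spans is stable under the generators of the algebra,
    because a generator enters a cell on one side and leaves it on the other
    ([trans_elt_Cspan]). *)
Lemma reachedC_mul v x y w : reachedC v x -> reachedC w (rsc (rsc x y) (lvert w)).
Proof.
elim/lpa_ind: y => t; elim: t v x w => [u|h i j|h i j||t IHt u IHu|k t IHt|t IHt u IHu] v x w Ax.
- rewrite -/(lvert u) -(reachedC_lab Ax) !rscA lvertM.
  case: (u =P w) => [<-|_]; last by rewrite mulr0 rsc0; apply: reachedC0.
  rewrite lvertM; case: (v =P u) => [<-|_]; last by rewrite rsc0; apply: reachedC0.
  by rewrite reachedC_lab.
- have [vs|vs] := eqVneq v (hsrc i); last first.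
    rewrite -(reachedC_lab Ax) -/(ledge i j) -lsrc_edge !rscA !mulrA lvertM (negPf vs) !mul0r rsc0.
    exact: reachedC0.
  have [wr|wr] := eqVneq w (hrng j); last first.
    rewrite -/(ledge i j) -ledge_rng !rscA -mulrA lvertM eq_sym (negPf wr) mulr0 rsc0.
    exact: reachedC0.
  rewrite -/(ledge i j) wr rscA ledge_rng; subst v; have [D Cx] := Ax.
  have := @trans_elt_Cspan D (@mk H true (inr h) i) x Cx (@mk H false (inr h) j).
  by rewrite (@trans_elt_trans K H true (inr h) i j); apply: reachedC_Cspan.
- have [vs|vs] := eqVneq v (hrng j); last first.
    rewrite -(reachedC_lab Ax) -/(lstar i j) -lrng_star !rscA !mulrA lvertM (negPf vs) !mul0r rsc0.
    exact: reachedC0.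
  have [wr|wr] := eqVneq w (hsrc i); last first.
    rewrite -/(lstar i j) -lstar_src !rscA -mulrA lvertM eq_sym (negPf wr) mulr0 rsc0.
    exact: reachedC0.
  rewrite -/(lstar i j) wr rscA lstar_src; subst v; have [D Cx] := Ax.
  have := @trans_elt_Cspan D.+1 (@mk H false (inr h) j) x (Cspan_flip false Cx) (@mk H true (inr h) i).
  by rewrite (@trans_elt_trans K H false (inr h) j i); apply: reachedC_Cspan.
- by rewrite lpi_zero rsc0 rsc0l; apply: reachedC0.
- by rewrite lpi_add rscDr rscDl; apply: reachedCD; [apply: IHt Ax | apply: IHu Ax].
- have -> : rsc (rsc x (lpi (TScale k t))) (lvert w) = ksc k (rsc (rsc x (lpi t)) (lvert w)).
    by apply/matrixP => a b; rewrite kscE !rscE lpi_scale -lpaZAr -lpaZAl.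
  exact/reachedC_ksc/(IHt _ _ _ Ax).
- have -> : rsc (rsc x (lpi (TMul t u))) (lvert w) =
    \sum_v' rsc (rsc (rsc (rsc x (lpi t)) (lvert v')) (lpi u)) (lvert w).
    by rewrite -!rsc_suml -rsc_sumr -lpa_oneE rsc1 !rscA lpi_mul mulrA.
  by apply: reachedC_sum => v' _; apply: (IHu v'); apply: IHt Ax.
Qed.

Lemma pcols_reachedC k v x : (v, x) \in pcols (piece_at k) -> reachedC v x.
Proof.
have E1 (F : I -> M) : \sum_j ksc (if j == k then 1 else 0) (F j) = F k.
  by rewrite (bigD1 k) //= eqxx ksc1 big1 ?addr0 // => j /negPf ->; rewrite ksc0.
case pE: (piece_at k) => [e' v' d x'|a d y] /=.
  rewrite inE => /eqP[-> ->]; apply: (@reachedC_Cspan d.+1 e').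
  exists (fun j => if j == k then 1 else 0), (fun _ _ => 0); split.
    by move=> b _ _; case: (Nspan_lin d (~~ e') (cellof b)).
  by rewrite E1 big1 ?addr0 // /pure_elt pE !eqxx /= leqnSn.
move=> /mapP[i _ [-> ->]]; apply: (@reachedC_Cspan d.+1 true).
have := @Nspan_Cspan d true a _ (Nspan_nodes d true a (fun j => if j == k then 1 else 0)) (mk i).
by rewrite E1 /node_elt pE eqxx leqnn.
Qed.

Lemma colspan_reachedC p w : colspan (stcols st) p -> reachedC w (rsc p (lvert w)).
Proof.
elim=> [|x y p' [v xv] _ IH]; first by rewrite rsc0l; apply: reachedC0.
rewrite rscDl; apply: reachedCD => //; apply: (@reachedC_mul v).
have /flatten_mapP[g gst xg] := xv.
have /tnthP[k gk] : g \in in_tuple st by [].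
by apply: (@pcols_reachedC k); rewrite /piece_at -gk.
Qed.

(** Descending with [strict_zero] leaves the span of weight zero, in which no
    pure piece occurs. *)
Lemma degree_zero v x : rsc x (lvert v) = x -> colspan (stcols st) x ->
  (forall e, mfil e 1 v x) ->
  exists ka : I -> K, x = \sum_k ksc (ka k) (node_elt (inl v) (fun d => d <= 0)%N k (vcorner true v)).
Proof.
move=> xv sx fx; have [D] := colspan_reachedC v sx; rewrite xv => Cx.
have Gx := @trans_elt_Nspan D (vcorner true v) x Cx.
have Gz : Nspan D false (inl v) (fun _ => 0) by case: (Nspan_lin D false (inl v)).
have [|y [z [Gy Gz' E1]]] := strict_zero Gx Gz.
  move=> c; rewrite addr0 trans_elt_vcorner; case: eqP => [cv|_]; last by rewrite rsc0; apply: mfil0.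
  by rewrite xv (vcornerP cv) lab_vcorner.
have {E1} xE : x = y (vcorner true v) + z (vcorner true v).
  have := congr1 (fun f : corner -> M => f (vcorner true v)) E1.
  by rewrite /= trans_elt_diag lab_vcorner xv addr0.
move: Gy Gz' => [ka [y' [y1 y2 y3 y4]]] [kb [z' [z1 z2 z3 z4]]].
exists (fun k => ka k + kb k); rewrite xE y4 z4.
have -> : y' (vcorner true v) = 0 by apply: y3.
have -> : z' (vcorner true v) = 0.
  rewrite (z1 false) big1 // => t /eqP st'.
  by have -> : z' t = 0 by [exact: z3]; rewrite rsc0l.
rewrite !addr0 -big_split; apply: eq_bigr => k _; by rewrite kscDl.
Qed.

(** * Recovering the unit columns from a minimal state *)

Section Units.
Variables (v0 : V) (sg : 'I_m -> V).

Definition unitcol (i : 'I_m) : M := \col_j (if j == i then lvert (sg i) else 0).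

Lemma unitcol_lab i : rsc (unitcol i) (lvert (sg i)) = unitcol i.
Proof.
apply/matrixP => a b; rewrite rscE !mxE; case: ifP => _; last by rewrite mul0r.
by rewrite lvertM eqxx.
Qed.

Lemma unitcol_fil e i : mfil e 1 (sg i) (unitcol i).
Proof.
move=> a; rewrite mxE; case: ifP => _; [exact: fil_vert | exact: fil0].
Qed.

Definition unitcols : seq col := [seq (sg i, unitcol i) | i : 'I_m].

Definition is_zero (k : I) : bool := if piece_at k is Node (inl _) 0 _ then true else false.
Definition zvert (k : I) : V := if piece_at k is Node (inl v) _ _ then v else v0.
Definition zcol (k : I) : M := if piece_at k is Node (inl v) _ y then y (vcorner true v) else 0.

Lemma node_elt_zero v k : node_elt (inl v) (fun d => d <= 0)%N k (vcorner true v) =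
  if is_zero k && (zvert k == v) then zcol k else 0.
Proof.
rewrite /node_elt /is_zero /zvert /zcol; case: (piece_at k) => [//|[v'|h] [|d] y] /=.
- by rewrite andbT -[inl v' == inl v]/(v' == v); case: eqP => [->|].
- by rewrite andbF.
- by [].
- by [].
Qed.

(** Unit columns are [K]-combinations of nodes of degree zero at vertices, and
    independent since the vertices are nonzero in the algebra; so they can be
    exchanged for such nodes. *)
Lemma minimal_units : (forall i, colspan (stcols st) (unitcol i)) ->
  exists rest, reach (stcols st) (unitcols ++ rest).
Proof.
move=> hspan.
have /choice[ka kaE] := fun i => degree_zero (unitcol_lab i) (hspan i) (fun e => @unitcol_fil e i).
pose s := [seq k <- enum I | is_zero k].
pose r := [seq k <- enum I | ~~ is_zero k].
have pst : perm_eq st (pick_pieces s ++ pick_pieces r).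
  rewrite /pick_pieces -map_cat; apply: perm_st.
  by rewrite perm_sym; apply/permPl/perm_filterC.
have /wfst_cat[swf rwf] := wfst_perm pst st_wf.
have scolE (u : seq I) : {subset u <= s} -> stcols (pick_pieces u) = [seq (zvert k, zcol k) | k <- u].
  elim: u => //= k u IHu us; rewrite -IHu; last by move=> j ju; apply: us; rewrite inE ju orbT.
  have : is_zero k by have := us k (mem_head _ _); rewrite mem_filter => /andP[].
  rewrite /stcols /= /is_zero /zvert /zcol; case: (piece_at k) => // -[v|//] [|//] y _ /=.
  rewrite /cellcols /image_mem enum_ordSl enum_ord0 /=; congr ((_, _) :: _).
  by congr y; rewrite [LHS](@vcornerP _ _ v).
pose T := [seq ((sg i, unitcol i) : col, fun k => if zvert k == sg i then ka i k else 0) | i : 'I_m].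
have szT : size T = m by rewrite size_map -cardE card_ord.
have nthT t0 i (im : (i < m)%N) : nth t0 T i =
   ((sg (Ordinal im), unitcol (Ordinal im)), fun k => if zvert k == sg (Ordinal im) then ka (Ordinal im) k else 0).
  rewrite /T (nth_map (Ordinal im)) ?size_enum_ord //.
  have -> : nth (Ordinal im) (enum 'I_m) i = Ordinal im by apply: val_inj; rewrite /= nth_enum_ord.
  by [].
have us : uniq s by rewrite filter_uniq // enum_uniq.
have uE i : unitcol i = \sum_(k <- s) ksc (if zvert k == sg i then ka i k else 0) (zcol k).
  rewrite {1}kaE big_filter big_enum_cond /= [RHS]big_mkcond /=; apply: eq_bigr => k _.
  by rewrite node_elt_zero; case: (is_zero k) => /=; case: (zvert k == sg i); rewrite ?ksc0r ?ksc0.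
have wf1 : wfc ([seq (zvert k, zcol k) | k <- s] ++ stcols (pick_pieces r)).
  rewrite -scolE //; apply/wfc_cat; split; exact: wfc_stcols.
pose t0 : col * (I -> K) := ((v0, 0), fun _ => 0).
have hT i : (i < size T)%N -> let t := nth t0 T i in
    [/\ rsc t.1.2 (lvert t.1.1) = t.1.2,
        forall k, k \in s -> t.2 k != 0 -> zvert k = t.1.1 &
        colspan (stcols (pick_pieces r)) (t.1.2 - \sum_(k <- s) ksc (t.2 k) (zcol k))].
  rewrite szT => im; rewrite nthT /=; split; first exact: unitcol_lab.
    by move=> k _; case: (zvert k =P _) => [-> //|_]; rewrite eqxx.
  by rewrite -uE subrr; left.
have indep (g : nat -> K) :
    (forall k, k \in s -> \sum_(i < size T) g i * (nth t0 T i).2 k = 0) ->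
    forall i, (i < size T)%N -> g i = 0.
  rewrite szT => hg i im.
  have S0 : \sum_(j < m) ksc (g j) (unitcol j) = 0.
    under eq_bigr do rewrite uE ksc_sumr.
    rewrite exchange_big /= big_seq big1 // => k ks.
    under eq_bigr do rewrite kscA.
    rewrite -ksc_suml (_ : \sum_(j < m) _ = 0) ?ksc0 // -[RHS](hg k ks).
    apply: eq_bigr => j _; rewrite (nthT _ j (ltn_ord j)) /=.
    by have -> : Ordinal (ltn_ord j) = j by apply: val_inj.
  have := congr1 (fun A : M => A (Ordinal im) 0) S0; rewrite summxE mxE.
  rewrite (bigD1 (Ordinal im)) //= big1 ?addr0; last first.
    move=> j ji; rewrite kscE mxE eq_sym (negPf ji); exact: scaler0.
  rewrite kscE mxE eqxx => /eqP; rewrite scaler_eq0 (negPf (lvert_neq0 K _)) orbF.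
  by move=> /eqP.
have [s' [ss' szs r1]] := @exchange K H m I zvert zcol T t0 s (stcols (pick_pieces r)) us wf1 hT indep.
have fstT : [seq t.1 | t <- T] = unitcols by rewrite /T -map_comp.
rewrite fstT -scolE // in r1.
exists ([seq (zvert k, zcol k) | k <- s'] ++ stcols (pick_pieces r)).
apply: reach_trans r1.
apply: (reach_perm (wfc_stcols st_wf)); rewrite /stcols -flatten_cat -map_cat.
exact: stcols_perm.
Qed.

End Units.
End Minimal.
End States.

(** * Reaching the unit columns *)

Section Normalisation.
Variables (K : fieldType) (H : hypergraph) (m : nat).
Notation V := (vertex H).
Notation L := (lpa K H).
Notation M := ('cV[L]_m).
Notation col := (vcolumn K H m).

(** The matrix can be read off for any presentation of the two lists as
    tuples. *)
Lemma reach_tuple n n' (t : n.-tuple col) (t' : n'.-tuple col) : reach t t' ->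
  exists2 G, gen_mx (wdt t) (wdt t') G & mxt t' = mxt t *m G.
Proof.
case: t t' => [s e] [s' e'] /= /reach_in_tuple.
have E := eqP e; have E' := eqP e'; subst n n'.
rewrite (_ : Tuple e = in_tuple s); last exact: val_inj.
by rewrite (_ : Tuple e' = in_tuple s'); last exact: val_inj.
Qed.

Lemma reach_colspan (cs ds : seq col) p : wfc cs -> reach cs ds ->
  colspan cs p -> colspan ds p.
Proof.
move=> wf /reach_in_tuple[G /gen_GL[GM [B [BM GB BG]]] dE].
apply: lspan_sub => x [v xcs]; have /tnthP[k kE] : (v, x) \in in_tuple cs by [].
have cE : mxt (in_tuple cs) = mxt (in_tuple ds) *m B.
  rewrite dE -mulmxA GB /Imx mul_mx_diag; apply/matrixP => i j; rewrite !mxE tnth_wdt.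
  by rewrite -rscE wfc_tnth.
have -> : x = \sum_l rsc (tnth (in_tuple ds) l).2 (B l k).
  apply/matrixP => i j; rewrite ord1 summxE.
  have := congr1 (fun A : 'M_(_, _) => A i k) cE; rewrite !mxE -kE /= => ->.
  by apply: eq_bigr => l _; rewrite rscE !mxE.
apply: lspan_sum => l _; apply/lspan_rsc/lspan_gen.
by exists (tnth (in_tuple ds) l).1; rewrite -surjective_pairing; apply: mem_tnth.
Qed.

(** A list of columns is a state with pure pieces only; reduce it to a minimal
    one, by induction on the measure. *)
Lemma reach_unitcols (v0 : V) (sg : 'I_m -> V) (cs : seq col) : wfc cs ->
  (forall i, colspan cs (unitcol K sg i)) ->
  exists rest, reach cs (unitcols K sg ++ rest).
Proof.
move=> wf hspan; have /choice[d dE] := fun x : M => mfil_exists x.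
pose st0 := [seq Pure true c.1 (d c.2) c.2 | c <- cs].
have st0E : stcols st0 = cs.
  by rewrite /stcols /st0 -map_comp; elim: (cs) => //= -[v x] s ->.
have wf0 : wfst st0 by move=> g /mapP[c ccs ->]; split; [apply: wf | apply: dE].
rewrite -st0E in wf hspan *; move: st0 {st0E} wf0 wf hspan => st.
have [n] := ubnP (measure st); elim: n st => // n IHn st /ltnSE mn wfs wf hspan.
have [[st' [wf' r lt]]|nred] := pselect (reducible st); last exact: minimal_units.
have hspan' i : colspan (stcols st') (unitcol K sg i) by exact: reach_colspan r (hspan i).
have [rest r'] := IHn st' (leq_trans lt mn) wf' (wfc_stcols wf') hspan'.
by exists rest; apply: reach_trans r'.
Qed.

End Normalisation.

Section Generators.
Variables (K : fieldType) (H : hypergraph).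
Notation V := (vertex H).
Notation L := (lpa K H).

(** After the unit columns have been reached nothing else is left in the list,
    for a further column would be a combination of them, whereas the columns of
    an invertible matrix are independent. *)
Lemma GL_gen m n (t : m.+1.-tuple V) (s : n.-tuple V) (A : 'M[L]_(m.+1, n)) :
  in_GL t s A -> exists2 G, gen_mx s t G & A *m G = Imx K t.
Proof.
move=> [AM [B [BM AB BA]]].
have [tA As] := (iffLR (in_MP _ _ _) AM).
pose sg := tnth t.
pose cs := [tuple (tnth s k, col k A) | k < n].
pose us := [tuple (sg i, unitcol K sg i) | i < m.+1].
have csA : mxt cs = A by apply/matrixP => i j; rewrite !mxE tnth_mktuple mxE.
have wcs : wdt cs = s by apply: eq_from_tnth => i; rewrite tnth_wdt tnth_mktuple.
have usI : mxt us = Imx K t.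
  apply/matrixP => i j; rewrite !mxE tnth_mktuple !mxE.
  by case: eqP => [->|]; rewrite ?mulr1n ?mulr0n.
have wus : wdt us = t by apply: eq_from_tnth => i; rewrite tnth_wdt tnth_mktuple.
have wf : wfc cs.
  move=> c /tnthP[k ->]; rewrite -tnth_wdt wcs tnth_mktuple /=.
  apply/matrixP => i j; rewrite rscE !mxE.
  by have := congr1 (fun C : 'M_(_, _) => C i k) As; rewrite /Imx mul_mx_diag !mxE.
have hspan i : colspan cs (unitcol K sg i).
  have -> : unitcol K sg i = \sum_k rsc (col k A) (B k i).
    apply/matrixP => a b; rewrite summxE.
    transitivity ((A *m B) a i); first by rewrite AB !mxE; case: eqP => [->|]; rewrite ?mulr1n ?mulr0n.
    by rewrite mxE; apply: eq_bigr => k _; rewrite rscE !mxE.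
  apply: lspan_sum => k _; apply/lspan_rsc/lspan_gen; exists (tnth s k).
  by apply/tnthP; exists k; rewrite tnth_mktuple.
have [rest r] := reach_unitcols (sg ord0) wf hspan.
(* A further column [x] of the matrix [N] is also [N] times the column whose
   entries at the unit columns are those of [x] and which is zero below;
   multiplication by the inverse of [N] makes a vertex zero. *)
have rest0 : rest = [::].
  have [G gG usE] := @reach_tuple K H m.+1 n _ cs (cat_tuple us (in_tuple rest)) r.
  apply/nilP; rewrite /nilp -leqn0 leqNgt; apply/negP => rest_gt0.
  rewrite wcs in gG; set ws := wdt (cat_tuple us (in_tuple rest)) in gG.
  have [NM [N' [N'M NN' N'N]]] : in_GL t ws (A *m G).
    by apply: in_GL_mul (gen_GL gG); split=> //; exists B.
  rewrite -csA -usE in NM N'N NN'; set N := mxt _ in NM N'N NN'.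
  pose l : 'I_(m.+1 + size rest) := rshift m.+1 (Ordinal rest_gt0).
  pose x := col l N.
  have tx : Imx K t *m x = x by rewrite /x colE mulmxA (iffLR (in_MP _ _ _) NM).1.
  have xE : N *m col_mx x 0 = x by rewrite /N mxt_cat mul_row_col mulmx0 addr0 usI tx.
  have E1 : N' *m x = Imx K ws *m col_mx x 0 by rewrite -N'N -mulmxA xE.
  have E2 : N' *m x = col l (Imx K ws) by rewrite /x !colE mulmxA N'N.
  have := congr1 (fun C : 'cV_(_) => C l 0) (etrans (esym E2) E1).
  rewrite /Imx mul_diag_mx [RHS]mxE col_mxEd [X in _ * X]mxE mulr0 !mxE eqxx mulr1n.
  by move/eqP; rewrite (negPf (lvert_neq0 K _)).
rewrite rest0 cats0 in r.
have [G gG usE] := @reach_tuple K H m.+1 n _ cs us r.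
by exists G; [rewrite -wcs -wus | rewrite -csA -usE usI].
Qed.

End Generators.

(** * Inverses in a generated subgroupoid *)

Section GroupoidInverse.
Variables (G : groupoid) (S : forall x y : gobj G, ghom x y -> Prop).

Lemma ginv_unique (x y : gobj G) (f : ghom x y) (h : ghom y x) :
  gcomp h f = gid x -> h = ginv f.
Proof. by move=> hf; rewrite -[LHS]gcompf1 -(gcompfV f) gcompA hf gcomp1f. Qed.

Lemma gen_hom_ginv (x y : gobj G) (f : ghom x y) : gen_hom S f -> gen_hom S (ginv f).
Proof.
elim=> {x y f} [x y f Sf|x y f Sf|x y z g f _ IHg _ IHf]; first exact: gen_inv.
  by rewrite -(ginv_unique (gcompfV f)); apply: gen_base.
rewrite -(@ginv_unique _ _ (gcomp g f) (gcomp (ginv f) (ginv g))); first exact: gen_comp.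
by rewrite -gcompA (gcompA (ginv g)) gcompVf gcomp1f gcompVf.
Qed.

End GroupoidInverse.

(** * From matrices to morphisms *)

Section Generation.
Variables (K : fieldType) (H : hypergraph).
Notation V := (vertex H).
Notation L := (lpa K H).

(** Objects of the groupoid are nonempty words, whereas the generated matrices
    include those with empty words; for these nothing is claimed. *)
Definition generated m n : m.-tuple V -> n.-tuple V -> 'M[L]_(m, n) -> Prop :=
  match m, n return m.-tuple V -> n.-tuple V -> 'M[L]_(m, n) -> Prop with
  | m'.+1, n'.+1 => fun s t A => forall A_GL : `[< in_GL s t A >],
      gen_hom (G := GLgroupoid K H) (@EFP K H)
        (exist _ A A_GL : GLhom K (existT _ n' t) (existT _ m' s))
  | _, _ => fun _ _ _ => True
  end.

(** A product through the empty word is impossible: the identity matrix of a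
    nonempty word would vanish. *)
Lemma gen_generated m n (s : m.-tuple V) (t : n.-tuple V) (A : 'M[L]_(m, n)) :
  gen_mx s t A -> generated s t A.
Proof.
elim=> {m n s t A} [n s A sA|m n s t A sA|n s t A sA|m n p s t r A B gA IHA gB IHB].
- case: n s A sA => [//|n] s A sA A_GL; apply/gen_base.
  exact: (@EFP_E K H (existT _ n s)).
- case: m s A sA => [//|m] s A; case: n t A => [//|n] t A sA A_GL; apply/gen_base.
  exact: (@EFP_F K H (existT _ n t) (existT _ m s)).
- case: n s t A sA => [//|n] s t A sA A_GL; apply/gen_base.
  exact: (@EFP_P K H n t s).
- move: (gen_GL gA) (gen_GL gB) IHA IHB => {gA gB} glA glB.
  case: m s A glA => [//|m] s A glA; case: p r B glB => [//|p] r B glB.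
  case: n t A B glA glB => [|n] t A B glA glB.
    case: glA => _ [A' [_ AA' _]] _ _; exfalso.
    have := congr1 (fun C : 'M_(_, _) => C ord0 ord0) AA'.
    rewrite !mxE big_ord0 eqxx mulr1n => /esym/eqP.
    by rewrite (negPf (lvert_neq0 K _)).
  move=> /= IHA IHB AB_GL.
  have := gen_comp (IHA (asboolT glA)) (IHB (asboolT glB)).
  by congr (gen_hom _ _); apply: val_inj.
Qed.

End Generation.

Theorem theorem5p10 (K : fieldType) (H : hypergraph) :
  generates (G := GLgroupoid K H) (@EFP K H).
Proof.
split=> [s|s t f].
  by left; exists s, (GLid K s); apply: EFP_E; apply: in_E_one.
have [G gG fG] := GL_gen (GLhomP f).
have G_GL := asboolT (gen_GL gG).
pose g : GLhom K t s := exist _ G G_GL.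
have fg : gcomp (f : @ghom (GLgroupoid K H) s t) g = gid t by apply: val_inj.
rewrite (ginv_unique fg); apply: gen_hom_ginv.
case: s t f G gG fG G_GL @g fg => [n s] [m t] f G gG fG G_GL g fg.
exact: (gen_generated gG).
Qed.
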